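(* Let $X$, $\psi$, $\{a_j\}$, $\{m_j\}$, $\{b_{jk}\}$ and $\delta_{jk}$ be as in the context, and let $\overline\delta_j^{(2,m_j)}:=\frac1{m_j}\sum_{k=1}^{m_j}\delta_{jk}^2$. Assume that for all $j\in\mathbb N$ and $(k,l)\in\mathbb Z^2$, $b_{jk}-b_{jl}=\gamma_j(k-l)$, where $\{\gamma_j\}$ is a sequence of positive reals with $\lim_{j\to+\infty}a_j/\gamma_j=c\in(0,+\infty)$ and $\lim_{j\to+\infty}m_j^2\big(\gamma_j/a_j-1/c\big)=0$, and assume $\lim_{j\to+\infty}m_ja_j^{-4}=0$. Then, as $j\to+\infty$, the random variables \[ \overline Y_j:=\sqrt{m_j}\Big(\overline\delta_j^{(2,m_j)}-s_0^{-4\alpha}\int_{\mathbb R}|\widehat\psi(\eta)|^2d\eta\Big) \] converge in distribution to a centred Gaussian random variable with variance \[ \mathcal V_1:=4c\pi s_0^{-8\alpha}\int_{-c\pi}^{c\pi}\Big|\sum_{n\in\mathbb Z}|\widehat\psi(\eta+2nc\pi)|^2\Big|^2d\eta . \]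
   Context: Standing setting. $X(t)$, $t\in\mathbb R$, is a measurable mean-square continuous real-valued stationary zero-mean Gaussian process whose spectral density is $f(\lambda)=h(\lambda)/|\lambda^2-s_0^2|^{2\alpha}$, where $s_0>1$, $\alpha\in(0,1/2)$, and $h$ is an even, non-negative, bounded, four times continuously differentiable function with $h^{(i)}(0)=0$ for $i=1,2,3,4$, $h(0)=1$, $h>0$ in some neighbourhood of $\pm s_0$, and $\int_{\mathbb R}h(\lambda)(1+|\lambda|)^{-\varepsilon}d\lambda<\infty$ for every $\varepsilon>0$. $\psi\in L_1(\mathbb R)$ is real-valued with Fourier transform $\widehat\psi(\lambda)=\int_{\mathbb R}e^{-i\lambda t}\psi(t)\,dt$ supported in $[-A,A]$ for some $A>0$ and of bounded variation on $[-A,A]$. $\{a_j\}$ is an unbounded strictly increasing sequence of positive reals, $\{m_j\}$ an unboundedly increasing sequence of positive integers, $\{b_{jk}\}_{(j,k)\in\mathbb N\times\mathbb Z}$ an array of reals. $\delta_{jk}:=a_j^{-1/2}\int_{\mathbb R}\psi\big((t-b_{jk})/a_j\big)X(t)\,dt$. *)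

(* Defs.v *)
From HB Require Import structures.
From mathcomp Require Import all_boot all_order all_algebra.
From mathcomp Require Import all_classical all_reals all_analysis.
Set Implicit Arguments. Unset Strict Implicit. Unset Printing Implicit Defensive.
Import Order.TTheory GRing.Theory Num.Theory.
Import numFieldNormedType.Exports.
Local Open Scope classical_set_scope.
Local Open Scope ring_scope.

Section defs.
Context {R : realType}.
Notation leb := (@lebesgue_measure R).

Definition RintR (f : R -> R) : R := Rintegral leb [set: R] f.

(** Fourier transform  psihat(l) = int e^{-i l t} psi(t) dt = FTre l - i FTim l *)
Definition FTre (psi : R -> R) (l : R) : R := RintR (fun t => cos (l * t) * psi t).
Definition FTim (psi : R -> R) (l : R) : R := RintR (fun t => sin (l * t) * psi t).
Definition FTabs2 (psi : R -> R) (l : R) : R := FTre psi l ^+ 2 + FTim psi l ^+ 2.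

(** sum over n in Z of a (nonnegative) family, as limit of symmetric partial sums *)
Definition sumZ (u : int -> R) : R :=
  limn (fun N : nat => \sum_(0 <= k < N) (u (Posz k) + u (- Posz k.+1)%R)).

Definition spec_dens (h : R -> R) (s0 alpha : R) (l : R) : R :=
  h l / (`| l ^+ 2 - s0 ^+ 2 | `^ (2 * alpha)).

Definition gauss_law (m v : R) : set R -> \bar R :=
  if 0 < v then normal_prob m (Num.sqrt v) else fun A => ((\1_A m)%:E).

Definition gauss_expect (v : R) (g : R -> R) : \bar R :=
  if 0 < v then (\int[leb]_(x in [set: R]) (g x * normal_pdf 0 (Num.sqrt v) x)%:E)%E
  else (g 0)%:E.
End defs.

Section prob.
Context {R : realType} {d : measure_display} {T : measurableType d}.

Definition is_gaussian_rv (P : probability T R) (Y : T -> R) : Prop :=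
  exists m v : R, 0 <= v /\
    forall A : set R, measurable A -> P (Y @^-1` A) = gauss_law m v A.

Definition gaussian_process (P : probability T R) (X : R -> T -> R) : Prop :=
  forall (n : nat) (t c : 'I_n -> R),
    is_gaussian_rv P (fun w => \sum_(i < n) c i * X (t i) w).

Definition cvg_law_gauss (P : probability T R) (Y : nat -> T -> R) (v : R) : Prop :=
  forall g : R -> R, continuous g -> (exists M : R, forall x, `|g x| <= M) ->
    ('E_P[g \o Y j])%E @[j --> \oo] --> gauss_expect v g.
End prob.

Section wavelet.
Context {R : realType} {T : Type}.
Definition wcoef (psi : R -> R) (X : R -> T -> R) (a : nat -> R)
  (b : nat -> int -> R) (j : nat) (k : int) (w : T) : R :=
  (Num.sqrt (a j))^-1 * RintR (fun t => psi ((t - b j k) / a j) * X t w).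
End wavelet.

(* Main.v *)
(* Fix j and write Z_k = delta_jk, G for the covariance matrix of the Z_k, m for
   their number, Q = sum_k Z_k^2 and R = Z' G Z.  Gaussian integration by parts
   gives E[Q f(Q)] = tr G E[f(Q)] + 2 E[R f'(Q)].  Applied to the bounded solution
   f of Stein's equation v f'(x) - x f(x) = g(x) - E g(N(0,v)), it bounds
   |E g(Y) - E g(N(0,v))| by three quantities: |2 tr G^2 / m - v|, the standard
   deviation of 2 R / m, whose square is 8 tr G^4 / m^2, and the bias
   sqrt m (tr G / m - t).  The matrix G is Toeplitz, with spectral density
   f(e / a) |psihat(e)|^2 in the frequency e.  Since f(x) = f(0) + O(x^2), replacing
   f(e / a) by f(0) costs O(a^-2), which settles the bias.  Since
   |sum_k u_k e^(ikx)|^2 has integral 2 pi |u|^2 over a period, the operator norm of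
   G is bounded, hence tr G^4 = O(tr G^2) = O(m).  Finally 2 tr G^2 / m converges
   by Fejer's theorem, after folding the line onto one period, which turns
   |psihat|^2 into its periodisation. *)

(* The coefficients are pathwise integrals of a process whose finite linear combinations alone have
   a known law. A vector of them is therefore handled only through the characteristic functions of
   its linear forms, and integration by parts is built on these: differentiating them gives the
   identity for sines and cosines, trigonometric algebra extends it to polynomials in bounded
   approximations of the squares, and limits reach f(Q). The covariance matrix may be singular
   throughout.

   The two rate assumptions enter through the entries of G, each compared with that of a matrix with
   constant density f(0) and exact step 1/c; the error has to beat sqrt m. For the density this is m
   a^-4 -> 0. Changing the step moves a phase by at most m A |gamma/a - 1/c|, and sqrt m <= m leads
   to the condition with m^2.

   The limit variance v may be zero, for instance when psihat vanishes. The solution of Stein's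
   equation divides by v, so a second-moment bound replaces it in that case. *)
Require Import Defs.
From HB Require Import structures.
From mathcomp Require Import all_boot all_order all_algebra.
From mathcomp Require Import all_classical all_reals all_analysis.
From mathcomp Require Import measurable_realfun ring lra.
Import Order.TTheory GRing.Theory Num.Theory.
Import numFieldNormedType.Exports HBSimple.
Set Implicit Arguments. Unset Strict Implicit. Unset Printing Implicit Defensive.
Local Open Scope classical_set_scope.
Local Open Scope ring_scope.

(** * Integrals of real-valued functions *)

Notation Rintegrable mu f := (integrable mu [set: _] (EFin \o f)).

Lemma cvgn_squeeze (R : realType) (u v : nat -> R) (l : R) :
  (forall n, `|u n - l| <= v n) -> v n @[n --> \oo] --> 0 -> u n @[n --> \oo] --> l.
Proof.
move=> h /cvgrPdist_le v0; apply/cvgrPdist_le => e e0.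
apply: filterS (v0 e e0) => n; rewrite sub0r normrN distrC => hn.
by rewrite (le_trans (h n))// (le_trans (ler_norm _)).
Qed.

Section real_integral.
Context d (T : measurableType d) (R : realType).
Variable mu : {measure set T -> \bar R}.
Implicit Types f g : T -> R.

Lemma Rintegrable_measurable f : Rintegrable mu f -> measurable_fun setT f.
Proof. by move=> /measurable_int; move/measurable_EFinP. Qed.

Lemma le_Rintegrable f g : measurable_fun setT f ->
  (forall x, `|f x| <= g x) -> Rintegrable mu g -> Rintegrable mu f.
Proof.
move=> mf fg; apply: le_integrable => //; first exact/measurable_EFinP.
by move=> x _; rewrite /= lee_fin (le_trans (fg x))// ler_norm.
Qed.

Lemma RintegrableD f g : Rintegrable mu f -> Rintegrable mu g ->
  Rintegrable mu (fun x => f x + g x).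
Proof. by move=> fi gi; have := integrableD measurableT fi gi. Qed.

Lemma RintegrableB f g : Rintegrable mu f -> Rintegrable mu g ->
  Rintegrable mu (fun x => f x - g x).
Proof. by move=> fi gi; have := integrableB measurableT fi gi. Qed.

Lemma RintegrableZ k f : Rintegrable mu f -> Rintegrable mu (fun x => k * f x).
Proof. by move=> fi; have := integrableZl measurableT k fi. Qed.

Lemma Rintegrable_norm f : Rintegrable mu f -> Rintegrable mu (fun x => `|f x|).
Proof. exact: integrable_norm. Qed.

Lemma Rintegrable_sum (I : Type) (s : seq I) (P : pred I) (F : I -> T -> R) :
  (forall i, P i -> Rintegrable mu (F i)) ->
  Rintegrable mu (fun x => \sum_(i <- s | P i) F i x).
Proof.
move=> h.
rewrite [X in integrable _ _ X](_ : _ =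
   (fun x => \sum_(i <- s | P i) (F i x)%:E)%E); last first.
  by apply/funext => x /=; rewrite sumEFin.
exact: integrable_sum.
Qed.

Lemma Rintegral_sum (I : Type) (s : seq I) (P : pred I) (F : I -> T -> R) :
  (forall i, P i -> Rintegrable mu (F i)) ->
  \int[mu]_x (\sum_(i <- s | P i) F i x) =
  \sum_(i <- s | P i) \int[mu]_x F i x.
Proof.
move=> h; elim: s => [|i s IH].
  under eq_Rintegral do rewrite big_nil.
  by rewrite big_nil /Rintegral integral0.
under eq_Rintegral do rewrite big_cons.
rewrite big_cons; case: ifPn => // Pi.
by rewrite RintegralD//; [rewrite IH | exact: h | exact: Rintegrable_sum].
Qed.

Lemma RintegralZ k f : Rintegrable mu f ->
  \int[mu]_x (k * f x) = k * \int[mu]_x f x.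
Proof. exact: RintegralZl. Qed.

Lemma Rintegrable_of_ge0 f : measurable_fun setT f -> (forall x, 0 <= f x) ->
  (\int[mu]_x (f x)%:E < +oo)%E -> Rintegrable mu f.
Proof.
move=> mf f0 foo; apply/integrableP; split; first exact/measurable_EFinP.
by under eq_integral do rewrite /= ger0_norm//.
Qed.

Lemma EFin_Rintegral f : Rintegrable mu f ->
  (\int[mu]_x f x)%:E = (\int[mu]_x (f x)%:E)%E.
Proof. by move=> fi; rewrite fineK//; exact: integrable_fin_num. Qed.

Lemma ae_eq_Rintegral f g : Rintegrable mu f -> Rintegrable mu g ->
  {ae mu, forall x, f x = g x} -> \int[mu]_x f x = \int[mu]_x g x.
Proof.
move=> fi gi fg; congr fine; apply: ae_eq_integral => //.
- exact: (measurable_int mu fi).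
- exact: (measurable_int mu gi).
- by apply: filterS fg => x /= -> _.
Qed.

Lemma Rintegral_dct (f_ : nat -> T -> R) f g :
  (forall n, measurable_fun setT (f_ n)) -> Rintegrable mu g ->
  (forall n x, `|f_ n x| <= g x) ->
  (forall x, f_ n x @[n --> \oo] --> f x) ->
  Rintegrable mu f /\ \int[mu]_x f_ n x @[n --> \oo] --> \int[mu]_x f x.
Proof.
move=> mf gi fg ff.
have mlim : measurable_fun setT f.
  by apply: measurable_fun_cvg mf _ => x _; exact: ff.
have fi : Rintegrable mu f.
  apply: (le_Rintegrable mlim _ gi) => x.
  by apply: (cvgr_to_le (cvg_norm (ff x))); near=> n; exact: fg.
split => //.
have h : (\int[mu]_x (f_ n x)%:E)%E @[n --> \oo] --> (\int[mu]_x f x)%:E.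
  rewrite EFin_Rintegral//.
  apply: (@dominated_cvg _ _ _ mu _ _ (fun n => EFin \o f_ n) (EFin \o f) (EFin \o g)) => //.
  - by move=> n; exact/measurable_EFinP.
  - by move=> x _ /=; apply/cvg_EFin; [exact: nearW | exact: ff].
  - by move=> n x _; rewrite /= lee_fin.
exact: fine_cvg h.
Unshelve. all: by end_near. Qed.

(** For limits without a dominating function: it yields the fourth moments of the Gaussian vector,
    on which all later dominations rest. *)
Lemma Rintegral_fatou (f_ : nat -> T -> R) f C :
  (forall n, Rintegrable mu (f_ n)) -> (forall n x, 0 <= f_ n x) ->
  (forall n, \int[mu]_x f_ n x <= C) ->
  (forall x, f_ n x @[n --> \oo] --> f x) ->
  Rintegrable mu f.
Proof.
move=> fi f0 fC ff.
have f00 x : 0 <= f x.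
  by apply: (cvgr_to_ge (ff x)); near=> n; exact: f0.
have mlim : measurable_fun setT f.
  by apply: measurable_fun_cvg (fun n => Rintegrable_measurable (fi n)) _ => x _; exact: ff.
apply: Rintegrable_of_ge0 => //.
rewrite (eq_integral (fun x => limn_einf (fun n => (f_ n x)%:E))); last first.
  move=> x _; apply/esym.
  have : EFin \o (f_ ^~ x) @ \oo --> (f x)%:E.
    by apply/cvg_EFin; [exact: nearW|exact: ff].
  by move=> /cvg_limn_einf_sup[].
apply: (@le_lt_trans _ _ (limn_einf (fun n => (\int[mu]_x (f_ n x)%:E)%E))).
  apply: (@fatou _ _ _ mu _ measurableT (fun n x => (f_ n x)%:E)).
    by move=> n; exact: (measurable_int mu (fi n)).
  by move=> n x _; rewrite lee_fin.
apply: (@le_lt_trans _ _ C%:E); last exact: ltry.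
rewrite limn_einf_lim; apply: lime_le; first exact: is_cvg_einfs.
near=> n; apply: (@le_trans _ _ (\int[mu]_x (f_ n x)%:E)%E).
  by apply: ereal_inf_lbound; exists n => /=.
by rewrite -EFin_Rintegral// lee_fin.
Unshelve. all: by end_near. Qed.
End real_integral.

(** * Affine changes of variable for Lebesgue measure *)

Section affine_change.
Context (R : realType).
Notation leb := (@lebesgue_measure R).

(** By uniqueness of Lebesgue measure it is enough to compare on half-open intervals. A negative [a]
    reverses the interval and exchanges its closed and open ends, whence the two cases. *)
Lemma lebesgue_measure_affine (a b : R) : a != 0 ->
  forall A, measurable A ->
  leb A = (`|a|%:E * leb ((fun x => (a * x + b)%R) @^-1` A))%E.
Proof.
move=> a0 A mA.
pose phi : measurableTypeR R -> measurableTypeR R := fun x : R => a * x + b.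
have mphi : measurable_fun setT phi.
  by apply: measurable_funD => //; exact: measurable_funM.
pose k : {nonneg R} := NngNum (normr_ge0 a).
pose pf := measure_function_pushforward__canonical__measure_function_Measure leb mphi.
pose nu : {measure set (measurableTypeR R) -> \bar R} := mscale k pf.
have h := @lebesgue_measure_unique R nu; move: h.
move=> /(_ _ A mA); apply => X [[u v] /= _ <-].
rewrite /nu/= /mscale/= /pushforward.
rewrite (_ : `|a|%R%:E = k%:num%:E)//.
rewrite [X in (_ * leb X)%E](_ : _ =
  if 0 < a then `](u - b) / a, (v - b) / a]%classic else
   `[(v - b) / a, (u - b) / a[%classic).
  case: (ltP 0 a) => ha.
    rewrite !lebesgue_measure_itv/= !lte_fin ltr_pM2r ?invr_gt0// ltrD2r.
    case: ifPn => uv; rewrite ?mule0//.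
    rewrite -!EFinB -EFinM gtr0_norm//; congr EFin.
    by field; rewrite gt_eqF.
  have {}ha : a < 0 by rewrite lt_neqAle a0.
  rewrite !lebesgue_measure_itv/= !lte_fin ltr_nM2r ?invr_lt0// ltrD2r.
  case: ifPn => uv; rewrite ?mule0//.
  rewrite -!EFinB -EFinM ltr0_norm//; congr EFin.
  by field; rewrite lt_eqF.
case: ifPn => ha.
  apply/seteqP; split => x /=; rewrite /phi !in_itv/=.
    by rewrite ltr_pdivrMr// ler_pdivlMr// ltrBlDr lerBrDr mulrC.
  by rewrite ltr_pdivrMr// ler_pdivlMr// ltrBlDr lerBrDr mulrC.
have {}ha : a < 0 by rewrite lt_neqAle a0 leNgt.
apply/seteqP; split => x /=; rewrite /phi !in_itv/=.
  by rewrite ltr_ndivlMr// ler_ndivrMr// ltrBlDr lerBrDr mulrC andbC.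
by rewrite ltr_ndivlMr// ler_ndivrMr// ltrBlDr lerBrDr mulrC andbC.
Qed.

Lemma ge0_integral_affine (a b : R) (f : R -> \bar R) : a != 0 ->
  measurable_fun setT f -> (forall x, 0 <= f x)%E ->
  (\int[leb]_x f x = `|a|%:E * \int[leb]_x f (a * x + b)%R)%E.
Proof.
move=> a0 mf f0.
pose phi : measurableTypeR R -> measurableTypeR R := fun x : R => a * x + b.
have mphi : measurable_fun setT phi.
  by apply: measurable_funD => //; exact: measurable_funM.
pose k : {nonneg R} := NngNum (normr_ge0 a).
pose pf := measure_function_pushforward__canonical__measure_function_Measure leb mphi.
rewrite (eq_measure_integral (mscale k pf)); last first.
  by move=> A mA _; exact: lebesgue_measure_affine.
rewrite ge0_integral_mscale// (_ : k%:num = `|a|)//; congr (_ * _)%E.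
by rewrite ge0_integral_pushforward.
Qed.

Lemma Rintegrable_affine (a b : R) (f : R -> R) : a != 0 ->
  Rintegrable leb f -> Rintegrable leb (fun x => f (a * x + b)).
Proof.
move=> a0 fi.
have mphi : measurable_fun setT (fun x : R => a * x + b).
  by apply: measurable_funD => //; exact: measurable_funM.
have mf := Rintegrable_measurable fi.
apply/integrableP; split.
  by apply/measurable_EFinP; exact: (measurableT_comp mf mphi).
move/integrableP : fi => [_].
rewrite (@ge0_integral_affine a b)//; last first.
  by apply: measurableT_comp => //; exact/measurable_EFinP.
by rewrite muleC -lte_pdivlMr ?normr_gt0// gt0_mulye// lte_fin invr_gt0 normr_gt0.
Qed.

Lemma Rintegral_affine (a b : R) (f : R -> R) : a != 0 ->
  Rintegrable leb f ->
  \int[leb]_x f (a * x + b) = `|a|^-1 * \int[leb]_x f x.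
Proof.
move=> a0 fi.
have mf := Rintegrable_measurable fi.
have fi' := Rintegrable_affine b a0 fi.
apply: EFin_inj; rewrite EFinM !EFin_Rintegral//.
rewrite [in RHS]integralE (@ge0_integral_affine a b (EFin \o f)^\+%E)//; last first.
  by apply: measurable_funepos; exact/measurable_EFinP.
rewrite [in RHS](@ge0_integral_affine a b (EFin \o f)^\-%E)//; last first.
  by apply: measurable_funeneg; exact/measurable_EFinP.
have e1 : (\int[leb]_x (EFin \o f)^\+ (a * x + b)%R)%E =
    (\int[leb]_x (EFin \o (fun x => f (a * x + b)%R))^\+ x)%E.
  by apply: eq_integral => x _; rewrite !funeposE.
have e2 : (\int[leb]_x (EFin \o f)^\- (a * x + b)%R)%E =
    (\int[leb]_x (EFin \o (fun x => f (a * x + b)%R))^\- x)%E.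
  by apply: eq_integral => x _; rewrite !funenegE.
rewrite e1 e2 -muleBr//; last exact: (integrable_add_def measurableT fi').
by rewrite muleA -EFinM mulVf ?normr_eq0// mul1e [LHS]integralE.
Qed.
End affine_change.

(** * Derivatives and elementary inequalities *)

Section derivation_rules.
Context (R : realType).
Implicit Types (f g : R -> R) (x a b : R).

Lemma derC a x : is_derive x 1 (fun=> a) 0.
Proof. exact: is_derive_cst. Qed.
Lemma derI x : is_derive x 1 (fun y => y) 1.
Proof. exact: is_derive_id. Qed.
Lemma derD f g x a b : is_derive x 1 f a -> is_derive x 1 g b ->
  is_derive x 1 (fun y => f y + g y) (a + b).
Proof. by move=> fa gb; exact: is_deriveD. Qed.
Lemma derN f x a : is_derive x 1 f a -> is_derive x 1 (fun y => - f y) (- a).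
Proof. by move=> fa; exact: is_deriveN. Qed.
Lemma derM f g x a b : is_derive x 1 f a -> is_derive x 1 g b ->
  is_derive x 1 (fun y => f y * g y) (f x * b + g x * a).
Proof. by move=> fa gb; exact: is_deriveM. Qed.
Lemma derX f x a n : is_derive x 1 f a ->
  is_derive x 1 (fun y => f y ^+ n) (n%:R * f x ^+ n.-1 * a).
Proof.
move=> fa; elim: n => [|n IH].
  by rewrite !mul0r; exact: derC.
rewrite (_ : (fun y => f y ^+ n.+1) = (fun y => f y * f y ^+ n)); last first.
  by apply/funext => y; rewrite exprS.
apply: (is_derive_eq (derM fa IH)).
case: n {IH} => [|n]; first by rewrite expr0 !mul0r mulr0 add0r mulr1.
by rewrite -!natr1 /= exprS; ring.
Qed.
Lemma der_comp f g x a b : is_derive (g x) 1 f a -> is_derive x 1 g b ->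
  is_derive x 1 (fun y => f (g y)) (b * a).
Proof. by move=> fa gb; rewrite mulrC; exact: is_derive1_comp. Qed.
Lemma der_exp g x b : is_derive x 1 g b ->
  is_derive x 1 (fun y => expR (g y)) (b * expR (g x)).
Proof. by move=> gb; exact: (der_comp (is_derive_expR _)). Qed.
Lemma der_cos g x b : is_derive x 1 g b ->
  is_derive x 1 (fun y => cos (g y)) (b * - sin (g x)).
Proof. by move=> gb; exact: (der_comp (is_derive_cos _)). Qed.
Lemma der_sin g x b : is_derive x 1 g b ->
  is_derive x 1 (fun y => sin (g y)) (b * cos (g x)).
Proof. by move=> gb; exact: (der_comp (is_derive_sin _)). Qed.

Lemma der_eq f x a b : is_derive x 1 f a -> a = b -> is_derive x 1 f b.
Proof. by move=> h <-. Qed.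

Lemma der_continuous f df : (forall x : R, is_derive x 1 f (df x)) -> continuous f.
Proof.
move=> h x; apply: differentiable_continuous.
by apply/derivable1_diffP; have := h x => -[].
Qed.
End derivation_rules.

(** The derivative is computed from the shape of the function; [derive_by] then leaves only the
    algebraic identity between the value found and the value announced. *)
Ltac der := first
 [ exact: derC | exact: derI
 | apply: der_exp; der | apply: der_cos; der | apply: der_sin; der
 | apply: derX; der | apply: derN; der
 | apply: derD; der | apply: derM; der ].
Ltac derive_by := eapply der_eq; [der | rewrite /GRing.scale/=].

Section monotone.
Context (R : realType).
Implicit Types (f df : R -> R) (x a b : R).

Lemma der_mvt f df a b : (forall x : R, is_derive x 1 f (df x)) -> a <= b ->
  exists2 c, a <= c <= b & f b - f a = df c * (b - a).
Proof.
move=> h ab.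
have [c cab ->] : exists2 c, c \in `[a, b] & f b - f a = df c * (b - a).
  apply: MVT_segment => //.
  by apply: continuous_subspaceT; exact: der_continuous h.
by exists c => //; move: cab; rewrite in_itv.
Qed.

Lemma der_ge0_le f df a b : (forall x : R, is_derive x 1 f (df x)) -> a <= b ->
  (forall x, a <= x <= b -> 0 <= df x) -> f a <= f b.
Proof.
move=> h ab d0; have [c cab e] := der_mvt h ab.
by rewrite -subr_ge0 e mulr_ge0 ?d0 ?subr_ge0.
Qed.

Lemma der_ge0_ge0 f df x : 0 <= x -> (forall y : R, is_derive y 1 f (df y)) ->
  (forall y, 0 <= y -> 0 <= df y) -> f 0 = 0 -> 0 <= f x.
Proof.
move=> x0 h d0 <-; apply: (der_ge0_le h x0) => y /andP[y0 _]; exact: d0.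
Qed.

Lemma der_eq0 f x y : (forall z : R, is_derive z 1 f 0) -> f x = f y.
Proof.
move=> h; have [xy|/ltW xy] := leP x y.
  by have [c _ /eqP] := der_mvt h xy; rewrite mul0r subr_eq0 => /eqP.
by have [c _ /eqP] := der_mvt h xy; rewrite mul0r subr_eq0 => /eqP.
Qed.

(** In this chain of bounds each difference vanishes at 0 and has as derivative the difference of an
    earlier bound, the first ones being [cos <= 1] and [sin <= 1]. *)
Lemma sin_le_id x : 0 <= x -> sin x <= x.
Proof.
move=> x0; rewrite -subr_ge0.
have h : forall y : R, is_derive y 1 (fun x => x - sin x) ((fun x => 1 - cos x) y).
  by move=> y; derive_by; ring.
apply: (der_ge0_ge0 x0 h).
- by move=> y _; rewrite subr_ge0 cos_le1.
- by rewrite sin0 subr0.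
Qed.

Lemma cos_ge_1B x : 0 <= x -> 1 - x <= cos x.
Proof.
move=> x0; rewrite -subr_ge0.
have h : forall y : R, is_derive y 1 (fun x => cos x - (1 - x)) ((fun x => 1 - sin x) y).
  by move=> y; derive_by; ring.
apply: (der_ge0_ge0 x0 h).
- by move=> y _; rewrite subr_ge0 sin_le1.
- by rewrite cos0 subr0 subrr.
Qed.

Lemma sin_ge_quad x : 0 <= x -> x - x ^+ 2 / 2 <= sin x.
Proof.
move=> x0; rewrite -subr_ge0.
have h : forall y : R, is_derive y 1 (fun x => sin x - (x - x ^+ 2 / 2)) ((fun x => cos x - (1 - x)) y).
  by move=> y; derive_by; field.
apply: (der_ge0_ge0 x0 h).
- by move=> y y0; rewrite subr_ge0 cos_ge_1B.
- by rewrite sin0 expr0n/= mul0r !subr0.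
Qed.

Lemma cos_ge_quad x : 1 - x ^+ 2 / 2 <= cos x.
Proof.
wlog x0 : x / 0 <= x.
  move=> h; have [/h//|/ltW x0] := leP 0 x.
  by have := h (- x); rewrite oppr_ge0 x0 sqrrN cosN; apply.
rewrite -subr_ge0.
have h : forall y : R, is_derive y 1 (fun x => cos x - (1 - x ^+ 2 / 2)) ((fun x => x - sin x) y).
  by move=> y; derive_by; field.
apply: (der_ge0_ge0 x0 h).
- by move=> y y0; rewrite subr_ge0 sin_le_id.
- by rewrite cos0 expr0n/= mul0r subr0 subrr.
Qed.

(** Any cubic remainder will do; with coefficient 1 the derivative [sin x - x + 3 x^2] is
    non-negative by [sin_ge_quad]. *)
Lemma cos_le_cubic x : 0 <= x -> cos x <= 1 - x ^+ 2 / 2 + x ^+ 3.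
Proof.
move=> x0; rewrite -subr_ge0.
have h : forall y : R, is_derive y 1 (fun x => 1 - x ^+ 2 / 2 + x ^+ 3 - cos x) ((fun x => sin x - x + 3 * x ^+ 2) y).
  by move=> y; derive_by; field.
apply: (der_ge0_ge0 x0 h).
- move=> y y0; have := sin_ge_quad y0; have := sqr_ge0 y; lra.
- by rewrite cos0 !expr0n/= mul0r subr0 addr0 subrr.
Qed.

Lemma normr_cos1B x : `|cos x - 1| <= x ^+ 2 / 2.
Proof.
rewrite distrC ger0_norm ?subr_ge0 ?cos_le1//.
by have := cos_ge_quad x; lra.
Qed.

Lemma normr_sin_le x : `|sin x| <= `|x|.
Proof.
wlog x0 : x / 0 <= x.
  move=> h; have [/h//|/ltW x0] := leP 0 x.
  by have := h (- x); rewrite oppr_ge0 x0 sinN !normrN; apply.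
rewrite (ger0_norm x0) ler_norml sin_le_id// andbT.
have h : forall y : R, is_derive y 1 (fun x => sin x + x) (cos y + 1).
  by move=> y; derive_by; ring.
rewrite -subr_ge0 opprK; apply: (der_ge0_ge0 x0 h).
- by move=> y _; have := cos_geN1 y; lra.
- by rewrite sin0 addr0.
Qed.

Lemma normr_sinB x : `|sin x - x| <= x ^+ 2 / 2.
Proof.
wlog x0 : x / 0 <= x.
  move=> h; have [/h//|/ltW x0] := leP 0 x.
  have := h (- x); rewrite oppr_ge0 x0 sinN sqrrN -opprD normrN.
  by apply.
rewrite distrC ger0_norm ?subr_ge0 ?sin_le_id//.
by have := sin_ge_quad x0; lra.
Qed.

(** The remainder is uniform in [a], as differentiation under an integral sign requires. *)
Lemma cos_taylor1 a b : `|cos (a + b) - cos a + b * sin a| <= b ^+ 2.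
Proof.
rewrite cosD [X in `|X|](_ : _ = cos a * (cos b - 1) - sin a * (sin b - b)); last by ring.
rewrite (le_trans (ler_normB _ _))// !normrM.
have ca : `|cos a| <= 1 by rewrite ler_norml cos_le1 cos_geN1.
have sa : `|sin a| <= 1 by rewrite ler_norml sin_le1 sin_geN1.
rewrite [leRHS](_ : _ = 1 * (b ^+ 2 / 2) + 1 * (b ^+ 2 / 2)); last by field.
by rewrite lerD// ler_pM ?normr_cos1B ?normr_sinB.
Qed.

Lemma sin_taylor1 a b : `|sin (a + b) - sin a - b * cos a| <= b ^+ 2.
Proof.
rewrite sinD [X in `|X|](_ : _ = sin a * (cos b - 1) + cos a * (sin b - b)); last by ring.
rewrite (le_trans (ler_normD _ _))// !normrM.
have ca : `|cos a| <= 1 by rewrite ler_norml cos_le1 cos_geN1.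
have sa : `|sin a| <= 1 by rewrite ler_norml sin_le1 sin_geN1.
rewrite [leRHS](_ : _ = 1 * (b ^+ 2 / 2) + 1 * (b ^+ 2 / 2)); last by field.
by rewrite lerD// ler_pM ?normr_cos1B ?normr_sinB.
Qed.

Lemma normr_cosB a b : `|cos a - cos b| <= `|a - b|.
Proof.
wlog ab : a b / a <= b.
  move=> h; have [/h//|/ltW /h] := leP a b.
  by rewrite distrC [X in _ <= X]distrC.
have [c _ e] := @der_mvt cos (fun x => - sin x) a b _ ab.
rewrite distrC e normrM normrN [leRHS]distrC ler_piMl//.
by rewrite ler_norml sin_le1 sin_geN1.
Qed.

Lemma normr_sinBB a b : `|sin a - sin b| <= `|a - b|.
Proof.
wlog ab : a b / a <= b.
  move=> h; have [/h//|/ltW /h] := leP a b.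
  by rewrite distrC [X in _ <= X]distrC.
have [c _ e] := @der_mvt sin cos a b _ ab.
rewrite distrC e normrM [leRHS]distrC ler_piMl//.
by rewrite ler_norml cos_le1 cos_geN1.
Qed.

Lemma expRN_ge x : 1 - x <= expR (- x).
Proof. exact: expR_ge1Dx. Qed.

Lemma expRN_le_quad x : 0 <= x -> expR (- x) <= 1 - x + x ^+ 2 / 2.
Proof.
move=> x0; rewrite -subr_ge0.
have h : forall y : R, is_derive y 1 (fun x => 1 - x + x ^+ 2 / 2 - expR (- x)) ((fun x => expR (- x) - (1 - x)) y).
  by move=> y; derive_by; field.
apply: (der_ge0_ge0 x0 h).
- by move=> y y0; rewrite subr_ge0 expRN_ge.
- by rewrite oppr0 expR0 expr0n/=; ring.
Qed.
End monotone.

(** * The fundamental theorem of calculus on the line *)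

Section integral_derivative.
Context (R : realType).
Notation leb := (@lebesgue_measure R).

Lemma cvgn_unique (u : nat -> R) (a b : R) :
  u n @[n --> \oo] --> a -> u n @[n --> \oo] --> b -> a = b.
Proof. by move=> /cvg_lim <-// /cvg_lim <-. Qed.

Lemma continuous_measurable (f : R -> R) : continuous f -> measurable_fun [set: R] f.
Proof. exact: continuous_measurable_fun. Qed.

Lemma Rintegral_itv_derive (F f : R -> R) (a b : R) : a <= b ->
  (forall x : R, is_derive x 1 F (f x)) -> continuous f ->
  \int[leb]_(x in `[a, b]) f x = F b - F a.
Proof.
rewrite le_eqVlt => /orP[/eqP <- _ _|ab h cf].
  by rewrite set_itv1 Rintegral_set1 subrr.
rewrite /Rintegral (@continuous_FTC2 _ f F)//=.
- exact: continuous_subspaceT.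
- have cF := der_continuous h; split.
  + by move=> x _; have := h x => -[].
  + by apply: cvg_at_right_filter; exact: cF.
  + by apply: cvg_at_left_filter; exact: cF.
- by move=> x _; rewrite derive1E; have := h x => -[_ ->].
Qed.

Lemma cvg_indic_itv (x : R) :
  \1_(`[- n%:R, n%:R]%classic : set R) x @[n --> \oo] --> (1 : R).
Proof.
apply: cvg_near_cst; near=> n.
rewrite indicE mem_set//= in_itv/= -ler_norml.
by near: n; exact: nbhs_infty_ger.
Unshelve. all: by end_near. Qed.

(** Exhaustion of the line by [[-n, n]] and dominated convergence, so the boundary limits are taken
    along the integers. *)
Lemma Rintegral_derive (F f : R -> R) (l r : R) :
  (forall x : R, is_derive x 1 F (f x)) -> continuous f -> Rintegrable leb f ->
  F n%:R @[n --> \oo] --> r -> F (- n%:R) @[n --> \oo] --> l ->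
  \int[leb]_x f x = r - l.
Proof.
move=> h cf fi Fr Fl.
have mf := Rintegrable_measurable fi.
have [] := @Rintegral_dct _ _ _ leb
  (fun n x => f x * \1_(`[- n%:R, n%:R]%classic : set R) x) f (fun x => `|f x|).
- by move=> n; apply: measurable_funM => //; exact: measurable_indic.
- exact: Rintegrable_norm.
- move=> n x; rewrite normrM ler_piMr// indicE; case: (_ \in _); rewrite /= ?normr1 ?normr0//.
- by move=> x; rewrite -[X in _ --> X]mulr1; apply: cvgM; [exact: cvg_cst|exact: cvg_indic_itv].
move=> _ h1; have h2 : F n%:R - F (- n%:R) @[n --> \oo] --> r - l by exact: cvgB.
apply: (cvgn_unique h1); apply: cvg_trans h2; apply: near_eq_cvg; near=> n.
rewrite -(@Rintegral_itv_derive F f)//; last by rewrite ge0_cp ?ler0n.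
rewrite Rintegral_mkcond; apply: eq_Rintegral => x _.
by rewrite patchE indicE; case: ifPn; rewrite ?mulr1 ?mulr0.
Unshelve. all: by end_near. Qed.

Lemma Rintegral_odd (f : R -> R) : Rintegrable leb f -> (forall x, f (- x) = - f x) ->
  \int[leb]_x f x = 0.
Proof.
move=> fi odd.
have m1 : -1 != 0 :> R by rewrite oppr_eq0 oner_eq0.
have := @Rintegral_affine R (-1) 0 f m1 fi.
rewrite normrN normr1 invr1 mul1r.
under eq_Rintegral do rewrite mulN1r addr0 odd -mulN1r.
by rewrite RintegralZ// mulN1r; lra.
Qed.
End integral_derivative.

(** * Differentiation of trigonometric integrals in their parameter *)

Section trigonometric_transform.
Context (R : realType).

Lemma continuous_cos_mul (u : R) : continuous (fun x : R => cos (u * x)).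
Proof.
by apply: (@der_continuous _ _ (fun x => - u * sin (u * x))) => x; derive_by; ring.
Qed.

Lemma continuous_sin_mul (u : R) : continuous (fun x : R => sin (u * x)).
Proof.
by apply: (@der_continuous _ _ (fun x => u * cos (u * x))) => x; derive_by; ring.
Qed.

(** A quadratic remainder with a constant valid for every increment survives integration, so
    derivatives pass under the integral without exchanging limits. *)
Lemma der_of_quad (c : R -> R) (t D M : R) :
  (forall k, `|c (t + k) - c t - k * D| <= M * k ^+ 2) -> is_derive t 1 c D.
Proof.
move=> h.
have M0 : 0 <= M by have := le_trans (normr_ge0 _) (h 1); rewrite expr1n mulr1.
have cv : (fun k => k^-1 *: ((c \o shift t) (k *: 1) - c t)) k @[k --> 0^'] --> D.
  apply/cvgrPdist_le => e e0; near=> k.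
  have k0 : k != 0 by near: k; exact: nbhs_dnbhs_neq.
  rewrite /= [k *: 1]mulr1 [k + t]addrC.
  rewrite (_ : D - _ = - (k^-1 * (c (t + k) - c t - k * D))); last first.
    by rewrite /GRing.scale/=; field.
  rewrite normrN normrM normfV mulrC ler_pdivrMr ?normr_gt0//.
  rewrite (le_trans (h k))// -real_normK ?num_real// expr2 mulrA ler_wpM2r//.
  (* [M + 1] in place of [M], which may be 0. *)
  have : `|k| <= e / (M + 1).
    near: k; apply: dnbhs0_le; rewrite divr_gt0//; lra.
  rewrite ler_pdivlMr; last by lra.
  by move: (normr_ge0 k); set y := `|k|; nra.
apply: DeriveDef; first by apply/cvg_ex; exists D.
by apply: cvg_lim => //.
Unshelve. all: by end_near. Qed.

Context d (T : measurableType d) (mu : {measure set T -> \bar R}).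
Variables (W V g : T -> R).
Hypotheses (mW : measurable_fun setT W) (mV : measurable_fun setT V).
Hypotheses (g0 : forall x, 0 <= g x) (gi : Rintegrable mu g).
Hypothesis Vgi : Rintegrable mu (fun x => V x ^+ 2 * g x).

Let mWV e : measurable_fun setT (fun x => W x + e * V x).
Proof. by apply: measurable_funD => //; apply: measurable_funM. Qed.

Let mg : measurable_fun setT g. Proof. exact: Rintegrable_measurable gi. Qed.

Lemma measurable_cos_comp (f : T -> R) : measurable_fun setT f ->
  measurable_fun setT (fun x => cos (f x)).
Proof.
by move=> mf; apply: measurableT_comp mf; apply: continuous_measurable; exact: continuous_cos.
Qed.

Lemma measurable_sin_comp (f : T -> R) : measurable_fun setT f ->
  measurable_fun setT (fun x => sin (f x)).
Proof.
by move=> mf; apply: measurableT_comp mf; apply: continuous_measurable; exact: continuous_sin.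
Qed.

Let ig (f : T -> R) : measurable_fun setT f -> (forall x, `|f x| <= 1) ->
  Rintegrable mu (fun x => f x * g x).
Proof.
move=> mf f1; apply: (le_Rintegrable _ _ gi); first exact: measurable_funM.
by move=> x; rewrite normrM (ger0_norm (g0 x)) ler_piMl.
Qed.

Let iVg (f : T -> R) : measurable_fun setT f -> (forall x, `|f x| <= 1) ->
  Rintegrable mu (fun x => V x * f x * g x).
Proof.
move=> mf f1; apply: (le_Rintegrable _ _ (RintegrableD gi Vgi)).
  by apply: measurable_funM => //; exact: measurable_funM.
move=> x; rewrite !normrM (ger0_norm (g0 x)) -[X in _ <= X + _]mul1r -mulrDl ler_wpM2r//.
have := f1 x; have := normr_ge0 (V x); have := normr_ge0 (f x).
rewrite -(real_normK (num_real (V x))); set y := `|V x|; set z := `|f x|.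
by have := sqr_ge0 (1 - y); nra.
Qed.

Let cos1 (x : R) : `|cos x| <= 1. Proof. by rewrite ler_norml cos_le1 cos_geN1. Qed.
Let sin1 (x : R) : `|sin x| <= 1. Proof. by rewrite ler_norml sin_le1 sin_geN1. Qed.

(** It serves twice: with Lebesgue measure and [g] a normal density, for the characteristic function
    of the normal law; with a probability and [g = 1], for Gaussian vectors. *)
Lemma der_Rintegral_cos (e : R) :
  is_derive e 1 (fun e => \int[mu]_x (cos (W x + e * V x) * g x))
    (- \int[mu]_x (V x * sin (W x + e * V x) * g x)).
Proof.
apply: (@der_of_quad _ _ _ (\int[mu]_x (V x ^+ 2 * g x))) => k.
have i1 e' : Rintegrable mu (fun x => cos (W x + e' * V x) * g x).
  by apply: ig => //; exact: measurable_cos_comp.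
have i2 : Rintegrable mu (fun x => V x * sin (W x + e * V x) * g x).
  by apply: iVg => //; exact: measurable_sin_comp.
rewrite mulrN opprK -RintegralB// -RintegralZ// -RintegralD//; last 2 first.
- exact: RintegrableB.
- exact: RintegrableZ.
rewrite mulrC -RintegralZ//.
apply: le_trans (le_normr_Rintegral _ _) _ => //.
  by apply: RintegrableD; [exact: RintegrableB|exact: RintegrableZ].
apply: le_Rintegral => //.
- by apply: Rintegrable_norm; apply: RintegrableD; [exact: RintegrableB|exact: RintegrableZ].
- exact: RintegrableZ.
move=> x _.
rewrite (_ : _ + _ = (cos (W x + e * V x + k * V x) - cos (W x + e * V x)
   + k * V x * sin (W x + e * V x)) * g x); last first.
  by rewrite (_ : W x + (e + k) * V x = W x + e * V x + k * V x); ring.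
by rewrite normrM (ger0_norm (g0 x)) mulrA ler_wpM2r// -exprMn cos_taylor1.
Qed.

Lemma der_Rintegral_sin (e : R) :
  is_derive e 1 (fun e => \int[mu]_x (sin (W x + e * V x) * g x))
    (\int[mu]_x (V x * cos (W x + e * V x) * g x)).
Proof.
apply: (@der_of_quad _ _ _ (\int[mu]_x (V x ^+ 2 * g x))) => k.
have i1 e' : Rintegrable mu (fun x => sin (W x + e' * V x) * g x).
  by apply: ig => //; exact: measurable_sin_comp.
have i2 : Rintegrable mu (fun x => V x * cos (W x + e * V x) * g x).
  by apply: iVg => //; exact: measurable_cos_comp.
rewrite -RintegralB// -RintegralZ// -RintegralB//; last 2 first.
- exact: RintegrableB.
- exact: RintegrableZ.
rewrite mulrC -RintegralZ//.
apply: le_trans (le_normr_Rintegral _ _) _ => //.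
  by apply: RintegrableB; [exact: RintegrableB|exact: RintegrableZ].
apply: le_Rintegral => //.
- by apply: Rintegrable_norm; apply: RintegrableB; [exact: RintegrableB|exact: RintegrableZ].
- exact: RintegrableZ.
move=> x _.
rewrite (_ : _ - _ = (sin (W x + e * V x + k * V x) - sin (W x + e * V x)
   - k * V x * cos (W x + e * V x)) * g x); last first.
  by rewrite (_ : W x + (e + k) * V x = W x + e * V x + k * V x); ring.
by rewrite normrM (ger0_norm (g0 x)) mulrA ler_wpM2r// -exprMn sin_taylor1.
Qed.
End trigonometric_transform.

(** * Centred normal laws *)

Section centered_normal.
Context (R : realType) (s : R).
Hypothesis s0 : 0 < s.
Notation leb := (@lebesgue_measure R).
Notation phi := (normal_pdf 0 s).
Let sn0 : s != 0. Proof. by rewrite gt_eqF. Qed.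

Lemma centered_normal_pdfE x : phi x = normal_peak s * expR (- (x ^+ 2 / (2 * s ^+ 2))).
Proof.
rewrite normal_pdfE// /normal_fun subr0 mulNr.
by rewrite -mulr_natl.
Qed.

Lemma centered_normal_pdfN x : phi (- x) = phi x.
Proof. by rewrite !centered_normal_pdfE sqrrN. Qed.

Lemma centered_normal_pdf_gt0 x : 0 < phi x.
Proof. by rewrite centered_normal_pdfE mulr_gt0 ?expR_gt0// normal_peak_gt0. Qed.

Lemma der_centered_normal_pdf (x : R) : is_derive x 1 phi (- (x / s ^+ 2) * phi x).
Proof.
rewrite (_ : phi = fun x => normal_peak s * expR (- (x ^+ 2 / (2 * s ^+ 2)))); last first.
  by apply/funext => y; exact: centered_normal_pdfE.
by derive_by; field.
Qed.

Lemma Rintegrable_normal : Rintegrable leb phi.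
Proof. exact: integrable_normal_pdf. Qed.
Lemma Rintegral_normal : \int[leb]_x phi x = 1.
Proof. by rewrite /Rintegral integral_normal_pdf. Qed.
End centered_normal.

Section normal_moments.
Context (R : realType) (s : R).
Hypothesis s0 : 0 < s.
Notation leb := (@lebesgue_measure R).
Notation phi := (normal_pdf 0 s).
Let sn0 : s != 0. Proof. by rewrite gt_eqF. Qed.

(** Half of the exponent absorbs [x^2], since [y exp(-y) <= 1] for [y = x^2 / (4 s^2)]; the other
    half is a normal density of variance [2 s^2]. *)
Lemma normal_pdf_sqr_le : exists2 C, 0 <= C &
  forall x, x ^+ 2 * phi x <= C * normal_pdf 0 (s * Num.sqrt 2) x.
Proof.
have s20 : 0 < s * Num.sqrt 2 by rewrite mulr_gt0// sqrtr_gt0.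
have p0 := normal_peak_gt0 sn0; have p20 := normal_peak_gt0 (lt0r_neq0 s20).
exists (4 * s ^+ 2 * normal_peak s / normal_peak (s * Num.sqrt 2)).
  by rewrite !mulr_ge0// ?invr_ge0 ?sqr_ge0// ltW.
move=> x; rewrite !centered_normal_pdfE// exprMn sqr_sqrtr//.
set y := x ^+ 2 / (4 * s ^+ 2).
have -> : x ^+ 2 / (2 * s ^+ 2) = y + y by rewrite /y; field.
have -> : x ^+ 2 / (2 * (s ^+ 2 * 2)) = y by rewrite /y; field.
have xy : x ^+ 2 = 4 * s ^+ 2 * y by rewrite /y; field.
rewrite opprD expRD {1}xy.
set p := normal_peak s in p0 *; set p2 := normal_peak _ in p20 *.
rewrite [leRHS](_ : _ = 4 * s ^+ 2 * p * expR (- y) * 1); last by field; rewrite gt_eqF.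
rewrite [leLHS](_ : _ = 4 * s ^+ 2 * p * expR (- y) * (y * expR (- y))); last by ring.
rewrite ler_wpM2l//; first by rewrite !mulr_ge0 ?expR_ge0 ?sqr_ge0 ?ltW.
rewrite expRN ler_pdivrMr ?expR_gt0// mul1r.
by rewrite (le_trans _ (expR_ge1Dx y))// lerDr.
Qed.

Lemma Rintegrable_normal_sqr : Rintegrable leb (fun x => x ^+ 2 * phi x).
Proof.
have [C C0 h] := normal_pdf_sqr_le.
have s20 : 0 < s * Num.sqrt 2 by rewrite mulr_gt0// sqrtr_gt0.
apply: (@le_Rintegrable _ _ _ leb _ (fun x => C * normal_pdf 0 (s * Num.sqrt 2) x)).
- by apply: measurable_funM; [exact: measurable_funX|exact: measurable_normal_pdf].
- by move=> x; rewrite ger0_norm ?h// mulr_ge0 ?sqr_ge0// ltW// centered_normal_pdf_gt0.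
- by apply: RintegrableZ; exact: Rintegrable_normal.
Qed.

Lemma Rintegrable_normal_mul (f : R -> R) (a b : R) : measurable_fun [set: R] f ->
  (forall x, `|f x| <= a + b * x ^+ 2) -> Rintegrable leb (fun x => f x * phi x).
Proof.
move=> mf h.
apply: (@le_Rintegrable _ _ _ leb _ (fun x => a * phi x + b * (x ^+ 2 * phi x))).
- by apply: measurable_funM => //; exact: measurable_normal_pdf.
- move=> x; have p0 := ltW (centered_normal_pdf_gt0 s0 x).
  by rewrite normrM (ger0_norm p0) mulrA -mulrDl ler_wpM2r.
- by apply: RintegrableD; apply: RintegrableZ; [exact: Rintegrable_normal|exact: Rintegrable_normal_sqr].
Qed.

(** Since [(1 + n)^2 <= 2 (1 + n^2)] and [n^2 phi n] is bounded, the density beats linear growth by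
    a factor [1 / (n + 1)]. *)
Lemma cvg_normal_pdf_mul (f : R -> R) (a : R) : (forall x, `|f x| <= a * (1 + `|x|)) ->
  f n%:R * phi n%:R @[n --> \oo] --> 0 /\ f (- n%:R) * phi (- n%:R) @[n --> \oo] --> 0.
Proof.
move=> fa.
have a0 : 0 <= a by have := le_trans (normr_ge0 _) (fa 0); rewrite normr0 addr0 mulr1.
have s20 : 0 < s * Num.sqrt 2 by rewrite mulr_gt0// sqrtr_gt0.
have [C C0 h] := normal_pdf_sqr_le.
pose D := a * (normal_peak s + C * normal_peak (s * Num.sqrt 2)) *+ 2.
have key n : phi n%:R * (1 + n%:R) * a <= D * n.+1%:R^-1.
  have p1 : phi n%:R <= normal_peak s by apply: normal_pdf_ub.
  have p2 : n%:R ^+ 2 * phi n%:R <= C * normal_peak (s * Num.sqrt 2).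
    by rewrite (le_trans (h _))// ler_wpM2l// normal_pdf_ub// gt_eqF.
  have p0 : 0 <= phi n%:R by rewrite ltW// centered_normal_pdf_gt0.
  rewrite ler_pdivlMr ?ltr0n// /D -natr1.
  set P := phi n%:R in p0 p1 p2 *; set N : R := n%:R in p2 *.
  have : P * (1 + N) ^+ 2 <= (normal_peak s + C * normal_peak (s * Num.sqrt 2)) *+ 2.
    have := mulr_ge0 p0 (sqr_ge0 (1 - N)).
    set K := _ * normal_peak _ in p2 *; rewrite mulr2n; lra.
  move=> /(ler_wpM2l a0); set K := _ + _ * normal_peak _; rewrite !mulr2n; lra.
have cD : D * n.+1%:R^-1 @[n --> \oo] --> 0.
  rewrite -[X in _ --> X](mulr0 D); apply: cvgM; first exact: cvg_cst.
  exact: cvg_harmonic.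
have bnd x n : phi x = phi n%:R -> `|x| = n%:R -> `|f x * phi x| <= D * n.+1%:R^-1.
  move=> e1 e2; have p0 := ltW (centered_normal_pdf_gt0 s0 x).
  rewrite normrM (ger0_norm p0); apply: le_trans (key n); rewrite -e1 -e2.
  by rewrite mulrC -mulrA ler_wpM2l// [leRHS]mulrC fa.
split; apply: norm_cvg0; apply: (@squeeze_cvgr _ _ _ _ (cst 0) (fun n => D * n.+1%:R^-1)) => //.
- by near=> n; rewrite normr_ge0/= bnd// normr_nat.
- exact: cvg_cst.
- by near=> n; rewrite normr_ge0/= bnd// ?centered_normal_pdfN// normrN normr_nat.
- exact: cvg_cst.
Unshelve. all: by end_near. Qed.

(** The difference of the two sides is the integral of the derivative of [- s^2 f phi], whose
    boundary terms vanish. *)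
Lemma normal_stein (f df : R -> R) (a : R) :
  (forall x : R, is_derive x 1 f (df x)) -> continuous df ->
  (forall x, `|f x| <= a * (1 + `|x|)) -> (forall x, `|df x| <= a) ->
  \int[leb]_x (x * f x * phi x) = s ^+ 2 * \int[leb]_x (df x * phi x).
Proof.
move=> fd cdf fa dfa.
have cf := der_continuous fd.
have a0 : 0 <= a by exact: le_trans (normr_ge0 _) (dfa 0).
have cphi : continuous phi by apply: continuous_normal_pdf.
have i1 : Rintegrable leb (fun x => x * f x * phi x).
  apply: (@Rintegrable_normal_mul _ (2 * a) (2 * a)).
    by apply: measurable_funM => //; exact: continuous_measurable.
  move=> x; rewrite normrM; apply: (@le_trans _ _ (`|x| * (a * (1 + `|x|)))).
    by rewrite ler_wpM2l.
  rewrite -(real_normK (num_real x)); set y := `|x|.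
  have y0 : 0 <= y by rewrite normr_ge0.
  have := mulr_ge0 a0 (sqr_ge0 (1 - y)); have := mulr_ge0 a0 (sqr_ge0 y); nra.
have i2 : Rintegrable leb (fun x => df x * phi x).
  apply: (@Rintegrable_normal_mul _ a 0); first exact: continuous_measurable.
  by move=> x; rewrite mul0r addr0.
have [l1 l2] := cvg_normal_pdf_mul fa.
pose F x := - s ^+ 2 * (f x * phi x).
have dF : forall x : R, is_derive x 1 F (x * f x * phi x - s ^+ 2 * (df x * phi x)).
  move=> x; have hp := der_centered_normal_pdf s0 x; have hf := fd x.
  apply: der_eq (derM (derC _ x) (derM hf hp)) _.
  by field.
have := Rintegral_derive dF _ _ _ _.
move=> /(_ 0 0); rewrite subr0.
rewrite RintegralB//; last exact: RintegrableZ.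
rewrite RintegralZ// => h; apply/eqP; rewrite -subr_eq0 h//.
- move=> x; apply: cvgB; first by apply: cvgM; [apply: cvgM; [exact: cvg_id|exact: cf]|exact: cphi].
  by apply: cvgM; [exact: cvg_cst|apply: cvgM; [exact: cdf|exact: cphi]].
- by apply: RintegrableB => //; exact: RintegrableZ.
- by rewrite -(mulr0 (- s ^+ 2)); apply: cvgM => //; exact: cvg_cst.
- by rewrite -(mulr0 (- s ^+ 2)); apply: cvgM => //; exact: cvg_cst.
Qed.

Lemma normal_mean : \int[leb]_x (x * phi x) = 0.
Proof.
apply: Rintegral_odd.
  apply: (@Rintegrable_normal_mul _ 1 1) => // x.
  rewrite -(real_normK (num_real x)) mul1r; set y := `|x|.
  have := sqr_ge0 (1 - y); have y0 : 0 <= y by rewrite normr_ge0.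
  nra.
by move=> x; rewrite centered_normal_pdfN// mulNr.
Qed.

Lemma normal_second_moment : \int[leb]_x (x ^+ 2 * phi x) = s ^+ 2.
Proof.
have := @normal_stein (fun x => x) (cst 1) 1 (fun x => derI x).
under eq_Rintegral do rewrite -expr2.
move=> ->.
- under eq_Rintegral do rewrite mul1r.
  by rewrite Rintegral_normal mulr1.
- by move=> x; exact: cvg_cst.
- by move=> x; rewrite mul1r lerDr.
- by move=> x; rewrite normr1.
Qed.

Lemma normal_sin t : \int[leb]_x (sin (t * x) * phi x) = 0.
Proof.
apply: Rintegral_odd.
  apply: (@Rintegrable_normal_mul _ 1 0).
    by apply: continuous_measurable; exact: continuous_sin_mul.
  by move=> x; rewrite mul0r addr0 ler_norml sin_le1 sin_geN1.
by move=> x; rewrite centered_normal_pdfN// mulrN sinN mulNr.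
Qed.

(** Stein's identity for [sin (u x)] shows that the characteristic function solves [c' = - s^2 u c];
    its product with [exp (u^2 s^2 / 2)] is then constant. *)
Lemma normal_cos t : \int[leb]_x (cos (t * x) * phi x) = expR (- (t ^+ 2 * s ^+ 2 / 2)).
Proof.
pose c t := \int[leb]_x (cos (t * x) * phi x).
have ic u : Rintegrable leb (fun x => cos (u * x) * phi x).
  apply: (@Rintegrable_normal_mul _ 1 0).
    by apply: continuous_measurable; exact: continuous_cos_mul.
  by move=> x; rewrite mul0r addr0 ler_norml cos_le1 cos_geN1.
have is_ u : Rintegrable leb (fun x => x * sin (u * x) * phi x).
  apply: (@Rintegrable_normal_mul _ 1 1).
    by apply: measurable_funM => //; apply: continuous_measurable; exact: continuous_sin_mul.
  move=> x; rewrite normrM.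
  have h : `|sin (u * x)| <= 1 by rewrite ler_norml sin_le1 sin_geN1.
  have := ler_wpM2l (normr_ge0 x) h.
  rewrite -(real_normK (num_real x)) mul1r; set y := `|x|.
  have := sqr_ge0 (1 - y); have y0 : 0 <= y by rewrite normr_ge0.
  nra.
have st u : \int[leb]_x (x * sin (u * x) * phi x) = s ^+ 2 * (u * c u).
  have hd : forall x : R, is_derive x 1 (fun x => sin (u * x)) (u * cos (u * x)).
    by move=> x; derive_by; ring.
  rewrite (@normal_stein _ _ (1 + `|u|) hd).
  - congr (_ * _); rewrite /c -RintegralZ//.
    by apply: eq_Rintegral => x _; rewrite mulrA.
  - by apply: (@der_continuous _ _ (fun x => - (u ^+ 2 * sin (u * x)))) => x; derive_by; ring.
  - move=> x; apply: (@le_trans _ _ 1); first by rewrite ler_norml sin_le1 sin_geN1.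
    by have := normr_ge0 u; have := normr_ge0 x; nra.
  - move=> x; rewrite normrM.
    have h : `|cos (u * x)| <= 1 by rewrite ler_norml cos_le1 cos_geN1.
    by have := ler_wpM2l (normr_ge0 u) h; lra.

have dc : forall u : R, is_derive u 1 c (- (s ^+ 2 * (u * c u))).
  move=> u.
  have e1 : c = (fun e => \int[leb]_x (cos (cst 0 x + e * idfun x) * phi x)).
    by apply/funext => e; rewrite /c; apply: eq_Rintegral => x _; rewrite /cst add0r.
  have := @der_Rintegral_cos R _ _ leb (cst 0) idfun phi _ _ _ _ _ u.
  rewrite -e1 => hh; apply: der_eq (hh _ _ _ _ _) _ => //.
  - exact: measurable_id.
  - by move=> x; rewrite ltW// centered_normal_pdf_gt0.
  - exact: Rintegrable_normal.
  - exact: Rintegrable_normal_sqr.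
  - by rewrite -st; congr (- _); apply: eq_Rintegral => x _; rewrite /cst add0r.
have d2 : forall u : R, is_derive u 1 (fun u => c u * expR (u ^+ 2 * s ^+ 2 / 2)) 0.
  move=> u; have hc := dc u.
  have he : is_derive u 1 (fun u => expR (u ^+ 2 * s ^+ 2 / 2)) (u * s ^+ 2 * expR (u ^+ 2 * s ^+ 2 / 2)).
    by derive_by; field.
  apply: der_eq (derM hc he) _.
  by rewrite /GRing.scale/=; field.
have := der_eq0 t 0 d2.
rewrite expr0n /= !mul0r expR0 mulr1 => h.
have c0 : c 0 = 1.
  rewrite /c -[RHS](Rintegral_normal s); apply: eq_Rintegral => x _.
  by rewrite mul0r cos0 mul1r.
rewrite -/(c t) expRN; apply: (mulIf (lt0r_neq0 (expR_gt0 (t ^+ 2 * s ^+ 2 / 2)))).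
by rewrite h c0 mulVf// gt_eqF// expR_gt0.
Qed.
End normal_moments.

(** The function [p] agrees almost everywhere with the Radon-Nikodym derivative, because both have
    the same integral on every measurable set. *)
Lemma ge0_integral_density d (T : measurableType d) (R : realType)
  (nu : {finite_measure set T -> \bar R}) (mu : {sigma_finite_measure set T -> \bar R})
  (p : T -> R) (g : T -> \bar R) :
  measurable_fun setT p -> (forall x, 0 <= p x) ->
  (forall A, measurable A -> nu A = \int[mu]_(x in A) (p x)%:E)%E ->
  measurable_fun setT g -> (forall x, 0 <= g x)%E ->
  (\int[nu]_x g x = \int[mu]_x (g x * (p x)%:E))%E.
Proof.
move=> mp p0 nuE mg g0.
have dom : nu `<< mu.
  apply/null_content_dominatesP => A mA A0; rewrite nuE//.
  by apply: null_set_integral => //; apply/measurable_EFinP; exact: measurable_funTS.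
rewrite -(Radon_Nikodym_SigmaFinite.change_of_variables dom)//.
have fi := Radon_Nikodym_SigmaFinite.f_integrable dom.
apply: ae_eq_integral => //.
- by apply: emeasurable_funM => //; exact: measurable_int fi.
- by apply: emeasurable_funM => //; exact/measurable_EFinP.
- apply: ae_eqe_mul2l; apply: integral_ae_eq => //; first exact/measurable_EFinP.
  by move=> E _ mE; rewrite -(Radon_Nikodym_SigmaFinite.f_integral dom)// nuE.
Qed.

(** * Expectations under a Gaussian law *)

Section gaussian_rv.
Context (R : realType) d (T : measurableType d) (P : probability T R).
Notation leb := (@lebesgue_measure R).
Notation phi := (normal_pdf (0 : R) 1).

Lemma normal_pdf_standard (m s y : R) : 0 < s -> s * normal_pdf m s (s * y + m) = phi y.
Proof.
move=> s0; have sn0 : s != 0 by rewrite gt_eqF.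
rewrite !normal_pdfE ?oner_eq0// /normal_fun /normal_peak addrK subr0 expr1n mul1r mulrA.
congr (_ * expR _).
  rewrite -mulrnAr sqrtrM ?sqr_ge0// sqrtr_sqr gtr0_norm//.
  by rewrite invfM mulrA divff// mul1r.
by rewrite (mulr2n (s ^+ 2)); field; rewrite -mulr2n mulrn_eq0 expf_eq0.
Qed.

(** Expressing the law as that of [sqrt v * y + m], with [y] standard normal, treats the Dirac mass
    at [v = 0] and the normal laws by one formula. *)
Lemma gaussian_law_integral (Y : T -> R) (m v : R) (g : R -> R) :
  measurable_fun setT Y -> 0 <= v ->
  (forall A : set R, measurable A -> P (Y @^-1` A) = gauss_law m v A) ->
  measurable_fun setT g -> (forall x, 0 <= g x) ->
  (\int[P]_x (g (Y x))%:E = \int[leb]_y (g (Num.sqrt v * y + m) * phi y)%:E)%E.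
Proof.
move=> mY v0 law mg g0.
have meg : measurable_fun setT (EFin \o g) by exact/measurable_EFinP.
pose Y' : T -> measurableTypeR R := Y.
have mY' : measurable_fun setT Y' by exact: mY.
pose pf := measure_function_pushforward__canonical__measure_function_Measure P mY'.
transitivity (\int[pf]_y (g y)%:E)%E.
  by rewrite ge0_integral_pushforward//= => y _; rewrite lee_fin.
move: v0; rewrite le_eqVlt => /orP[/eqP v0|v0].
  rewrite -v0 sqrtr0.
  rewrite [LHS](eq_measure_integral (@dirac _ (measurableTypeR R) m R)); last first.
    by move=> A mA _; rewrite /= /pushforward law// /gauss_law -v0 ltxx diracE indicE.
  rewrite integral_dirac// diracE mem_set// mul1e.
  under eq_integral do rewrite mul0r add0r EFinM.
  by rewrite integralZl//= ?integral_normal_pdf ?mule1//; exact: integrable_normal_pdf.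
have s0 : 0 < Num.sqrt v by rewrite sqrtr_gt0.
rewrite [LHS](eq_measure_integral (normal_prob m (Num.sqrt v))); last first.
  by move=> A mA _; rewrite /= /pushforward law// /gauss_law v0.
rewrite (@ge0_integral_density _ _ _ (normal_prob m (Num.sqrt v)) leb (normal_pdf m (Num.sqrt v))); first last.
- by move=> x; rewrite lee_fin.
- exact: meg.
- by [].
- by move=> x; exact: normal_pdf_ge0.
- exact: measurable_normal_pdf.
rewrite (@ge0_integral_affine R (Num.sqrt v) m
  (fun x => ((g x)%:E * (normal_pdf m (Num.sqrt v) x)%:E)%E)); last 3 first.
- by rewrite gt_eqF.
- by apply: emeasurable_funM => //; apply/measurable_EFinP; exact: measurable_normal_pdf.
- by move=> x; rewrite mule_ge0 ?lee_fin ?normal_pdf_ge0.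
rewrite -ge0_integralZl//.
- by apply: eq_integral => y _; rewrite -!EFinM -(@normal_pdf_standard m _ y s0) gtr0_norm// mulrCA.
- apply/measurable_EFinP; apply: measurable_funM.
    by apply: measurableT_comp mg _; apply: measurable_funD => //; exact: measurable_funM.
  apply: measurableT_comp; first exact: measurable_normal_pdf.
  by apply: measurable_funD => //; exact: measurable_funM.
- by move=> x _; rewrite mule_ge0 ?lee_fin ?normal_pdf_ge0.
Qed.

Lemma gaussian_law_Rintegral (Y : T -> R) (m v : R) (g : R -> R) (a b : R) :
  measurable_fun setT Y -> 0 <= v ->
  (forall A : set R, measurable A -> P (Y @^-1` A) = gauss_law m v A) ->
  measurable_fun setT g -> (forall x, 0 <= g x <= a + b * x ^+ 2) ->
  [/\ Rintegrable P (fun w => g (Y w)),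
    Rintegrable leb (fun y => g (Num.sqrt v * y + m) * phi y) &
   \int[P]_w g (Y w) = \int[leb]_y (g (Num.sqrt v * y + m) * phi y)].
Proof.
move=> mY v0 law mg gab.
have g0 x : 0 <= g x by have /andP[] := gab x.
have maff : measurable_fun [set: R] (fun y => Num.sqrt v * y + m).
  by apply: measurable_funD => //; exact: measurable_funM.
have i1 : Rintegrable leb (fun y => g (Num.sqrt v * y + m) * phi y).
  apply: (@Rintegrable_normal_mul _ _ ltr01 _ (`|a| + 2 * `|b| * m ^+ 2) (2 * `|b| * v)).
    exact: measurableT_comp mg maff.
  move=> x; rewrite ger0_norm//; have /andP[_ h] := gab (Num.sqrt v * x + m).
  apply: (le_trans h).
  have : b * (Num.sqrt v * x + m) ^+ 2 <= `|b| * (Num.sqrt v * x + m) ^+ 2.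
    by rewrite ler_wpM2r ?sqr_ge0 ?ler_norm.
  have : (Num.sqrt v * x + m) ^+ 2 <= 2 * m ^+ 2 + 2 * v * x ^+ 2.
    rewrite -{2}(sqr_sqrtr v0).
    by have := sqr_ge0 (Num.sqrt v * x - m); lra.
  move=> /(ler_wpM2l (normr_ge0 b)).
  by have := ler_norm a; lra.
have e := gaussian_law_integral mY v0 law mg g0.
split => //.
- apply: Rintegrable_of_ge0 => //; first exact: measurableT_comp mg mY.
  by rewrite e; exact: integrable_lty i1.
- by rewrite /Rintegral e.
Qed.

(** Only non-negative functions of quadratic growth have been transferred to the normal density. So
    the mean is read off from [(Y + 1)^2], and the two transforms from [1 - cos] and [1 - sin]. *)
Lemma gaussian_rv_moments (Y : T -> R) : measurable_fun setT Y -> is_gaussian_rv P Y ->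
  exists m v, [/\ 0 <= v, Rintegrable P (fun w => Y w ^+ 2), Rintegrable P Y,
    \int[P]_w Y w = m & \int[P]_w Y w ^+ 2 = m ^+ 2 + v] /\
    \int[P]_w cos (Y w) = cos m * expR (- (v / 2)) /\
    \int[P]_w sin (Y w) = sin m * expR (- (v / 2)).
Proof.
move=> mY [m [v [v0 law]]]; exists m, v.
have iphi := @Rintegrable_normal R 1.
have ixphi : Rintegrable leb (fun y => y * phi y).
  apply: (@Rintegrable_normal_mul _ _ ltr01 _ 1 1) => // x.
  rewrite -(real_normK (num_real x)) mul1r; set y := `|x|.
  have := sqr_ge0 (1 - y); have y0 : 0 <= y by rewrite normr_ge0.
  nra.
have ix2 := @Rintegrable_normal_sqr R 1 ltr01.
have one : Rintegrable P (fun=> 1) by exact: finite_measure_integrable_cst.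
have e1 : \int[P]_w 1 = 1.
  by have := expectation_cst P 1; rewrite unlock /Rintegral /cst => ->.
have quad (p q r : R) : \int[leb]_y ((p * y ^+ 2 + q * y + r) * phi y) = p + r.
  rewrite (_ : \int[leb]_y _ = \int[leb]_y (p * (y ^+ 2 * phi y) + q * (y * phi y) + r * phi y)); last first.
    by apply: eq_Rintegral => y _; ring.
  rewrite !RintegralD//; do ?[by apply: RintegrableZ|by apply: RintegrableD; apply: RintegrableZ].
  rewrite !RintegralZ// normal_mean// normal_second_moment// Rintegral_normal//.
  by rewrite expr1n mulr1 mulr0 addr0 mulr1.
have sv : Num.sqrt v ^+ 2 = v by rewrite sqr_sqrtr.
have [j1 _ k1] : [/\ Rintegrable P (fun w => Y w ^+ 2),
    Rintegrable leb (fun y => (Num.sqrt v * y + m) ^+ 2 * phi y) &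
   \int[P]_w (Y w) ^+ 2 = \int[leb]_y ((Num.sqrt v * y + m) ^+ 2 * phi y)].
  apply: (@gaussian_law_Rintegral Y m v (fun x => x ^+ 2) 0 1) => //.
  by move=> x; rewrite sqr_ge0 add0r mul1r lexx.
have [j2 _ k2] : [/\ Rintegrable P (fun w => (Y w + 1) ^+ 2),
    Rintegrable leb (fun y => (Num.sqrt v * y + m + 1) ^+ 2 * phi y) &
   \int[P]_w (Y w + 1) ^+ 2 = \int[leb]_y ((Num.sqrt v * y + m + 1) ^+ 2 * phi y)].
  apply: (@gaussian_law_Rintegral Y m v (fun x => (x + 1) ^+ 2) 2 2) => //.
    by apply: measurable_funX; exact: measurable_funD.
  by move=> x; rewrite sqr_ge0/=; have := sqr_ge0 (x - 1); lra.
have iY : Rintegrable P Y.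
  apply: (le_Rintegrable mY _ (RintegrableD one j1)) => w.
  rewrite -(real_normK (num_real (Y w))); set y := `|_|.
  have := sqr_ge0 (1 - y); have y0 : 0 <= y by rewrite normr_ge0.
  nra.
have m2 : \int[P]_w Y w ^+ 2 = m ^+ 2 + v.
  rewrite k1 -[RHS]addrC -(quad v (2 * Num.sqrt v * m) (m ^+ 2)); apply: eq_Rintegral => y _.
  by congr (_ * _); set z := Num.sqrt v in sv *; rewrite -sv; ring.
have m1 : \int[P]_w Y w = m.
  have : \int[P]_w (Y w + 1) ^+ 2 = (m + 1) ^+ 2 + v.
    rewrite k2 -[RHS]addrC -(quad v (2 * Num.sqrt v * (m + 1)) ((m + 1) ^+ 2)); apply: eq_Rintegral => y _.
    by congr (_ * _); set z := Num.sqrt v in sv *; rewrite -sv; ring.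
  rewrite (_ : \int[P]_w _ = \int[P]_w (Y w ^+ 2 + 2 * Y w + 1)); last first.
    by apply: eq_Rintegral => w _; ring.
  rewrite !RintegralD//; do ?[by apply: RintegrableZ|by apply: RintegrableD => //; apply: RintegrableZ].
  by rewrite RintegralZ// m2 e1; lra.
have bd (f : R -> R) : measurable_fun [set: R] f -> (forall x, `|f x| <= 1) ->
   Rintegrable leb (fun y => f y * phi y).
  move=> mf f1; apply: (@Rintegrable_normal_mul _ _ ltr01 _ 1 0) => // x.
  by rewrite mul0r addr0.
have cos1 (x : R) : `|cos x| <= 1 by rewrite ler_norml cos_le1 cos_geN1.
have sin1 (x : R) : `|sin x| <= 1 by rewrite ler_norml sin_le1 sin_geN1.
have ic : Rintegrable leb (fun y => cos (Num.sqrt v * y) * phi y).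
  by apply: bd => // ; apply: continuous_measurable; exact: continuous_cos_mul.
have is_ : Rintegrable leb (fun y => sin (Num.sqrt v * y) * phi y).
  by apply: bd => // ; apply: continuous_measurable; exact: continuous_sin_mul.
have icP : Rintegrable P (fun w => cos (Y w)).
  apply: (le_Rintegrable _ _ one) => //; exact: measurable_cos_comp.
have isP : Rintegrable P (fun w => sin (Y w)).
  apply: (le_Rintegrable _ _ one) => //; exact: measurable_sin_comp.
have Ec : \int[leb]_y (cos (Num.sqrt v * y) * phi y) = expR (- (v / 2)).
  by rewrite normal_cos// sv expr1n mulr1.
have Es : \int[leb]_y (sin (Num.sqrt v * y) * phi y) = 0 by exact: normal_sin.
split => //; split.
- have mf : measurable_fun [set: R] (fun x => 1 - cos x).
    by apply: measurable_funB => //; apply: continuous_measurable; exact: continuous_cos.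
  have bf (x : R) : 0 <= 1 - cos x <= 2 + 0 * x ^+ 2.
    by rewrite mul0r addr0; have := cos1 x; rewrite ler_norml; lra.
  have [_ _] := gaussian_law_Rintegral mY v0 law mf bf.
  rewrite RintegralB// e1.
  rewrite (_ : \int[leb]_y _ = \int[leb]_y (phi y - (cos m * (cos (Num.sqrt v * y) * phi y)
     - sin m * (sin (Num.sqrt v * y) * phi y)))); last first.
    by apply: eq_Rintegral => y _; rewrite cosD; ring.
  rewrite !RintegralB//; do ?[exact: RintegrableZ|by apply: RintegrableB => //; exact: RintegrableZ].
  rewrite !RintegralZ// Ec Es Rintegral_normal// mulr0 subr0 => h.
  suff : 1 - \int[P]_w cos (Y w) = 1 - cos m * expR (- (v / 2)) by lra.
  exact: h.
- have mf : measurable_fun [set: R] (fun x => 1 - sin x).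
    by apply: measurable_funB => //; apply: continuous_measurable; exact: continuous_sin.
  have bf (x : R) : 0 <= 1 - sin x <= 2 + 0 * x ^+ 2.
    by rewrite mul0r addr0; have := sin1 x; rewrite ler_norml; lra.
  have [_ _] := gaussian_law_Rintegral mY v0 law mf bf.
  rewrite RintegralB// e1.
  rewrite (_ : \int[leb]_y _ = \int[leb]_y (phi y - (cos m * (sin (Num.sqrt v * y) * phi y)
     + sin m * (cos (Num.sqrt v * y) * phi y)))); last first.
    by apply: eq_Rintegral => y _; rewrite sinD; ring.
  rewrite RintegralB//; last by apply: RintegrableD => //; exact: RintegrableZ.
  rewrite RintegralD//; do ?[exact: RintegrableZ].
  rewrite !RintegralZ// Ec Es Rintegral_normal// mulr0 add0r => h.
  suff : 1 - \int[P]_w sin (Y w) = 1 - sin m * expR (- (v / 2)) by lra.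
  exact: h.
Qed.

Lemma centered_gaussian_rv (Y : T -> R) : measurable_fun setT Y -> is_gaussian_rv P Y ->
  'E_P[Y]%E = 0%E ->
  [/\ Rintegrable P (fun w => Y w ^+ 2), Rintegrable P Y,
    \int[P]_w cos (Y w) = expR (- ((\int[P]_w Y w ^+ 2) / 2)) &
    \int[P]_w sin (Y w) = 0].
Proof.
move=> mY gY; rewrite unlock => EY.
have [m [v [[v0 i2 i1 e1 e2] [ec es]]]] := gaussian_rv_moments mY gY.
have m0 : m = 0 by rewrite -e1 /Rintegral EY.
split => //.
- by rewrite ec e2 m0 cos0 mul1r expr0n/= add0r.
- by rewrite es m0 sin0 mul0r.
Qed.
End gaussian_rv.

(** * Integrating a Gaussian process against a kernel *)

Section fourier_bounds.
Context (R : realType).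
Notation leb := (@lebesgue_measure R).
Variable phi : R -> R.
Hypothesis phi_i : Rintegrable leb phi.

Lemma Rintegrable_bounded_mul d (T : measurableType d) (mu : {measure set T -> \bar R})
  (f p : T -> R) : Rintegrable mu p -> measurable_fun setT f -> (forall x, `|f x| <= 1) ->
  Rintegrable mu (fun x => f x * p x).
Proof.
move=> pi mf f1; have mp := Rintegrable_measurable pi.
apply: (le_Rintegrable _ _ (Rintegrable_norm pi)); first exact: measurable_funM.
by move=> x; rewrite normrM ler_piMl.
Qed.

Lemma normr_cos_le1 (x : R) : `|cos x| <= 1.
Proof. by rewrite ler_norml cos_le1 cos_geN1. Qed.
Lemma normr_sin_le1 (x : R) : `|sin x| <= 1.
Proof. by rewrite ler_norml sin_le1 sin_geN1. Qed.

Lemma le_normr_Rintegral_bounded d (T : measurableType d) (mu : {measure set T -> \bar R})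
  (f p : T -> R) : Rintegrable mu p -> measurable_fun setT f -> (forall x, `|f x| <= 1) ->
  `|\int[mu]_x (f x * p x)| <= \int[mu]_x `|p x|.
Proof.
move=> pi mf f1.
have fpi := Rintegrable_bounded_mul pi mf f1.
apply: le_trans (le_normr_Rintegral _ fpi) _ => //.
apply: le_Rintegral => //; [exact: Rintegrable_norm|exact: Rintegrable_norm|].
by move=> x _; rewrite normrM ler_piMl.
Qed.

Lemma le_FTre l : `|FTre phi l| <= \int[leb]_x `|phi x|.
Proof.
apply: le_normr_Rintegral_bounded => //.
  by apply: continuous_measurable; exact: continuous_cos_mul.
by move=> x; exact: normr_cos_le1.
Qed.

Lemma le_FTim l : `|FTim phi l| <= \int[leb]_x `|phi x|.
Proof.
apply: le_normr_Rintegral_bounded => //.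
  by apply: continuous_measurable; exact: continuous_sin_mul.
by move=> x; exact: normr_sin_le1.
Qed.

Lemma FTabs2_ge0 l : 0 <= FTabs2 phi l.
Proof. by rewrite addr_ge0 ?sqr_ge0. Qed.

Lemma le_FTabs2 l : FTabs2 phi l <= 2 * (\int[leb]_x `|phi x|) ^+ 2.
Proof.
have h (x y : R) : `|x| <= y -> x ^+ 2 <= y ^+ 2.
  by move=> xy; rewrite -real_normK ?num_real// ler_sqr// nnegrE (le_trans _ xy).
by have := h _ _ (le_FTre l); have := h _ _ (le_FTim l); rewrite /FTabs2; lra.
Qed.

(** With [g] the identity this is continuity of the Fourier transform; with [g] a simple function of
    time it serves the sampling of the process. *)
Lemma cvg_FT_subst (g : R -> R) (u : nat -> R) (l : R) : measurable_fun [set: R] g ->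
  u n @[n --> \oo] --> l ->
  \int[leb]_t (cos (u n * g t) * phi t) @[n --> \oo] --> \int[leb]_t (cos (l * g t) * phi t) /\
  \int[leb]_t (sin (u n * g t) * phi t) @[n --> \oo] --> \int[leb]_t (sin (l * g t) * phi t).
Proof.
move=> mg ul; have mphi := Rintegrable_measurable phi_i; split.
- have [] := @Rintegral_dct _ _ _ leb (fun n t => cos (u n * g t) * phi t) (fun t => cos (l * g t) * phi t)
    (fun t => `|phi t|) _ _ _ _ => //.
  + move=> n; apply: measurable_funM => //.
    by apply: measurable_cos_comp; exact: measurable_funM.
  + exact: Rintegrable_norm.
  + by move=> n x; rewrite normrM ler_piMl// normr_cos_le1.
  + move=> x; apply: cvgM; last exact: cvg_cst.
    apply: (cvg_comp (fun n => u n * g x) cos _ (@continuous_cos R (l * g x))).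
    by apply: cvgM => //; exact: cvg_cst.
- have [] := @Rintegral_dct _ _ _ leb (fun n t => sin (u n * g t) * phi t) (fun t => sin (l * g t) * phi t)
    (fun t => `|phi t|) _ _ _ _ => //.
  + move=> n; apply: measurable_funM => //.
    by apply: measurable_sin_comp; exact: measurable_funM.
  + exact: Rintegrable_norm.
  + by move=> n x; rewrite normrM ler_piMl// normr_sin_le1.
  + move=> x; apply: cvgM; last exact: cvg_cst.
    apply: (cvg_comp (fun n => u n * g x) sin _ (@continuous_sin R (l * g x))).
    by apply: cvgM => //; exact: cvg_cst.
Qed.

Lemma cvg_FT (u : nat -> R) (l : R) : u n @[n --> \oo] --> l ->
  FTre phi (u n) @[n --> \oo] --> FTre phi l /\ FTim phi (u n) @[n --> \oo] --> FTim phi l.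
Proof. exact: (@cvg_FT_subst idfun u l (@measurable_id _ _ _)). Qed.

Lemma continuous_FTre : continuous (FTre phi).
Proof. by move=> l; apply/(@cvg_nbhsP _ R^o) => u ul; exact: (cvg_FT ul).1. Qed.

Lemma continuous_FTim : continuous (FTim phi).
Proof. by move=> l; apply/(@cvg_nbhsP _ R^o) => u ul; exact: (cvg_FT ul).2. Qed.

Lemma continuous_FTabs2 : continuous (FTabs2 phi).
Proof.
move=> l; rewrite /FTabs2; apply: cvgD; apply: cvgM.
- exact: continuous_FTre.
- exact: continuous_FTre.
- exact: continuous_FTim.
- exact: continuous_FTim.
Qed.

Lemma FTabs2N l : FTabs2 phi (- l) = FTabs2 phi l.
Proof.
rewrite /FTabs2 /FTre /FTim /RintR.
under eq_Rintegral do rewrite mulNr cosN.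
congr (_ + _); under eq_Rintegral do rewrite mulNr sinN mulNr -mulN1r.
rewrite RintegralZ ?mulN1r ?sqrrN//; apply: Rintegrable_bounded_mul => //.
  by apply: continuous_measurable; exact: continuous_sin_mul.
by move=> x; exact: normr_sin_le1.
Qed.
End fourier_bounds.

Section gaussian_process.
Context (R : realType) d (T : measurableType d) (P : probability T R).
Notation leb := (@lebesgue_measure R).
Variables (X : R -> T -> R) (F : R -> R).
Hypothesis mX : measurable_fun [set: R * T] (fun p : R * T => X p.1 p.2).
Hypothesis gX : gaussian_process P X.
Hypothesis EX : forall t, ('E_P[X t] = 0)%E.
Hypotheses (mF : measurable_fun [set: R] F) (F0 : forall l, 0 <= F l).
Hypothesis covX : forall t s, ('E_P[fun w => (X t w * X s w)%R] =
     \int[leb]_(l in [set: R]) (cos (l * (t - s)) * F l)%R%:E)%E.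
Hypothesis msX : forall t, ('E_P[fun w => ((X s w - X t w) ^+ 2)%R] @[s --> t] --> 0%E)%E.

Lemma measurable_process t : measurable_fun setT (X t).
Proof. exact: (measurableT_comp mX (measurable_pair1 t)). Qed.

Lemma process_marginal t : Rintegrable P (fun w => X t w ^+ 2) /\ Rintegrable P (X t).
Proof.
have := gX (fun _ : 'I_1 => t) (fun _ => 1).
rewrite (_ : (fun w => _) = X t); last first.
  by apply/funext => w; rewrite big_ord1 mul1r.
move=> h.
by have [] := centered_gaussian_rv (measurable_process t) h (EX t).
Qed.

Lemma Rintegrable_process_mul t s : Rintegrable P (fun w => X t w * X s w).
Proof.
have [i1 _] := process_marginal t; have [i2 _] := process_marginal s.
apply: (le_Rintegrable _ _ (RintegrableD i1 i2)).
  by apply: measurable_funM; exact: measurable_process.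
move=> w; rewrite normrM.
rewrite -(real_normK (num_real (X t w))) -(real_normK (num_real (X s w))).
set x := `|X t w|; set y := `|X s w|.
have := sqr_ge0 (x - y); have := sqr_ge0 (x + y); lra.
Qed.

Lemma process_cov t s :
  \int[P]_w (X t w * X s w) = \int[leb]_l (cos (l * (t - s)) * F l).
Proof. by have := covX t s; rewrite unlock /Rintegral => ->. Qed.

(** The total mass of [F] is the second moment of [X 0], finite because [X 0] is Gaussian. *)
Lemma Rintegrable_spectral : Rintegrable leb F.
Proof.
apply: Rintegrable_of_ge0 => //.
have := covX 0 0; rewrite unlock.
rewrite [X in _ = X](_ : _ = (\int[leb]_l (F l)%:E)%E); last first.
  by apply: eq_integral => l _; rewrite subr0 mulr0 cos0 mul1r.
move=> <-; exact: integrable_lty (Rintegrable_process_mul 0 0).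
Qed.

Lemma Rintegrable_spectral_mul (f : R -> R) : measurable_fun [set: R] f ->
  (forall x, `|f x| <= 1) -> Rintegrable leb (fun l => f l * F l).
Proof. by move=> mf f1; apply: Rintegrable_bounded_mul => //; exact: Rintegrable_spectral. Qed.

Lemma Rintegrable_process_sum (I : Type) (r : seq I) (c t : I -> R) :
  Rintegrable P (fun w => \sum_(i <- r) c i * X (t i) w).
Proof. by apply: Rintegrable_sum => i _; apply: RintegrableZ; have [] := process_marginal (t i). Qed.

Lemma mean_process_sum (I : Type) (r : seq I) (c t : I -> R) :
  ('E_P[fun w => (\sum_(i <- r) c i * X (t i) w)%R] = 0)%E.
Proof.
rewrite unlock -EFin_Rintegral; last exact: Rintegrable_process_sum.
rewrite Rintegral_sum; last by move=> i _; apply: RintegrableZ; have [] := process_marginal (t i).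
rewrite big1// => i _; rewrite RintegralZ; last by have [] := process_marginal (t i).
by have := EX (t i); rewrite unlock /Rintegral => ->; rewrite mulr0.
Qed.

(** On the right stands the integral of [F] against [|sum_i c_i e^(i l t_i)|^2]. *)
Lemma process_sum_sqr (I : Type) (r : seq I) (c t : I -> R) :
  \int[P]_w (\sum_(i <- r) c i * X (t i) w) ^+ 2 =
  \int[leb]_l (F l * ((\sum_(i <- r) c i * cos (l * t i)) ^+ 2 +
                      (\sum_(i <- r) c i * sin (l * t i)) ^+ 2)).
Proof.
have mc (i j : I) : measurable_fun [set: R] (fun l => cos (l * (t i - t j))).
  apply: measurable_cos_comp; exact: measurable_funM.
transitivity (\sum_(i <- r) \sum_(j <- r) c i * c j * \int[leb]_l (cos (l * (t i - t j)) * F l)).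
  rewrite (_ : \int[P]_w _ = \int[P]_w \sum_(i <- r) \sum_(j <- r) c i * c j * (X (t i) w * X (t j) w)); last first.
    apply: eq_Rintegral => w _; rewrite expr2 big_distrlr/=.
    by apply: eq_bigr => i _; apply: eq_bigr => j _; ring.
  rewrite Rintegral_sum; last first.
    by move=> i _; apply: Rintegrable_sum => j _; apply: RintegrableZ; exact: Rintegrable_process_mul.
  apply: eq_bigr => i _; rewrite Rintegral_sum; last first.
    by move=> j _; apply: RintegrableZ; exact: Rintegrable_process_mul.
  apply: eq_bigr => j _; rewrite RintegralZ ?process_cov//.
  exact: Rintegrable_process_mul.
rewrite (_ : \int[leb]_l _ = \int[leb]_l \sum_(i <- r) \sum_(j <- r) c i * c j * (cos (l * (t i - t j)) * F l)); last first.
  apply: eq_Rintegral => l _; rewrite !expr2 !big_distrlr/= -big_split/= big_distrr/=.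
  apply: eq_bigr => i _; rewrite -big_split/= big_distrr/=; apply: eq_bigr => j _.
  by rewrite mulrBr cosB; ring.
have ic i j : Rintegrable leb (fun l => cos (l * (t i - t j)) * F l).
  apply: Rintegrable_spectral_mul => // x; exact: normr_cos_le1.
rewrite Rintegral_sum; last first.
  by move=> i _; apply: Rintegrable_sum => j _; exact: RintegrableZ.
apply: eq_bigr => i _; rewrite Rintegral_sum; last by move=> j _; exact: RintegrableZ.
by apply: eq_bigr => j _; rewrite RintegralZ.
Qed.

Lemma gaussian_process_sum (r : seq R) (c : R -> R) :
  let Z := fun w => \sum_(y <- r) c y * X y w in
  let V := \int[leb]_l (F l * ((\sum_(y <- r) c y * cos (l * y)) ^+ 2 +
                      (\sum_(y <- r) c y * sin (l * y)) ^+ 2)) in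
  [/\ measurable_fun setT Z, \int[P]_w cos (Z w) = expR (- (V / 2)) &
    \int[P]_w sin (Z w) = 0].
Proof.
move=> Z V.
have mZ : measurable_fun setT Z.
  apply: measurable_sum => y; apply: measurable_funM => //; exact: measurable_process.
have gZ : is_gaussian_rv P Z.
  have := gX (fun i : 'I_(size r) => nth 0 r i) (fun i => c (nth 0 r i)).
  rewrite (_ : (fun w => _) = Z)//; apply/funext => w.
  by rewrite /Z (big_nth 0) big_mkord.
have [i2 i1 ec es] := centered_gaussian_rv mZ gZ (mean_process_sum r c id).
by split => //; rewrite ec (process_sum_sqr r c id).
Qed.

Definition incr_sqr t s := \int[P]_w (X t w - X s w) ^+ 2.

Lemma Rintegrable_incr t s : Rintegrable P (fun w => (X t w - X s w) ^+ 2).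
Proof.
rewrite (_ : (fun w => _) = (fun w => X t w * X t w - 2 * (X t w * X s w) + X s w * X s w)); last first.
  by apply/funext => w; ring.
apply: RintegrableD; last exact: Rintegrable_process_mul.
apply: RintegrableB; first exact: Rintegrable_process_mul.
by apply: RintegrableZ; exact: Rintegrable_process_mul.
Qed.

Lemma incr_sqr_cvg (u : nat -> R) t : u n @[n --> \oo] --> t ->
  incr_sqr t (u n) @[n --> \oo] --> 0.
Proof.
move=> ut.
have h : ('E_P[fun w => ((X (u n) w - X t w) ^+ 2)%R] @[n --> \oo] --> 0%E)%E.
  exact: (cvg_comp _ _ ut (msX t)).
rewrite (_ : (fun n => _) = fine \o (fun n => 'E_P[fun w => ((X (u n) w - X t w) ^+ 2)%R])%E).
  exact: fine_cvg h.
apply/funext => n; rewrite /incr_sqr /= unlock /Rintegral; congr fine.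
by apply: eq_integral => w _; congr EFin; ring.
Qed.

Section kernel_integral.
Variable phi : R -> R.
Hypothesis phi_i : Rintegrable leb phi.

(** Fubini-Tonelli, for a general random field [K] because it is applied to the process, to its
    sampled versions and to their differences. The pathwise integral exists almost surely only. *)
Lemma kernel_integral (K : R -> T -> R) (C : R) :
  measurable_fun [set: R * T] (fun p : R * T => K p.1 p.2) ->
  (forall t, Rintegrable P (K t)) -> (forall t, \int[P]_w `|K t w| <= C) ->
  let I := fun w => RintR (fun t => phi t * K t w) in
  [/\ {ae P, forall w, Rintegrable leb (fun t => phi t * K t w)},
     measurable_fun setT I, Rintegrable P I,
     Rintegrable leb (fun t => `|phi t| * \int[P]_w `|K t w|) &
     \int[P]_w `|I w| <= \int[leb]_t (`|phi t| * \int[P]_w `|K t w|)].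
Proof.
move=> mK iK KC I.
have mphi := Rintegrable_measurable phi_i.
pose f (p : measurableTypeR R * T) := (phi p.1 * K p.1 p.2)%:E.
have mf : measurable_fun setT f.
  apply/measurable_EFinP; apply: measurable_funM => //.
  exact: (measurableT_comp mphi measurable_fst).
have C0 : 0 <= C by apply: le_trans (KC 0); apply: Rintegral_ge0.
have e1 t : (\int[P]_w `|f (t, w)| = (`|phi t| * \int[P]_w `|K t w|)%:E)%E.
  rewrite EFinM EFin_Rintegral; last exact: Rintegrable_norm.
  rewrite -ge0_integralZl//.
  - by apply: eq_integral => w _; rewrite /f /= normrM EFinM.
  - by apply/measurable_EFinP; apply: Rintegrable_measurable; exact: Rintegrable_norm.
have mabsf : measurable_fun setT (abse \o f) by exact: measurableT_comp.
have i1 : Rintegrable leb (fun t => `|phi t| * \int[P]_w `|K t w|).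
  apply: (le_Rintegrable _ _ (RintegrableZ C (Rintegrable_norm phi_i))).
    apply/measurable_EFinP.
    have h : measurable_fun setT (fubini_F P (abse \o f)).
      by apply: measurable_fun_fubini_tonelli_F => // p; exact: abse_ge0.
    by apply: eq_measurable_fun h => t _; rewrite /fubini_F /= e1.
  move=> t; rewrite ger0_norm ?mulr_ge0 ?Rintegral_ge0// mulrC.
  by rewrite ler_wpM2r.
have fin : (\int[leb]_t \int[P]_w `|f (t, w)| < +oo)%E.
  under eq_integral do rewrite e1.
  exact: integrable_lty i1.
have fi : (leb \x P)%E.-integrable setT f by apply/integrable12ltyP.
have mG := measurable_fubini_G fi.
have mI : measurable_fun setT I.
  have := measurableT_comp (@fine_measurable R _ measurableT) mG.
  by apply: eq_measurable_fun.
have IG w : (`|I w|%:E <= \int[leb]_t `|f (t, w)|)%E.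
  apply: le_trans (le_abse_integral leb measurableT _) => //; last first.
    exact: (measurableT_comp mf (measurable_pair2 w)).
  rewrite /I /RintR /Rintegral.
  (* Where the integral is infinite, [fine] returns 0 and the bound is trivial. *)
  case: (\int[leb]_x f (x, w))%E => [r| |]//=; by rewrite normr0 leey.
have EI : (\int[P]_w `|I w|%:E <= \int[leb]_t (`|phi t| * \int[P]_w `|K t w|)%:E)%E.
  rewrite [leRHS](_ : _ = \int[leb]_t \int[P]_w `|f (t, w)|)%E; last first.
    by apply: eq_integral => t _; rewrite e1.
  have -> : (\int[leb]_t \int[P]_w `|f (t, w)| = \int[P]_w \int[leb]_t `|f (t, w)|)%E.
    by apply: (@fubini_tonelli _ _ _ _ _ leb P (abse \o f)) => // p; exact: abse_ge0.
  apply: ge0_le_integral => //.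
  - by apply/measurable_EFinP; exact: measurableT_comp.
  - have h : measurable_fun setT (fubini_G leb (abse \o f)).
      by apply: measurable_fun_fubini_tonelli_G => // p; exact: abse_ge0.
    by apply: eq_measurable_fun h.
have iI : Rintegrable P I.
  apply/integrableP; split; first exact/measurable_EFinP.
  by apply: le_lt_trans EI _; exact: integrable_lty i1.
split => //.
- exact: ae_integrable2 fi.
- by rewrite -lee_fin !EFin_Rintegral//; exact: Rintegrable_norm.
Qed.

Lemma process_norm_le t : \int[P]_w `|X t w| <= 1 + \int[leb]_l F l.
Proof.
have [i1 i2] := process_marginal t.
have one : Rintegrable P (fun=> 1) by exact: finite_measure_integrable_cst.
have e1 : \int[P]_w 1 = 1 by have := expectation_cst P 1; rewrite unlock /Rintegral /cst => ->.
apply: (@le_trans _ _ (\int[P]_w (1 + X t w ^+ 2))).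
  apply: le_Rintegral => //; [exact: Rintegrable_norm|exact: RintegrableD|].
  move=> w _; rewrite -(real_normK (num_real (X t w))); set y := `|_|.
  have := sqr_ge0 (1 - y); have y0 : 0 <= y by rewrite normr_ge0.
  nra.
rewrite RintegralD// e1 lerD2l.
under eq_Rintegral do rewrite expr2.
rewrite process_cov le_eqVlt; apply/orP; left; apply/eqP.
by apply: eq_Rintegral => l _; rewrite subrr mulr0 cos0 mul1r.
Qed.

Lemma measurable_process_subst (g : R -> R) : measurable_fun [set: R] g ->
  measurable_fun [set: R * T] (fun p : R * T => X (g p.1) p.2).
Proof.
move=> mg.
have h : measurable_fun [set: R * T] (fun p : R * T => (g p.1, p.2)).
  apply/measurable_fun_pairP; split => /=.
    exact: (measurableT_comp mg measurable_fst).
  exact: measurable_snd.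
exact: (measurableT_comp mX h).
Qed.

(** When [g] takes finitely many values [y], the integral is a finite combination of the [X y]; the
    coefficient [c y] is the integral of [phi] over the level set of [y]. *)
Lemma simple_process_integral (g : R -> R) : measurable_fun [set: R] g -> finite_set (range g) ->
  let Z := fun w => RintR (fun t => phi t * X (g t) w) in
  let C l := \int[leb]_t (cos (l * g t) * phi t) in
  let S l := \int[leb]_t (sin (l * g t) * phi t) in
  let V := \int[leb]_l (F l * (C l ^+ 2 + S l ^+ 2)) in
  \int[P]_w cos (Z w) = expR (- (V / 2)) /\ \int[P]_w sin (Z w) = 0.
Proof.
move=> mg fg Z C S V.
have mphi := Rintegrable_measurable phi_i.
have [r0 r0E] := (finite_seqP _).1 fg.
pose r := undup r0.
pose I (y t : R) : R := \1_(g @^-1` [set y]) t.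
have mI y : measurable_fun [set: R] (I y).
  by apply: measurable_indic; rewrite -[X in measurable X]setTI; exact: mg.
have I1 y t : `|I y t| <= 1 by rewrite /I indicE; case: (_ \in _); rewrite /= ?normr1 ?normr0.
have iI y : Rintegrable leb (fun t => I y t * phi t) by exact: (Rintegrable_bounded_mul phi_i (mI y) (I1 y)).
pose c y := \int[leb]_t (I y t * phi t).
have sumI (h : R -> R) t : h (g t) = \sum_(y <- r) h y * I y t.
  have gt_r : g t \in r.
    have h1 : range g (g t) by exists t.
    by rewrite mem_undup; move: h1; rewrite r0E.
  rewrite (bigD1_seq (g t))/= ?undup_uniq// /I indicE mem_set// mulr1 big1 ?addr0// => y yg.
  by rewrite indicE memNset ?mulr0// => /= e; rewrite e eqxx in yg.
have intI (h : R -> R) : \int[leb]_t (h (g t) * phi t) = \sum_(y <- r) c y * h y.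
  rewrite (_ : \int[leb]_t _ = \int[leb]_t \sum_(y <- r) h y * (I y t * phi t)); last first.
    by apply: eq_Rintegral => t _; rewrite sumI big_distrl/=; apply: eq_bigr => y _; rewrite mulrA.
  rewrite Rintegral_sum; last by move=> y _; exact: RintegrableZ.
  by apply: eq_bigr => y _; rewrite RintegralZ// mulrC.
have ZE w : Z w = \sum_(y <- r) c y * X y w.
  rewrite /Z /RintR -(intI (X ^~ w)).
  by apply: eq_Rintegral => t _; rewrite mulrC.
have VE : \int[leb]_l (F l * ((\sum_(y <- r) c y * cos (l * y)) ^+ 2 +
     (\sum_(y <- r) c y * sin (l * y)) ^+ 2)) = V.
  apply: eq_Rintegral => l _.
  by rewrite /C /S (intI (fun y => cos (l * y))) (intI (fun y => sin (l * y))).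
have := gaussian_process_sum r c.
rewrite (_ : (fun w => _) = Z); last by apply/funext => w; rewrite ZE.
by rewrite /= VE => -[].
Qed.

(* Sample the process at a simple function of time, g n t -> t: the integral becomes a
   finite sum, and mean-square continuity controls the error. *)
Lemma process_integral_gaussian :
  let Z := fun w => RintR (fun t => phi t * X t w) in
  let V := \int[leb]_l (F l * FTabs2 phi l) in
  \int[P]_w cos (Z w) = expR (- (V / 2)) /\ \int[P]_w sin (Z w) = 0.
Proof.
move=> Z V.
have mphi := Rintegrable_measurable phi_i.
pose N := \int[leb]_x `|phi x|.
have [g [mg fg gcvg]] : exists g : nat -> R -> R, [/\ forall n, measurable_fun [set: R] (g n),
    forall n, finite_set (range (g n)) & forall t : R, g n t @[n --> \oo] --> t].
  have mE : measurable_fun setT (EFin : measurableTypeR R -> \bar R) by exact/measurable_EFinP.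
  have [g gcvg] := @approximation_sfun _ (measurableTypeR R) R EFin setT measurableT mE.
  exists (fun n => g n); split => [n|n|t].
  - have h := @measurable_funPT _ _ (measurableTypeR R) R (g n); exact: h.
  - have h := @fimfunP (measurableTypeR R) R (g n); exact: h.
  - by have /fine_cvg := gcvg t I.
pose D n w := RintR (fun t => phi t * (X t w - X (g n t) w)).
pose Zn n w := RintR (fun t => phi t * X (g n t) w).
have iX t : Rintegrable P (X t) by have [] := process_marginal t.
have [aeZ mZ iZ _ _] := kernel_integral mX iX process_norm_le.
have mXn n := measurable_process_subst (mg n).
have kZn n := kernel_integral (mXn n) (fun t => iX (g n t)) (fun t => process_norm_le (g n t)).
have normB n t : \int[P]_w `|X t w - X (g n t) w| <= 2 * (1 + \int[leb]_l F l).
  apply: (@le_trans _ _ (\int[P]_w (`|X t w| + `|X (g n t) w|))).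
    apply: le_Rintegral => //.
    - by apply: Rintegrable_norm; exact: RintegrableB.
    - by apply: RintegrableD; exact: Rintegrable_norm.
    - by move=> w _; exact: ler_normB.
  rewrite RintegralD//; do ?exact: Rintegrable_norm.
  by have := process_norm_le t; have := process_norm_le (g n t); lra.
have kD n := kernel_integral (measurable_funB mX (mXn n)) (fun t => RintegrableB (iX t) (iX (g n t))) (normB n).
have bD n t : `| `|phi t| * \int[P]_w `|X t w - X (g n t) w| | <= 2 * (1 + \int[leb]_l F l) * `|phi t|.
  by rewrite ger0_norm ?mulr_ge0 ?Rintegral_ge0// mulrC ler_wpM2r.
have pD t : `|phi t| * \int[P]_w `|X t w - X (g n t) w| @[n --> \oo] --> (cst 0 t : R).
  rewrite /cst -(mulr0 `|phi t|); apply: cvgM; first exact: cvg_cst.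
  apply/cvgrPdist_le => e e0.
  have := incr_sqr_cvg (gcvg t).
  move=> /cvgrPdist_le /(_ (e ^+ 2)); rewrite exprn_gt0// => /(_ isT).
  apply: filterS => n; rewrite !sub0r !normrN [X in X <= _ -> _]ger0_norm ?Rintegral_ge0//; last first.
    by move=> w _; exact: sqr_ge0.
  move=> hn; rewrite ger0_norm ?Rintegral_ge0//.
  have one : Rintegrable P (fun=> e / 2) by exact: finite_measure_integrable_cst.
  have e1 : \int[P]_w (e / 2) = e / 2 by have := expectation_cst P (e / 2); rewrite unlock /Rintegral /cst => ->.
  have i2 := Rintegrable_incr t (g n t).
  (* By [|x| <= e / 2 + x^2 / (2 e)], a mean square of at most [e^2] gives a mean absolute value of
     at most [e]. *)
  apply: (@le_trans _ _ (\int[P]_w (e / 2 + (2 * e)^-1 * (X t w - X (g n t) w) ^+ 2))).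
    apply: le_Rintegral => //.
    - by apply: Rintegrable_norm; exact: RintegrableB.
    - by apply: RintegrableD => //; exact: RintegrableZ.
    - move=> w _; set y := X t w - _.
      rewrite -(ler_pM2l (_ : 0 < 2 * e)); last by rewrite mulr_gt0.
      rewrite mulrDr [X in _ <= _ + X]mulrA divff ?mul1r; last by rewrite gt_eqF// mulr_gt0.
      rewrite -(real_normK (num_real y)); set z := `|y|.
      have := sqr_ge0 (z - e); rewrite [X in _ -> _ <= X + _](_ : _ = e ^+ 2); last by field.
      lra.
  rewrite RintegralD//; last exact: RintegrableZ.
  rewrite e1 RintegralZ// -/(incr_sqr _ _).
  rewrite -lerBrDl (_ : e - e / 2 = (2 * e)^-1 * e ^+ 2); last by field; rewrite gt_eqF.
  by rewrite ler_wpM2l// invr_ge0 mulr_ge0// ltW.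
have D0 : \int[P]_w `|D n w| @[n --> \oo] --> 0.
  have [_] := @Rintegral_dct _ _ _ leb (fun n t => `|phi t| * \int[P]_w `|X t w - X (g n t) w|) (cst 0)
    (fun t => 2 * (1 + \int[leb]_l F l) * `|phi t|)
    (fun n => let: And5 _ _ _ i _ := kD n in Rintegrable_measurable i)
    (RintegrableZ _ (Rintegrable_norm phi_i)) bD pD.
  rewrite [X in _ --> X](_ : _ = 0); last by rewrite /Rintegral integral0.
  move=> h; apply: (cvgn_squeeze _ h) => n.
  by rewrite subr0 ger0_norm ?Rintegral_ge0//; have [] := kD n.
have ZnZ n : {ae P, forall w, Z w - Zn n w = D n w}.
  have [aen _ _ _ _] := kZn n.
  apply: filterS2 aeZ aen => w h1 h2.
  rewrite /Z /Zn /D /RintR -RintegralB//.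
  by apply: eq_Rintegral => t _; rewrite mulrBr.
have iZn n : Rintegrable P (Zn n) by have [] := kZn n.
have iDn n : Rintegrable P (D n) by have [] := kD n.
have mZn n : measurable_fun setT (Zn n) by have [] := kZn n.
have one : Rintegrable P (fun=> 1) by exact: finite_measure_integrable_cst.
(* For a 1-Lipschitz function the error is at most the mean of [|Z - Zn n|], which tends to 0 by
   [D0]. *)
have lipD (h : R -> R) : continuous h -> (forall x, `|h x| <= 1) ->
    (forall x y, `|h x - h y| <= `|x - y|) ->
    \int[P]_w h (Zn n w) @[n --> \oo] --> \int[P]_w h (Z w).
  move=> ch h1 hl.
  have ih (f : T -> R) : measurable_fun setT f -> Rintegrable P (fun w => h (f w)).
    move=> mf; apply: (le_Rintegrable _ _ one) => //.
    by apply: measurableT_comp mf; exact: continuous_measurable.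
  apply: (cvgn_squeeze _ D0) => n; rewrite distrC.
  rewrite -RintegralB//; do ?exact: ih.
  apply: le_trans (le_normr_Rintegral _ _) _ => //.
    by apply: RintegrableB; exact: ih.
  rewrite -(@ae_eq_Rintegral _ _ _ P (fun w => `|Z w - Zn n w|) (fun w => `|D n w|)); last 3 first.
  - by apply: Rintegrable_norm; exact: RintegrableB.
  - exact: Rintegrable_norm.
  - by apply: filterS (ZnZ n) => w ->.
  apply: le_Rintegral => //.
  - by apply: Rintegrable_norm; apply: RintegrableB; exact: ih.
  - by apply: Rintegrable_norm; exact: RintegrableB.
have cosD := lipD cos (@continuous_cos R) (@normr_cos_le1 _) (@normr_cosB R).
have sinD := lipD sin (@continuous_sin R) (@normr_sin_le1 _) (@normr_sinBB R).
pose Cn n l := \int[leb]_t (cos (l * g n t) * phi t).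
pose Sn n l := \int[leb]_t (sin (l * g n t) * phi t).
have mcn n l : measurable_fun [set: R] (fun t => cos (l * g n t)).
  by apply: measurable_cos_comp; exact: measurable_funM.
have msn n l : measurable_fun [set: R] (fun t => sin (l * g n t)).
  by apply: measurable_sin_comp; exact: measurable_funM.
have CnC l : Cn n l @[n --> \oo] --> FTre phi l.
  have [] := @Rintegral_dct _ _ _ leb (fun n t => cos (l * g n t) * phi t) (fun t => cos (l * t) * phi t)
    (fun t => `|phi t|) _ _ _ _ => //.
  + by move=> n; apply: measurable_funM; [exact: mcn|exact: mphi].
  + exact: Rintegrable_norm.
  + by move=> n x; rewrite normrM ler_piMl// normr_cos_le1.
  + move=> x; apply: cvgM; last exact: cvg_cst.
    apply: (cvg_comp (fun n => l * g n x) cos _ (@continuous_cos R (l * x))).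
    by apply: cvgM; [exact: cvg_cst|exact: gcvg].
have SnS l : Sn n l @[n --> \oo] --> FTim phi l.
  have [] := @Rintegral_dct _ _ _ leb (fun n t => sin (l * g n t) * phi t) (fun t => sin (l * t) * phi t)
    (fun t => `|phi t|) _ _ _ _ => //.
  + by move=> n; apply: measurable_funM; [exact: msn|exact: mphi].
  + exact: Rintegrable_norm.
  + by move=> n x; rewrite normrM ler_piMl// normr_sin_le1.
  + move=> x; apply: cvgM; last exact: cvg_cst.
    apply: (cvg_comp (fun n => l * g n x) sin _ (@continuous_sin R (l * x))).
    by apply: cvgM; [exact: cvg_cst|exact: gcvg].
pose Vn n := \int[leb]_l (F l * (Cn n l ^+ 2 + Sn n l ^+ 2)).
have VnV : Vn n @[n --> \oo] --> V.
  have [] := @Rintegral_dct _ _ _ leb (fun n l => F l * (Cn n l ^+ 2 + Sn n l ^+ 2))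
    (fun l => F l * FTabs2 phi l) (fun l => (2 * N ^+ 2) * F l) _ _ _ _ => //.
  + move=> n; apply: measurable_funM => //.
    have cC : continuous (Cn n).
      by move=> l; apply/(@cvg_nbhsP _ R^o) => u ul; exact: (cvg_FT_subst phi_i (mg n) ul).1.
    have cS : continuous (Sn n).
      by move=> l; apply/(@cvg_nbhsP _ R^o) => u ul; exact: (cvg_FT_subst phi_i (mg n) ul).2.
    by apply: measurable_funD; apply: measurable_funX; exact: continuous_measurable.
  + by apply: RintegrableZ; exact: Rintegrable_spectral.
  + move=> n l; rewrite normrM ger0_norm// mulrC ler_wpM2r//.
    have h (x y : R) : `|x| <= y -> x ^+ 2 <= y ^+ 2.
      by move=> xy; rewrite -real_normK ?num_real// ler_sqr// nnegrE (le_trans _ xy).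
    rewrite ger0_norm ?addr_ge0 ?sqr_ge0//.
    have := h _ _ (le_normr_Rintegral_bounded phi_i (mcn n l) (fun x => normr_cos_le1 _)).
    have := h _ _ (le_normr_Rintegral_bounded phi_i (msn n l) (fun x => normr_sin_le1 _)).
    by rewrite /Cn /Sn /N; lra.
  + move=> l; apply: cvgM; first exact: cvg_cst.
    by rewrite /FTabs2 expr2 (expr2 (FTim _ _)); apply: cvgD; rewrite /=; under eq_fun do rewrite expr2; apply: cvgM.
have sp n := simple_process_integral (mg n) (fg n).
split.
- apply: (cvgn_unique cosD).
  rewrite (_ : (fun n => _) = (fun n => expR (- (Vn n / 2)))); last first.
    by apply/funext => n; exact: (sp n).1.
  apply: (cvg_comp (fun n => - (Vn n / 2)) expR _ (@continuous_expR R _)).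
  by apply: cvgN; apply: cvgM => //; exact: cvg_cst.
- apply: (cvgn_unique sinD).
  rewrite (_ : (fun n => _) = (fun n => 0)); first exact: cvg_cst.
  by apply/funext => n; exact: (sp n).2.
Qed.
End kernel_integral.
End gaussian_process.

(** * Polynomial approximation *)

Section weierstrass.
Context (R : realType).
Implicit Types (f k : R -> R) (x y : R) (g : nat -> R) (p : {poly R}).

(** Only [x] has to lie in the segment; [y] may leave it, so that shifted arguments are covered
    too. *)
Lemma segment_unif_continuous k (a b e : R) : continuous k -> 0 < e ->
  exists2 D : R, 0 < D & forall x y, a <= x <= b -> `|x - y| < D -> `|k x - k y| < e.
Proof.
move=> ck e0.
have /compact_near_coveringP cov := @segment_compact R a b.
pose Q (n : nat) x := forall y, `|x - y| < n.+1%:R^-1 -> `|k x - k y| < e.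
have /cov : forall x, `[a, b]%classic x -> \forall x' \near x & n \near \oo, Q n x'.
  move=> x _; have e2 : 0 < e / 2 by lra.
  have /cvgrPdist_lt/(_ _ e2)[D /= D0 hD] := ck x.
  have hn : \forall n \near \oo, n.+1%:R^-1 < D / 2.
    by apply: (near_infty_natSinv_lt (PosNum (divr_gt0 D0 (ltr0Sn R 1)))).
  have {}hD t : `|x - t| < D -> `|k x - k t| < e / 2 := hD t.
  exists ([set z | `|x - z| < D / 2], [set n | n.+1%:R^-1 < D / 2]) => /=.
    split => //; exists (D / 2) => //=; lra.
  move=> [z n] [xz nD] y zy.
  have {}xz : `|x - z| < D / 2 := xz; have {}nD : n.+1%:R^-1 < D / 2 := nD.
  have {}zy : `|z - y| < n.+1%:R^-1 := zy.
  have h1 : `|k x - k z| < e / 2 by apply: hD => /=; lra.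
  have h2 : `|k x - k y| < e / 2.
    by apply: hD; apply: (le_lt_trans (ler_distD z x y)); rewrite (splitr D) ltrD// (lt_trans zy).
  have := ler_distD (k x) (k z) (k y); rewrite (distrC (k z) (k x)); lra.
move=> [N _ /(_ N (leqnn N)) h]; exists N.+1%:R^-1; first by rewrite invr_gt0.
by move=> x y axb; apply: h; rewrite /= in_itv.
Qed.

(* The expectation of g at the number of heads in n tosses of an 'X-coin, by conditioning on
   one toss. *)
Fixpoint bern (n : nat) g : {poly R} :=
  if n is n'.+1 then (1 - 'X) * bern n' g + 'X * bern n' (g \o S) else (g 0%N)%:P.

Lemma bern_le n g g' x : 0 <= x <= 1 -> (forall i, (i <= n)%N -> g i <= g' i) ->
  (bern n g).[x] <= (bern n g').[x].
Proof.
move=> /andP[x0 x1]; elim: n g g' => [|n IH] g g' h /=; first by rewrite !hornerC h.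
rewrite !(hornerD, hornerM, hornerN, hornerX, hornerC, hornerN) lerD// ler_wpM2l ?subr_ge0//.
  by apply: IH => i iN; apply: h; exact: leqW.
by apply: IH => i iN; exact: h.
Qed.

(** The binomial variance [n x (1 - x)] plus the squared distance of the mean to [c]. The centre is
    general because a head in the first toss moves it to [c - 1]. *)
Lemma bern_quad n (a b c x : R) : (bern n (fun i => a + b * (i%:R - c) ^+ 2)).[x] =
  a + b * (n%:R * (x * (1 - x)) + (n%:R * x - c) ^+ 2).
Proof.
elim: n c => [|n IH] c /=; first by rewrite hornerC; ring.
rewrite (_ : _ \o S = (fun i => a + b * (i%:R - (c - 1)) ^+ 2)); last first.
  by apply/funext => i /=; rewrite -natr1; ring.
by rewrite !(hornerD, hornerM, hornerN, hornerX, hornerC) !IH -natr1; ring.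
Qed.

(** Bernstein's proof. The increment of [k] is at most [e / 2] at distance below [D] and at most
    [2 B] elsewhere, hence at most [e / 2 + C (x - y)^2]; under the binomial law the second term has
    mean at most [C / n]. *)
Lemma weierstrass k e : continuous k -> 0 < e ->
  exists p, forall x, 0 <= x <= 1 -> `|p.[x] - k x| <= e.
Proof.
move=> ck e0; have e2 : 0 < e / 2 by lra.
have [D D0 hD] := @segment_unif_continuous k 0 1 _ ck e2.
have [B hB] : exists B, forall x, 0 <= x <= 1 -> `|k x| <= B.
  have ckn : {within `[0, 1]%classic, continuous (fun x => `|k x|)}.
    apply: continuous_subspaceT => x; apply: cvg_norm; exact: ck.
  have [z _ hz] := EVT_max ler01 ckn.
  by exists `|k z| => x x01; apply: hz; rewrite in_itv.
have B0 : 0 <= B by apply: (le_trans (normr_ge0 _) (hB 0 _)); rewrite lexx ler01.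
pose C := 2 * B / D ^+ 2.
have C0 : 0 <= C by rewrite divr_ge0 ?sqr_ge0// mulr_ge0.
have key x y : 0 <= x <= 1 -> 0 <= y <= 1 -> `|k x - k y| <= e / 2 + C * (x - y) ^+ 2.
  move=> hx hy; have [xyD|Dxy] := ltP `|x - y| D.
    by apply: (le_trans (ltW (hD _ _ hx xyD))); rewrite lerDl mulr_ge0// sqr_ge0.
  have h1 : `|k x - k y| <= 2 * B.
    by have := ler_normB (k x) (k y); have := hB _ hx; have := hB _ hy; lra.
  apply: (le_trans h1); apply: ler_wpDl; first exact: ltW.
  rewrite [leRHS](_ : _ = 2 * B * (x - y) ^+ 2 / D ^+ 2); last by rewrite /C; ring.
  rewrite ler_pdivlMr ?exprn_gt0//.
  rewrite ler_wpM2l ?mulr_ge0// -[leRHS]real_normK ?num_real// ler_sqr ?nnegrE//; exact: ltW.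
pose n := (Num.trunc (C / (e / 2))).+1.
have hn : C / n%:R <= e / 2.
  rewrite ler_pdivrMr ?ltr0n// mulrC -ler_pdivrMr//; apply/ltW.
  by apply: truncnS_gt.
have n0 : (n%:R : R) != 0 by rewrite pnatr_eq0.
exists (bern n (fun i => k (i%:R / n%:R))) => x hx.
have range i : (i <= n)%N -> 0 <= (i%:R / n%:R : R) <= 1.
  by move=> iN; rewrite divr_ge0//= ler_pdivrMr ?ltr0n// mul1r ler_nat.
have q0 : x * (1 - x) <= 1 by case/andP: hx => h0 h1; nra.
have q1 : C / n%:R ^+ 2 * (n%:R * (x * (1 - x)) + (n%:R * x - n%:R * x) ^+ 2) <= e / 2.
  rewrite subrr expr0n/= addr0.
  have -> : C / n%:R ^+ 2 * (n%:R * (x * (1 - x))) = C / n%:R * (x * (1 - x)) by field.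
  apply: le_trans hn; rewrite ler_piMr// divr_ge0//.
have sqE i : C * (i%:R / n%:R - x) ^+ 2 = C / n%:R ^+ 2 * (i%:R - n%:R * x) ^+ 2 by field.
rewrite ler_norml; apply/andP; split.
  have h : (bern n (fun i => (k x - e / 2) + - (C / n%:R ^+ 2) * (i%:R - n%:R * x) ^+ 2)).[x] <=
     (bern n (fun i => k (i%:R / n%:R))).[x].
    apply: bern_le => // i iN; have := key _ _ (range i iN) hx.
    by rewrite ler_norml sqE => /andP[? ?]; lra.
  by move: h; rewrite bern_quad; lra.
have h : (bern n (fun i => k (i%:R / n%:R))).[x] <=
    (bern n (fun i => (k x + e / 2) + C / n%:R ^+ 2 * (i%:R - n%:R * x) ^+ 2)).[x].
  apply: bern_le => // i iN; have := key _ _ (range i iN) hx.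
  by rewrite ler_norml sqE => /andP[? ?]; lra.
by move: h; rewrite bern_quad; lra.
Qed.

Lemma poly_antiderivative p : exists q, q^`() = p.
Proof.
exists (\poly_(i < (size p).+1) (p`_i.-1 / i%:R)); apply/polyP => i.
rewrite coef_deriv coef_poly ltnS; case: ltnP => ip.
  by rewrite -[LHS]mulr_natr -mulrA mulVf ?mulr1// pnatr_eq0.
by rewrite mul0rn nth_default.
Qed.

Lemma der_horner p x : is_derive x 1 (fun y => p.[y]) p^`().[x].
Proof.
elim/poly_ind: p => [|p c IH].
  by rewrite deriv0 horner0; under eq_fun do rewrite horner0; exact: derC.
rewrite (_ : (fun y => _) = (fun y => p.[y] * y + c)); last first.
  by apply/funext => y; rewrite !(hornerD, hornerM, hornerX, hornerC).
eapply der_eq; first by der.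
rewrite derivD derivM derivX derivC mulr1 addr0 !(hornerD, hornerM, hornerX, hornerC).
rewrite /GRing.scale/=; ring.
Qed.

(** The derivative is approximated and the polynomial integrated: closeness passes from [f'] to [f],
    but not conversely. *)
Lemma C1_weierstrass f f' (M e : R) : (forall x, is_derive x 1 f (f' x)) -> continuous f' ->
  0 < M -> 0 < e -> exists p, forall x, 0 <= x <= M ->
    `|p.[x] - f x| <= e * M /\ `|p^`().[x] - f' x| <= e.
Proof.
move=> df cf' M0 e0.
have ck : continuous (fun x => f' (M * x)).
  by move=> x; apply: continuous_comp; [exact: mulrl_continuous|exact: cf'].
have [p0 hp0] := weierstrass ck e0.
pose p1 := p0 \Po (M^-1 *: 'X).
have hp1 x : 0 <= x <= M -> `|p1.[x] - f' x| <= e.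
  move=> /andP[x0 xM]; rewrite /p1 horner_comp hornerZ hornerX.
  have := hp0 (M^-1 * x); rewrite mulVKf ?gt_eqF//; apply.
  by rewrite mulrC ler_pdivrMr// mul1r xM divr_ge0// ltW.
have [q hq] := poly_antiderivative p1.
exists (q + (f 0 - q.[0])%:P) => x hx; split; last first.
  by rewrite derivD derivC addr0 hq; exact: hp1.
rewrite hornerD hornerC.
have dD y : is_derive y 1 (fun z => q.[z] - f z) (p1.[y] - f' y).
  have dq := der_horner q y; rewrite -hq; exact: derD dq (derN (df y)).
have [x0 xM] := andP hx.
have [c /andP[c0 cx] e1] := der_mvt dD x0.
have -> : q.[x] + (f 0 - q.[0]) - f x = (p1.[c] - f' c) * (x - 0) by rewrite -e1; ring.
rewrite subr0 normrM (ger0_norm x0) ler_pM//; apply: hp1; rewrite c0/=; lra.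
Qed.
End weierstrass.

(** * Gaussian integration by parts *)

Section bounded_measurable.
Context (R : realType) d (T : measurableType d) (P : probability T R).

Definition bounded_measurable (f : T -> R) :=
  measurable_fun setT f /\ exists M, forall w, `|f w| <= M.
Local Notation bm := bounded_measurable.

Lemma bm_cst (c : R) : bm (fun=> c).
Proof. by split => //; exists `|c|. Qed.

Lemma bmD f g : bm f -> bm g -> bm (fun w => f w + g w).
Proof.
move=> [mf [M hM]] [mg [N hN]]; split; first exact: measurable_funD.
by exists (M + N) => w; rewrite (le_trans (ler_normD _ _))// lerD.
Qed.

Lemma bmM f g : bm f -> bm g -> bm (fun w => f w * g w).
Proof.
move=> [mf [M hM]] [mg [N hN]]; split; first exact: measurable_funM.
by exists (M * N) => w; rewrite normrM ler_pM.
Qed.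

Lemma bmZ c f : bm f -> bm (fun w => c * f w).
Proof. by move=> bf; apply: bmM => //; exact: bm_cst. Qed.

Lemma bmB f g : bm f -> bm g -> bm (fun w => f w - g w).
Proof.
move=> bf bg; have := bmD bf (bmZ (-1) bg).
by under eq_fun do rewrite mulN1r.
Qed.

Lemma bm_cos f : measurable_fun setT f -> bm (fun w => cos (f w)).
Proof.
by move=> mf; split; [exact: measurable_cos_comp|exists 1 => w; exact: normr_cos_le1].
Qed.

Lemma bm_sin f : measurable_fun setT f -> bm (fun w => sin (f w)).
Proof.
by move=> mf; split; [exact: measurable_sin_comp|exists 1 => w; exact: normr_sin_le1].
Qed.

Lemma bmX f N : bm f -> bm (fun w => f w ^+ N).
Proof.
move=> bf; elim: N => [|N IH]; first by under eq_fun do rewrite expr0; exact: bm_cst.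
by under eq_fun do rewrite exprS; exact: bmM.
Qed.

Lemma bmZI f g : bm f -> Rintegrable P g -> Rintegrable P (fun w => g w * f w).
Proof.
move=> [mf [M hM]] ig; have mg := Rintegrable_measurable ig.
apply: (le_Rintegrable _ _ (RintegrableZ M (Rintegrable_norm ig))).
  exact: measurable_funM.
by move=> w; rewrite normrM mulrC ler_wpM2r.
Qed.

Lemma Rintegrable_cst (c : R) : Rintegrable P (fun=> c).
Proof. exact: finite_measure_integrable_cst. Qed.

Lemma Rintegral_cst_prob (c : R) : \int[P]_w c = c.
Proof. by have := expectation_cst P c; rewrite unlock /Rintegral /cst => ->. Qed.

Lemma bmI f : bm f -> Rintegrable P f.
Proof.
by move=> bf; have := bmZI bf (Rintegrable_cst 1); under eq_fun do rewrite mul1r.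
Qed.
End bounded_measurable.
Notation bm := bounded_measurable.

Lemma der_unique (R : realType) (f : R -> R) (x a b : R) :
  is_derive x 1 f a -> is_derive x 1 f b -> a = b.
Proof. by move=> [_ <-] [_ <-]. Qed.

Lemma cvg_sumr (R : realType) n (u : nat -> 'I_n -> R) (v : 'I_n -> R) :
  (forall i, u N i @[N --> \oo] --> v i) ->
  \sum_i u N i @[N --> \oo] --> \sum_i v i.
Proof.
move=> uv; elim: (index_enum _) => [|i r IH].
  by under eq_fun do rewrite big_nil; rewrite big_nil; exact: cvg_cst.
by under eq_fun do rewrite big_cons; rewrite big_cons; apply: cvgD => //; exact: uv.
Qed.

Section gaussian_vector.
Context (R : realType) d (T : measurableType d) (P : probability T R).
Variables (n : nat) (Z : 'I_n -> T -> R) (G : 'I_n -> 'I_n -> R).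
Hypothesis mZ : forall i, measurable_fun setT (Z i).
Hypothesis Gsym : forall i j, G i j = G j i.

Definition lin (u : 'I_n -> R) (w : T) := \sum_i u i * Z i w.
Definition qform (u : 'I_n -> R) := \sum_i \sum_j u i * u j * G i j.

Hypothesis Gpos : forall u, 0 <= qform u.
Hypothesis Zcos : forall u, \int[P]_w cos (lin u w) = expR (- (qform u / 2)).
Hypothesis Zsin : forall u, \int[P]_w sin (lin u w) = 0.

Definition dir (k : 'I_n) (e : R) (i : 'I_n) := e * (i == k)%:R.

Lemma sum_dir k e (f : 'I_n -> R) : \sum_i dir k e i * f i = e * f k.
Proof.
rewrite (bigD1 k)//= big1 ?addr0; first by rewrite /dir eqxx mulr1.
by move=> i ik; rewrite /dir (negbTE ik) mulr0 mul0r.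
Qed.

Lemma lin_dir k e w : lin (dir k e) w = e * Z k w.
Proof. exact: sum_dir. Qed.

Lemma linD u v w : lin (fun i => u i + v i) w = lin u w + lin v w.
Proof. by rewrite /lin -big_split/=; apply: eq_bigr => i _; rewrite mulrDl. Qed.

Lemma linB u v w : lin (fun i => u i - v i) w = lin u w - lin v w.
Proof. by rewrite /lin -sumrB; apply: eq_bigr => i _; rewrite mulrBl. Qed.

Lemma qformD u k e : qform (fun i => u i + dir k e i) =
  qform u + 2 * e * (\sum_l G k l * u l) + e ^+ 2 * G k k.
Proof.
rewrite /qform.
transitivity (\sum_i \sum_j (u i * u j * G i j) + \sum_i \sum_j (u i * (dir k e j * G i j)) +
   \sum_i \sum_j (dir k e i * (u j * G i j)) + \sum_i \sum_j (dir k e i * (dir k e j * G i j))).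
  rewrite -!big_split/=; apply: eq_bigr => i _; rewrite -!big_split/=; apply: eq_bigr => j _.
  by ring.
have -> : \sum_i \sum_j u i * (dir k e j * G i j) = e * \sum_l G k l * u l.
  rewrite mulr_sumr; apply: eq_bigr => i _.
  by rewrite -mulr_sumr sum_dir Gsym; ring.
have -> : \sum_i \sum_j dir k e i * (u j * G i j) = e * \sum_l G k l * u l.
  under eq_bigr do rewrite -mulr_sumr.
  rewrite sum_dir; congr (_ * _); apply: eq_bigr => i _; exact: mulrC.
have -> : \sum_i \sum_j dir k e i * (dir k e j * G i j) = e ^+ 2 * G k k.
  under eq_bigr do rewrite -mulr_sumr.
  by rewrite sum_dir sum_dir; ring.
by ring.
Qed.

Lemma qform_dir k e : qform (dir k e) = e ^+ 2 * G k k.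
Proof.
rewrite /qform; transitivity (\sum_i \sum_j dir k e i * (dir k e j * G i j)).
  by apply: eq_bigr => i _; apply: eq_bigr => j _; rewrite mulrA.
under eq_bigr do rewrite -mulr_sumr.
by rewrite sum_dir sum_dir; ring.
Qed.

Lemma measurable_lin u : measurable_fun setT (lin u).
Proof. by apply: measurable_sum => i; apply: measurable_funM. Qed.

Lemma cvg_cos_quad (x : R) :
  (2 - 2 * cos (n0.+1%:R^-1 * x)) / n0.+1%:R^-1 ^+ 2 @[n0 --> \oo] --> x ^+ 2.
Proof.
have h (t : R) : 0 < t -> `|(2 - 2 * cos (t * x)) / t ^+ 2 - x ^+ 2| <= 2 * `|x| ^+ 3 * t.
  move=> t0; pose y := t * `|x|.
  have y0 : 0 <= y by rewrite mulr_ge0// ltW.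
  have cy : cos (t * x) = cos y.
    rewrite /y; case: (ger0P x) => // _; by rewrite mulrN cosN.
  have x2 : x ^+ 2 = y ^+ 2 / t ^+ 2.
    by rewrite /y exprMn real_normK ?num_real//; field; rewrite gt_eqF.
  rewrite cy x2 -mulrBl normrM normfV [X in _ / X]ger0_norm ?sqr_ge0//.
  rewrite ler_pdivrMr ?exprn_gt0//.
  have -> : 2 * `|x| ^+ 3 * t * t ^+ 2 = 2 * y ^+ 3 by rewrite /y; ring.
  rewrite ler_norml; have := cos_le_cubic y0; have := cos_ge_quad y.
  have := exprn_ge0 3 y0; lra.
apply: (@cvgn_squeeze _ _ (fun n0 => 2 * `|x| ^+ 3 * n0.+1%:R^-1)) => [n0|].
  by apply: h; rewrite invr_gt0.
rewrite -(mulr0 (2 * `|x| ^+ 3)); apply: cvgM; [exact: cvg_cst|exact: cvg_harmonic].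
Qed.

(* Fatou: (2 - 2 cos (t z)) / t^2 tends to z^2 as t -> 0, and the expectation of its
   square is known. *)
Lemma Rintegrable_fourth k : Rintegrable P (fun w => Z k w ^+ 4).
Proof.
pose t (N : nat) : R := N.+1%:R^-1.
have t0 N : 0 < t N by rewrite invr_gt0.
pose f N w := ((2 - 2 * cos (t N * Z k w)) / t N ^+ 2) ^+ 2.
have mt N : measurable_fun setT (fun w => t N * Z k w) by exact: measurable_funM.
have bf N : bm (f N).
  apply: bmX; apply: bmM; last exact: bm_cst.
  by apply: bmB; [exact: bm_cst|apply: bmZ; exact: bm_cos].
apply: (@Rintegral_fatou _ _ _ P f _ (4 * G k k ^+ 2)).
- by move=> N; exact: bmI.
- by move=> N w; exact: sqr_ge0.
(* The expansion [(2 - 2 cos y)^2 = 6 - 8 cos y + 2 cos (2 y)] has an expectation given by the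
   characteristic function. *)
- move=> N; rewrite (_ : \int[P]_w f N w =
    \int[P]_w (t N ^- 4 * (6 - 8 * cos (lin (dir k (t N)) w) + 2 * cos (lin (dir k (2 * t N)) w)))); last first.
    apply: eq_Rintegral => w _; rewrite !lin_dir /f.
    set y := t N * Z k w.
    have -> : 2 * t N * Z k w = y + y by rewrite /y; ring.
    rewrite cosD -!expr2 sin2cos2; field; exact: lt0r_neq0.
  have i1 u : Rintegrable P (fun w => cos (lin u w)) by apply: bmI; apply: bm_cos; exact: measurable_lin.
  rewrite RintegralZ; last first.
    by apply: RintegrableD; [apply: RintegrableB; [exact: Rintegrable_cst|exact: RintegrableZ]|exact: RintegrableZ].
  rewrite RintegralD//; [|by apply: RintegrableB; [exact: Rintegrable_cst|exact: RintegrableZ]|exact: RintegrableZ].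
  rewrite RintegralB//; [|exact: Rintegrable_cst|exact: RintegrableZ].
  rewrite !RintegralZ// Rintegral_cst_prob !Zcos !qform_dir.
  rewrite mulrC ler_pdivrMr ?exprn_gt0//.
  set x := t N ^+ 2 * G k k / 2.
  have x0 : 0 <= x.
    by have := Gpos (dir k 1); rewrite qform_dir expr1n mul1r => g0; rewrite /x divr_ge0// mulr_ge0// sqr_ge0.
  have -> : (2 * t N) ^+ 2 * G k k / 2 = 4 * x by rewrite /x; field.
  have -> : 4 * G k k ^+ 2 * t N ^+ 4 = 16 * x ^+ 2 by rewrite /x; field.
  (* Orders 0 and 1 cancel: [6 - 8 (1 - x) + 2 (1 - 4 x + 8 x^2) = 16 x^2]. *)
  have := expRN_ge x; have := @expRN_le_quad R (4 * x); rewrite mulr_ge0// => /(_ isT).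
  lra.
- move=> w; rewrite (_ : Z k w ^+ 4 = Z k w ^+ 2 * Z k w ^+ 2); last by ring.
  by rewrite /f; under eq_fun do rewrite expr2; apply: cvgM; exact: cvg_cos_quad.
Qed.

(** A single majorant for all dominated convergences below. It is at least 1, so its powers
    increase, and its fourth power is integrable. *)
Definition rho w := 1 + \sum_i `|Z i w|.

Lemma rho_ge1 w : 1 <= rho w.
Proof. by rewrite lerDl sumr_ge0. Qed.

Lemma norm_le_rho k w : `|Z k w| <= rho w.
Proof. by rewrite /rho (bigD1 k)//= addrCA lerDl addr_ge0// sumr_ge0. Qed.

Lemma Rintegrable_rho4 : Rintegrable P (fun w => rho w ^+ 4).
Proof.
have key (f g : T -> R) : measurable_fun setT f -> measurable_fun setT g ->
   Rintegrable P (fun w => f w ^+ 4) -> Rintegrable P (fun w => g w ^+ 4) ->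
   Rintegrable P (fun w => (f w + g w) ^+ 4).
  move=> mf mg f4 g4; apply: (le_Rintegrable _ _ (RintegrableD (RintegrableZ 8 f4) (RintegrableZ 8 g4))).
    by apply: measurable_funX; exact: measurable_funD.
  move=> w; have -> : (f w + g w) ^+ 4 = ((f w + g w) ^+ 2) ^+ 2 by ring.
  rewrite ger0_norm ?sqr_ge0//; set x := f w; set y := g w.
  have h : (x + y) ^+ 2 <= 2 * (x ^+ 2 + y ^+ 2) by have := sqr_ge0 (x - y); lra.
  have : ((x + y) ^+ 2) ^+ 2 <= (2 * (x ^+ 2 + y ^+ 2)) ^+ 2.
    by rewrite ler_sqr ?nnegrE ?sqr_ge0// mulr_ge0// addr_ge0 ?sqr_ge0.
  have := sqr_ge0 (x ^+ 2 - y ^+ 2); lra.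
apply: (key) => //; first by apply: measurable_sum => i; exact: measurableT_comp.
  by under eq_fun do rewrite expr1n; exact: Rintegrable_cst.
suff : forall s : seq 'I_n, Rintegrable P (fun w => (\sum_(i <- s) `|Z i w|) ^+ 4) by exact.
elim => [|i s IH].
  by under eq_fun do rewrite big_nil expr0n/=; exact: Rintegrable_cst.
under eq_fun do rewrite big_cons.
apply: (key) => //.
- exact: measurableT_comp.
- by apply: measurable_sum => j; exact: measurableT_comp.
- rewrite (_ : (fun w => _) = (fun w => Z i w ^+ 4)); first exact: Rintegrable_fourth.
  apply/funext => w; rewrite (_ : `|Z i w| ^+ 4 = (`|Z i w| ^+ 2) ^+ 2); last by ring.
  by rewrite real_normK ?num_real//; ring.
Qed.

Lemma Rintegrable_rho_le (f : T -> R) C : measurable_fun setT f ->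
  (forall w, `|f w| <= C * rho w ^+ 4) -> Rintegrable P f.
Proof. by move=> mf fC; apply: (le_Rintegrable mf fC); apply: RintegrableZ; exact: Rintegrable_rho4. Qed.

Lemma rhoX_le m w : (m <= 4)%N -> rho w ^+ m <= rho w ^+ 4.
Proof. by move=> m4; apply: ler_weXn2l => //; exact: rho_ge1. Qed.

Lemma Rintegrable_Z k : Rintegrable P (Z k).
Proof.
apply: (@Rintegrable_rho_le _ 1) => // w; rewrite mul1r.
by rewrite (le_trans (norm_le_rho k w))// -[leLHS]expr1 rhoX_le.
Qed.

Lemma Rintegrable_Z2 k l : Rintegrable P (fun w => Z k w * Z l w).
Proof.
apply: (@Rintegrable_rho_le _ 1); first exact: measurable_funM.
move=> w; rewrite mul1r normrM (@le_trans _ _ (rho w ^+ 2))// ?rhoX_le//.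
by rewrite expr2 ler_pM// norm_le_rho.
Qed.

(** The characteristic function at [u + e 1_k] is differentiated at [e = 0] in two ways: under the
    expectation, which produces the factor [Z k], and on its explicit form, which produces the
    [k]-th entry of [G u]. *)
Lemma trig_stein u k :
  \int[P]_w (Z k w * sin (lin u w)) = (\sum_l G k l * u l) * \int[P]_w cos (lin u w) /\
  \int[P]_w (Z k w * cos (lin u w)) = 0.
Proof.
have one0 : forall w : T, 0 <= (cst 1 : T -> R) w by [].
have i2 : Rintegrable P (fun w => Z k w ^+ 2 * cst 1 w).
  under eq_fun do rewrite /cst mulr1 expr2; exact: Rintegrable_Z2.
have h1 := der_Rintegral_cos (measurable_lin u) (mZ k) one0 (Rintegrable_cst P 1) i2 0.
have h2 := der_Rintegral_sin (measurable_lin u) (mZ k) one0 (Rintegrable_cst P 1) i2 0.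
have E1 : (fun e => \int[P]_x (cos (lin u x + e * Z k x) * cst 1 x)) =
   (fun e => expR (- ((qform u + 2 * e * (\sum_l G k l * u l) + e ^+ 2 * G k k) / 2))).
  apply/funext => e; rewrite -qformD -Zcos; apply: eq_Rintegral => w _.
  by rewrite linD lin_dir /cst mulr1.
have E2 : (fun e => \int[P]_x (sin (lin u x + e * Z k x) * cst 1 x)) = (fun e => 0).
  apply/funext => e; rewrite -[RHS](Zsin (fun i => u i + dir k e i)); apply: eq_Rintegral => w _.
  by rewrite linD lin_dir /cst mulr1.
rewrite E1 in h1; rewrite E2 in h2; split.
- have h3 : is_derive (0 : R) 1 (fun e => expR (- ((qform u + 2 * e * (\sum_l G k l * u l) + e ^+ 2 * G k k) / 2)))
     (- ((\sum_l G k l * u l) * expR (- (qform u / 2)))).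
    set B := \sum_l G k l * u l.
    eapply der_eq; first by der.
    by rewrite /GRing.scale/= expr0n/= !mulr0 !mul0r !addr0; field.
  have := der_unique h1 h3 => /eqP; rewrite eqr_opp => /eqP; rewrite -Zcos => <-.
  by apply: eq_Rintegral => w _; rewrite /cst mulr1 mul0r addr0.
- have := der_unique h2 (derC 0 _) => e.
  by rewrite -[RHS]e; apply: eq_Rintegral => w _; rewrite /cst mulr1 mul0r addr0.
Qed.

(* D l plays the role of the l-th partial derivative of h as a function of Z. *)
Definition bibp (h : T -> R) (D : 'I_n -> T -> R) := [/\ bm h, forall l, bm (D l) &
  forall k, \int[P]_w (Z k w * h w) = \sum_l G k l * \int[P]_w D l w].

Lemma bibp_ext h D h' D' : bibp h D -> h =1 h' -> (forall l, D l =1 D' l) -> bibp h' D'.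
Proof.
move=> b /funext <- DD'; rewrite (_ : D' = D)//.
by apply/funext => l; apply/funext => w; rewrite DD'.
Qed.

Lemma bibp_lin a b h1 h2 D1 D2 : bibp h1 D1 -> bibp h2 D2 ->
  bibp (fun w => a * h1 w + b * h2 w) (fun l w => a * D1 l w + b * D2 l w).
Proof.
move=> [b1 d1 e1] [b2 d2 e2]; split.
- by apply: bmD; exact: bmZ.
- by move=> l; apply: bmD; exact: bmZ.
- move=> k; have i1 := bmZI b1 (Rintegrable_Z k); have i2 := bmZI b2 (Rintegrable_Z k).
  transitivity (\int[P]_w (a * (Z k w * h1 w) + b * (Z k w * h2 w))).
    by apply: eq_Rintegral => w _; ring.
  rewrite RintegralD//; [|exact: RintegrableZ|exact: RintegrableZ].
  rewrite !RintegralZ// e1 e2 !mulr_sumr -big_split/=; apply: eq_bigr => l _.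
  have j1 := bmI P (d1 l); have j2 := bmI P (d2 l).
  rewrite RintegralD//; [|exact: RintegrableZ|exact: RintegrableZ].
  by rewrite !RintegralZ//; ring.
Qed.

(* Stable under products with cos (lin v) and sin (lin v) by the product-to-sum formulas,
   hence satisfied by polynomials in cosQ. *)
Definition trig (h : T -> R) (D : 'I_n -> T -> R) := forall u,
  bibp (fun w => h w * cos (lin u w))
       (fun l w => D l w * cos (lin u w) - u l * (h w * sin (lin u w))) /\
  bibp (fun w => h w * sin (lin u w))
       (fun l w => D l w * sin (lin u w) + u l * (h w * cos (lin u w))).

Lemma trig1 : trig (fun=> 1) (fun _ _ => 0).
Proof.
move=> u.
have bc : bm (fun w => cos (lin u w)) by apply: bm_cos; exact: measurable_lin.
have bs : bm (fun w => sin (lin u w)) by apply: bm_sin; exact: measurable_lin.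
have ic := bmI P bc; have is_ := bmI P bs.
have b1 : bibp (fun w => cos (lin u w)) (fun l w => - u l * sin (lin u w)).
  split => // [l|k]; first exact: bmZ.
  rewrite (trig_stein u k).2; under eq_bigr do rewrite RintegralZ// Zsin !mulr0.
  by rewrite big1.
have b2 : bibp (fun w => sin (lin u w)) (fun l w => u l * cos (lin u w)).
  split => // [l|k]; first exact: bmZ.
  rewrite (trig_stein u k).1 mulr_suml; apply: eq_bigr => l _; rewrite RintegralZ//; ring.
by (split; [apply: (bibp_ext b1)|apply: (bibp_ext b2)]) => [w|l w|w|l w]; ring.
Qed.

Lemma trig_ext h D h' D' : trig h D -> h =1 h' -> (forall l, D l =1 D' l) -> trig h' D'.
Proof.
move=> b /funext <- DD'; rewrite (_ : D' = D)//.
by apply/funext => l; apply/funext => w; rewrite DD'.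
Qed.

Lemma trig_bibp h D : trig h D -> bibp h D.
Proof.
move=> /(_ (fun=> 0)) [b _]; have l0 w : lin (fun=> 0) w = 0.
  by rewrite /lin big1// => i _; rewrite mul0r.
by apply: (bibp_ext b) => [w|l w]; rewrite l0 cos0 ?sin0; ring.
Qed.

Lemma trig_lin a b h1 h2 D1 D2 : trig h1 D1 -> trig h2 D2 ->
  trig (fun w => a * h1 w + b * h2 w) (fun l w => a * D1 l w + b * D2 l w).
Proof.
move=> t1 t2 u; have [c1 s1] := t1 u; have [c2 s2] := t2 u.
by (split; [apply: (bibp_ext (bibp_lin a b c1 c2))|apply: (bibp_ext (bibp_lin a b s1 s2))])
  => [w|l w|w|l w]; ring.
Qed.

Lemma trig_cos h D v : trig h D ->
  trig (fun w => h w * cos (lin v w))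
       (fun l w => D l w * cos (lin v w) - v l * (h w * sin (lin v w))).
Proof.
move=> t u; have [c1 s1] := t (fun i => u i + v i); have [c2 s2] := t (fun i => u i - v i).
(split; [apply: (bibp_ext (bibp_lin 2^-1 2^-1 c1 c2))|apply: (bibp_ext (bibp_lin 2^-1 2^-1 s1 s2))])
  => [w|l w|w|l w]; rewrite linD linB ?cosB ?cosD ?sinB ?sinD; by field.
Qed.

Lemma trig_sin h D v : trig h D ->
  trig (fun w => h w * sin (lin v w))
       (fun l w => D l w * sin (lin v w) + v l * (h w * cos (lin v w))).
Proof.
move=> t u; have [c1 s1] := t (fun i => u i + v i); have [c2 s2] := t (fun i => u i - v i).
(split; [apply: (bibp_ext (bibp_lin 2^-1 (- 2^-1) s1 s2))|apply: (bibp_ext (bibp_lin (- 2^-1) 2^-1 c1 c2))])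
  => [w|l w|w|l w]; rewrite linD linB ?sinB ?sinD ?cosB ?cosD; by field.
Qed.

Lemma trig_sum (r : seq 'I_n) h D : (forall i : 'I_n, trig (h i) (D i)) ->
  trig (fun w => \sum_(i <- r) h i w) (fun l w => \sum_(i <- r) D i l w).
Proof.
move=> t; elim: r => [|i r IH].
  by apply: (trig_ext (trig_lin 0 0 trig1 trig1)) => [w|l w]; rewrite big_nil; ring.
by apply: (trig_ext (trig_lin 1 1 (t i) IH)) => [w|l w]; rewrite big_cons; ring.
Qed.

(** A bounded approximation of [Z i], chosen so that [2 * sinZ e i] is the partial derivative of
    [cosQ e] with respect to [Z i]. *)
Definition sinZ (e : R) i w := e^-1 * sin (e * Z i w).

(* A trigonometric approximation of sum_i Z_i^2 as e -> 0. *)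
Definition cosQ (e : R) w := \sum_i (2 - 2 * cos (e * Z i w)) / e ^+ 2.

Lemma trig_sinZ h D e i : e != 0 -> trig h D ->
  trig (fun w => h w * sinZ e i w)
    (fun l w => D l w * sinZ e i w + (l == i)%:R * (h w * cos (e * Z i w))).
Proof.
move=> e0 t; have t1 := trig_sin (dir i e) t.
by apply: (trig_ext (trig_lin e^-1 0 t1 t1)) => [w|l w]; rewrite lin_dir /sinZ /dir; field.
Qed.

Lemma trig_cosQ h D e : e != 0 -> trig h D ->
  trig (fun w => h w * cosQ e w)
    (fun l w => D l w * cosQ e w + h w * (2 * sinZ e l w)).
Proof.
move=> e0 t; pose t1 i := trig_lin (2 / e ^+ 2) (- (2 / e ^+ 2)) t (trig_cos (dir i e) t).
apply: (trig_ext (trig_sum (index_enum _) t1)) => [w|l w].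
  by rewrite /cosQ mulr_sumr; apply: eq_bigr => i _; rewrite lin_dir; field.
transitivity (\sum_i (D l w * ((2 - 2 * cos (e * Z i w)) / e ^+ 2) +
    dir l e i * (2 / e ^+ 2 * (h w * sin (e * Z i w))))).
  by apply: eq_bigr => i _; rewrite lin_dir /dir (eq_sym i l); field.
rewrite big_split/= -mulr_sumr sum_dir /sinZ /cosQ; congr (_ + _); by field.
Qed.

Lemma trig_poly h D e p : e != 0 -> trig h D ->
  trig (fun w => h w * p.[cosQ e w])
    (fun l w => D l w * p.[cosQ e w] + h w * (p^`().[cosQ e w] * (2 * sinZ e l w))).
Proof.
move=> e0 t; elim/poly_ind: p => [|p c IH].
  apply: (trig_ext (trig_lin 0 0 t t)) => [w|l w]; rewrite ?deriv0 !horner0; ring.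
apply: (trig_ext (trig_lin 1 c (trig_cosQ e0 IH) t)) => [w|l w];
  rewrite ?derivD ?derivM ?derivX ?derivC ?mulr1 ?addr0 !(hornerD, hornerM, hornerX, hornerC); ring.
Qed.

(** The exponents are fixed by the integrable majorant [rho^4]: one power is left for the factor
    [Z k] that multiplies [h], none for the derivatives. *)
Lemma ibp_lim (hN : nat -> T -> R) (DN : nat -> 'I_n -> T -> R) h D C :
  (forall N, bibp (hN N) (DN N)) ->
  (forall N w, `|hN N w| <= C * rho w ^+ 3) ->
  (forall N l w, `|DN N l w| <= C * rho w ^+ 4) ->
  (forall w, hN N w @[N --> \oo] --> h w) ->
  (forall l w, DN N l w @[N --> \oo] --> D l w) ->
  forall k, \int[P]_w (Z k w * h w) = \sum_l G k l * \int[P]_w D l w.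
Proof.
move=> b hC DC hh hD k.
have ir := RintegrableZ C Rintegrable_rho4.
have [_ c1] : Rintegrable P (fun w => Z k w * h w) /\
   \int[P]_w (Z k w * hN N w) @[N --> \oo] --> \int[P]_w (Z k w * h w).
  apply: (@Rintegral_dct _ _ _ P (fun N w => Z k w * hN N w) _ (fun w => C * rho w ^+ 4)) => //.
  - move=> N; have [bh _ _] := b N; apply: measurable_funM => //; exact: bh.1.
  - move=> N w; rewrite normrM exprS mulrCA ler_pM//; exact: norm_le_rho.
  - by move=> w; apply: cvgM => //; exact: cvg_cst.
have c2 : \sum_l G k l * \int[P]_w DN N l w @[N --> \oo] --> \sum_l G k l * \int[P]_w D l w.
  apply: cvg_sumr => l; apply: cvgM; first exact: cvg_cst.
  have [] : Rintegrable P (D l) /\ \int[P]_w (DN N l w) @[N --> \oo] --> \int[P]_w (D l w).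
    apply: (@Rintegral_dct _ _ _ P (fun N w => DN N l w) _ (fun w => C * rho w ^+ 4)) => //.
    by move=> N; have [_ bd _] := b N; exact: (bd l).1.
  by [].
rewrite (_ : (fun N => \sum_l G k l * \int[P]_w DN N l w) = (fun N => \int[P]_w (Z k w * hN N w))) in c2.
  exact: cvgn_unique c1 c2.
by apply/funext => N; have [_ _ ->] := b N.
Qed.

Lemma normr_sinZ_le (e : R) i w : `|sinZ e i w| <= `|Z i w|.
Proof.
have [->|e0] := eqVneq e 0; first by rewrite /sinZ invr0 mul0r normr0.
rewrite /sinZ normrM normfV mulrC ler_pdivrMr ?normr_gt0// mulrC -normrM.
exact: normr_sin_le.
Qed.

Lemma normr_sinZ_le_rho (e : R) i w : `|sinZ e i w| <= rho w.
Proof. exact: le_trans (normr_sinZ_le e i w) (norm_le_rho i w). Qed.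

Definition quad w := \sum_i Z i w ^+ 2.

Lemma cvg_harmonic0 (C : R) : C * n0.+1%:R^-1 @[n0 --> \oo] --> 0.
Proof. by rewrite -(mulr0 C); apply: cvgM; [exact: cvg_cst|exact: cvg_harmonic]. Qed.

Lemma cvg_sinZ i w : sinZ n0.+1%:R^-1 i w @[n0 --> \oo] --> Z i w.
Proof.
apply: (@cvgn_squeeze _ _ (fun N => Z i w ^+ 2 / 2 * N.+1%:R^-1)) (cvg_harmonic0 _) => N.
have e0 : 0 < (N.+1%:R^-1 : R) by rewrite invr_gt0.
set e : R := N.+1%:R^-1 in e0 *.
have -> : sinZ e i w - Z i w = e^-1 * (sin (e * Z i w) - e * Z i w).
  by rewrite /sinZ; field; rewrite gt_eqF.
rewrite normrM normfV (gtr0_norm e0) mulrC ler_pdivrMr//.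
by apply: (le_trans (normr_sinB _)); rewrite exprMn expr2; lra.
Qed.

Lemma cvg_cosZ i w : cos (n0.+1%:R^-1 * Z i w) @[n0 --> \oo] --> (1 : R).
Proof.
apply: (@cvgn_squeeze _ _ (fun N => Z i w ^+ 2 / 2 * N.+1%:R^-1)) (cvg_harmonic0 _) => N.
set e : R := N.+1%:R^-1.
have e0 : 0 <= e by rewrite invr_ge0.
have e1 : e <= 1 by rewrite invf_le1 ?ler1n// ltr0n.
apply: (le_trans (normr_cos1B _)); rewrite exprMn.
have e2 : e ^+ 2 <= e by nra.
by have := sqr_ge0 (Z i w); nra.
Qed.

Lemma cvg_cosQ w : cosQ n0.+1%:R^-1 w @[n0 --> \oo] --> quad w.
Proof. by apply: cvg_sumr => i; exact: cvg_cos_quad. Qed.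

Lemma cosQ_bounds e w : e != 0 -> 0 <= cosQ e w <= 4 * n%:R / e ^+ 2.
Proof.
move=> e0; have e2 : 0 < e ^+ 2 by rewrite exprn_even_gt0.
have h i : 0 <= (2 - 2 * cos (e * Z i w)) / e ^+ 2 <= 4 / e ^+ 2.
  have := cos_le1 (e * Z i w); have := cos_geN1 (e * Z i w) => c1 c2.
  apply/andP; split; first by apply: divr_ge0; [lra|exact: ltW].
  by rewrite ler_pM2r ?invr_gt0//; lra.
apply/andP; split; first by apply: sumr_ge0 => i _; case/andP: (h i).
apply: (@le_trans _ _ (\sum_(i < n) 4 / e ^+ 2)); first by apply: ler_sum => i _; case/andP: (h i).
by rewrite sumr_const card_ord -[leLHS]mulr_natr mulrAC.
Qed.

Lemma bm_cosQ e : e != 0 -> bm (cosQ e).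
Proof.
move=> e0; split; last first.
  exists (4 * n%:R / e ^+ 2) => w; have /andP[h0 h1] := cosQ_bounds w e0; by rewrite ger0_norm.
apply: measurable_sum => i; apply: measurable_funM => //; apply: measurable_funB => //.
by apply: measurable_funM => //; apply: measurable_cos_comp; exact: measurable_funM.
Qed.

(** Here it matters that [cosQ e] is bounded, unlike the sum of squares: its values stay in a
    segment, on which one polynomial approximates [f] and its derivative approximates [f']. *)
Lemma bibp_C1 h D e (f f' : R -> R) B : trig h D -> e != 0 -> (forall x : R, is_derive x 1 f (f' x)) ->
  continuous f' -> (forall x, `|f x| <= B) -> (forall x, `|f' x| <= B) ->
  bibp (fun w => h w * f (cosQ e w))
    (fun l w => D l w * f (cosQ e w) + h w * (f' (cosQ e w) * (2 * sinZ e l w))).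
Proof.
move=> t e0 df cf' fB f'B; have [bh bD _] := trig_bibp t.
have mq := (bm_cosQ e0).1.
have bf : bm (fun w => f (cosQ e w)).
  split; last by exists B.
  by apply: measurableT_comp => //; apply: continuous_measurable; exact: der_continuous df.
have bf' : bm (fun w => f' (cosQ e w)).
  by split; [apply: measurableT_comp => //; exact: continuous_measurable|exists B].
have bs l : bm (sinZ e l).
  by apply: bmZ; apply: bm_sin; exact: measurable_funM.
split; first exact: bmM.
  by move=> l; apply: bmD; apply: bmM => //; apply: bmM => //; exact: bmZ.
(* An upper bound of [cosQ e]; adding 1 keeps it positive when [n = 0]. *)
pose M := 4 * n%:R / e ^+ 2 + 1.
have M0 : 0 < M by rewrite ltr_wpDl// divr_ge0 ?sqr_ge0// mulr_ge0.
have qM w : 0 <= cosQ e w <= M by have := cosQ_bounds w e0; rewrite /M; lra.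
have ap N := C1_weierstrass df cf' M0 (divr_gt0 ltr01 (ltr0Sn R N)).
pose p N := sval (cid (ap N)).
have hp N x : 0 <= x <= M -> `|(p N).[x] - f x| <= M * N.+1%:R^-1 /\
    `|(p N)^`().[x] - f' x| <= 1 * N.+1%:R^-1.
  move=> hx; have := svalP (cid (ap N)) x hx; rewrite -/(p N) !mul1r.
  by rewrite [_ * M]mulrC.
have N1 N : N.+1%:R^-1 <= 1 :> R by rewrite invf_le1 ?ler1n// ltr0n.
have [H hH] := bh.2.
pose K := \sum_l sval (cid (bD l).2).
have DK l w : `|D l w| <= K.
  apply: (le_trans (svalP (cid (bD l).2) w)); rewrite /K (bigD1 l)//= lerDl sumr_ge0// => i _.
  by apply: le_trans (svalP (cid (bD i).2) w); exact: normr_ge0.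
pose C := (H + K) * (B + M + 1) * (1 + 2 * `|e^-1|).
have pB N w : `|(p N).[cosQ e w]| <= B + M + 1.
  have [h1 _] := hp N _ (qM w).
  have -> : (p N).[cosQ e w] = (p N).[cosQ e w] - f (cosQ e w) + f (cosQ e w) by ring.
  have h2 : M * N.+1%:R^-1 <= M by rewrite ler_piMr// ltW.
  apply: (le_trans (ler_normD _ _)); apply: (le_trans (lerD (le_trans h1 h2) (fB _))).
  lra.
have p'B N w : `|(p N)^`().[cosQ e w]| <= B + M + 1.
  have [_ h1] := hp N _ (qM w).
  have -> : (p N)^`().[cosQ e w] = (p N)^`().[cosQ e w] - f' (cosQ e w) + f' (cosQ e w) by ring.
  have h2 : 1 * N.+1%:R^-1 <= 1 :> R by rewrite mul1r.
  apply: (le_trans (ler_normD _ _)); apply: (le_trans (lerD (le_trans h1 h2) (f'B _))).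
  lra.
apply: (@ibp_lim (fun N w => h w * (p N).[cosQ e w])
   (fun N l w => D l w * (p N).[cosQ e w] + h w * ((p N)^`().[cosQ e w] * (2 * sinZ e l w))) _ _ C).
- by move=> N; apply: trig_bibp; exact: trig_poly.
- move=> N w; have H0 : 0 <= H := le_trans (normr_ge0 _) (hH w).
  have K0 : 0 <= K by apply: sumr_ge0 => i _; apply: le_trans (svalP (cid (bD i).2) w); exact: normr_ge0.
  have B0 : 0 <= B := le_trans (normr_ge0 _) (fB 0).
  have E0 := normr_ge0 e^-1.
  have C1 : `|h w * (p N).[cosQ e w]| <= C.
    rewrite normrM; apply: (@le_trans _ _ (H * (B + M + 1))); first exact: ler_pM.
    rewrite /C.
    have x0 : 0 <= H * (B + M + 1) by apply: mulr_ge0 => //; lra.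
    have y0 : 0 <= K * (B + M + 1) by apply: mulr_ge0 => //; lra.
    nra.
  apply: (le_trans C1); rewrite ler_peMr//; first exact: le_trans C1.
  exact/exprn_ege1/rho_ge1.
- move=> N l w; have H0 : 0 <= H := le_trans (normr_ge0 _) (hH w).
  have K0 : 0 <= K := le_trans (normr_ge0 _) (DK l w).
  have B0 : 0 <= B := le_trans (normr_ge0 _) (fB 0).
  have E0 := normr_ge0 e^-1.
  have C1 : `|D l w * (p N).[cosQ e w] + h w * ((p N)^`().[cosQ e w] * (2 * sinZ e l w))| <= C.
    apply: (le_trans (ler_normD _ _)); rewrite !normrM.
    have h1 : `|D l w| * `|(p N).[cosQ e w]| <= K * (B + M + 1) by exact: ler_pM.
    have h2 : `|h w| * (`|(p N)^`().[cosQ e w]| * (`|2| * (`|e^-1| * `|sin (e * Z l w)|))) <=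
        H * ((B + M + 1) * (2 * (`|e^-1| * 1))).
      apply: ler_pM; rewrite ?mulr_ge0//.
      apply: ler_pM; rewrite ?mulr_ge0//.
      apply: ler_pM; rewrite ?mulr_ge0//.
        by rewrite ger0_norm.
      apply: ler_pM => //; exact: normr_sin_le1.
    have x0 : 0 <= H * (B + M + 1) by apply: mulr_ge0 => //; lra.
    have y0 : 0 <= K * (B + M + 1) by apply: mulr_ge0 => //; lra.
    by rewrite /C; nra.
  apply: (le_trans C1); rewrite ler_peMr//; first exact: le_trans C1.
  exact/exprn_ege1/rho_ge1.
- move=> w; apply: cvgM; first exact: cvg_cst.
  by apply: (cvgn_squeeze (fun N => (hp N _ (qM w)).1)); exact: cvg_harmonic0.
- move=> l w; apply: cvgD; apply: cvgM; try exact: cvg_cst.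
    by apply: (cvgn_squeeze (fun N => (hp N _ (qM w)).1)); exact: cvg_harmonic0.
  apply: cvgM; last exact: cvg_cst.
  by apply: (cvgn_squeeze (fun N => (hp N _ (qM w)).2)); exact: cvg_harmonic0.
Qed.

Lemma natr_inv_neq0 N : N.+1%:R^-1 != 0 :> R.
Proof. by rewrite invr_eq0 pnatr_eq0. Qed.

Lemma sum_delta (F : 'I_n -> R) a : \sum_l F l * (l == a)%:R = F a.
Proof.
rewrite (bigD1 a)//= eqxx mulr1 big1 ?addr0// => i ia.
by rewrite (negbTE ia) mulr0.
Qed.

Lemma moment2 k a : \int[P]_w (Z k w * Z a w) = G k a.
Proof.
rewrite (@ibp_lim (fun N w => 1 * sinZ N.+1%:R^-1 a w)
  (fun N l w => 0 * sinZ N.+1%:R^-1 a w + (l == a)%:R * (1 * cos (N.+1%:R^-1 * Z a w)))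
  (Z a) (fun l w => (l == a)%:R) 1).
- by under eq_bigr do rewrite Rintegral_cst_prob; exact: sum_delta.
- by move=> N; apply: trig_bibp; apply: trig_sinZ trig1; exact: natr_inv_neq0.
- move=> N w; rewrite !mul1r (le_trans (normr_sinZ_le_rho _ _ _))//.
  by rewrite -[leLHS]expr1; apply: ler_weXn2l => //; exact: rho_ge1.
- move=> N l w; rewrite mul0r add0r !mul1r normrM (@le_trans _ _ 1)//; last exact/exprn_ege1/rho_ge1.
  by rewrite -[leRHS]mulr1 ler_pM// ?normr_cos_le1// ger0_norm// lern1 leq_b1.
- by move=> w; under eq_fun do rewrite mul1r; exact: cvg_sinZ.
- move=> l w; rewrite -[X in _ --> X]mulr1; under eq_fun do rewrite mul0r add0r mul1r.
  by apply: cvgM; [exact: cvg_cst|exact: cvg_cosZ].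
Qed.

(** Isserlis' formula: integration by parts on [Z a * Z b * Z c] leaves the three second moments
    obtained by removing one factor. The product is reached through the bounded product of the
    [sinZ]. *)
Lemma moment4 k a b c : \int[P]_w (Z k w * (Z a w * Z b w * Z c w)) =
  G k a * G b c + G k b * G a c + G k c * G a b.
Proof.
pose s N := sinZ N.+1%:R^-1; pose co N i w : R := cos (N.+1%:R^-1 * Z i w).
rewrite (@ibp_lim (fun N w => 1 * s N a w * s N b w * s N c w)
  (fun N l w => ((0 * s N a w + (l == a)%:R * (1 * co N a w)) * s N b w +
      (l == b)%:R * (1 * s N a w * co N b w)) * s N c w +
      (l == c)%:R * (1 * s N a w * s N b w * co N c w))
  (fun w => Z a w * Z b w * Z c w) (fun l w => (l == a)%:R * (Z b w * Z c w) +
     (l == b)%:R * (Z a w * Z c w) + (l == c)%:R * (Z a w * Z b w)) 3).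
- under eq_bigr => l _.
    have i1 : Rintegrable P (fun w => (l == a)%:R * (Z b w * Z c w)).
      by apply: RintegrableZ; exact: Rintegrable_Z2.
    have i2 : Rintegrable P (fun w => (l == b)%:R * (Z a w * Z c w)).
      by apply: RintegrableZ; exact: Rintegrable_Z2.
    have i3 : Rintegrable P (fun w => (l == c)%:R * (Z a w * Z b w)).
      by apply: RintegrableZ; exact: Rintegrable_Z2.
    rewrite RintegralD//; last exact: RintegrableD.
    rewrite RintegralD// !RintegralZ ?moment2; try exact: Rintegrable_Z2.
    rewrite (_ : _ * _ = G k l * G b c * (l == a)%:R + G k l * G a c * (l == b)%:R +
       G k l * G a b * (l == c)%:R); last by ring.
  over.
  by rewrite !big_split/= !sum_delta.
- by move=> N; apply: trig_bibp; do 3 (apply: trig_sinZ; first exact: natr_inv_neq0); exact: trig1.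
- move=> N w; have r3 := exprn_ege1 3 (rho_ge1 w).
  have b3 (x y z : R) : `|x| <= rho w -> `|y| <= rho w -> `|z| <= rho w -> `|1 * x * y * z| <= 3 * rho w ^+ 3.
    move=> x1 y1 z1; apply: (@le_trans _ _ (rho w ^+ 3)); last by lra.
    by rewrite mul1r !normrM !exprS expr0 mulr1 mulrA ler_pM// ler_pM.
  by apply: b3; exact: normr_sinZ_le_rho.
- move=> N l w.
  have c1 i : `|co N i w| <= 1 by exact: normr_cos_le1.
  have s1 i : `|s N i w| <= rho w by exact: normr_sinZ_le_rho.
  have d1 (i : 'I_n) : `|(l == i)%:R : R| <= 1 by rewrite ger0_norm// lern1 leq_b1.
  have r0 := rho_ge1 w.
  have b3 x y z u : `|x| <= 1 -> `|y| <= 1 -> `|z| <= rho w -> `|u| <= rho w ->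
      `|x * y * z * u| <= rho w ^+ 4.
    move=> x1 y1 z1 u1; apply: (@le_trans _ _ (rho w ^+ 2)); last exact: rhoX_le.
    rewrite !normrM expr2 ler_pM//.
    by rewrite -[leRHS]mul1r ler_pM// -[leRHS]mul1r ler_pM.
  rewrite [X in `|X|](_ : _ = (l == a)%:R * co N a w * s N b w * s N c w +
    (l == b)%:R * co N b w * s N a w * s N c w + (l == c)%:R * co N c w * s N a w * s N b w); last by ring.
  apply: (le_trans (ler_normD _ _)).
  have h1 := b3 _ _ _ _ (d1 a) (c1 a) (s1 b) (s1 c).
  have h2 := b3 _ _ _ _ (d1 b) (c1 b) (s1 a) (s1 c).
  have h3 := b3 _ _ _ _ (d1 c) (c1 c) (s1 a) (s1 b).
  have h4 := ler_normD ((l == a)%:R * co N a w * s N b w * s N c w) ((l == b)%:R * co N b w * s N a w * s N c w).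
  lra.
- by move=> w; under eq_fun do rewrite mul1r; do 2 (apply: cvgM; last exact: cvg_sinZ); exact: cvg_sinZ.
- move=> l w.
  rewrite [X in _ --> X](_ : _ = ((0 * Z a w + (l == a)%:R * (1 * 1)) * Z b w +
      (l == b)%:R * (1 * Z a w * 1)) * Z c w + (l == c)%:R * (1 * Z a w * Z b w * 1)); last by ring.
  apply: cvgD.
    apply: cvgM; last exact: cvg_sinZ.
    apply: cvgD.
      apply: cvgM; last exact: cvg_sinZ.
      apply: cvgD; first by apply: cvgM; [exact: cvg_cst|exact: cvg_sinZ].
      apply: cvgM; first exact: cvg_cst.
      by apply: cvgM; [exact: cvg_cst|exact: cvg_cosZ].
    apply: cvgM; first exact: cvg_cst.
    apply: cvgM; last exact: cvg_cosZ.
    by apply: cvgM; [exact: cvg_cst|exact: cvg_sinZ].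
  apply: cvgM; first exact: cvg_cst.
  apply: cvgM; last exact: cvg_cosZ.
  apply: cvgM; last exact: cvg_sinZ.
  by apply: cvgM; [exact: cvg_cst|exact: cvg_sinZ].
Qed.

Definition quadf (H : 'I_n -> 'I_n -> R) w := \sum_k \sum_l H k l * (Z k w * Z l w).

(** The function [Z k * f (quad)] is the limit of [sinZ * f (cosQ)] with one common parameter. Its
    derivative has two terms, from the factor [Z k] and from the argument of [f]. *)
Lemma quad_stein_coord (f f' : R -> R) B k : (forall x : R, is_derive x 1 f (f' x)) ->
  continuous f' -> (forall x, `|f x| <= B) -> (forall x, `|f' x| <= B) ->
  \int[P]_w (Z k w * (Z k w * f (quad w))) = \sum_l G k l *
    \int[P]_w ((l == k)%:R * f (quad w) + Z k w * (f' (quad w) * (2 * Z l w))).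
Proof.
move=> df cf' fB f'B.
have B0 : 0 <= B := le_trans (normr_ge0 _) (fB 0).
pose s N := sinZ N.+1%:R^-1; pose q N := cosQ N.+1%:R^-1.
rewrite (@ibp_lim (fun N w => 1 * s N k w * f (q N w))
  (fun N l w => (0 * s N k w + (l == k)%:R * (1 * cos (N.+1%:R^-1 * Z k w))) * f (q N w) +
      (1 * s N k w) * (f' (q N w) * (2 * s N l w)))
  (fun w => Z k w * f (quad w)) (fun l w => (l == k)%:R * f (quad w) +
     Z k w * (f' (quad w) * (2 * Z l w))) (3 * B))//.
- by move=> N; apply: (bibp_C1 _ (natr_inv_neq0 N) df cf' fB f'B); apply: trig_sinZ trig1; exact: natr_inv_neq0.
- move=> N w; rewrite mul1r normrM.
  have r0 := rho_ge1 w.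
  have r1 : rho w <= rho w ^+ 3 by rewrite -[leLHS]expr1; apply: ler_weXn2l.
  apply: (@le_trans _ _ (rho w * B)); first by apply: ler_pM => //; exact: normr_sinZ_le_rho.
  have : 0 <= rho w ^+ 3 * B by rewrite mulr_ge0// exprn_ge0//; lra.
  nra.
- move=> N l w; rewrite mul0r add0r !mul1r.
  have r0 := rho_ge1 w.
  have r1 : 1 <= rho w ^+ 4 by exact: exprn_ege1.
  have r2 : rho w ^+ 2 <= rho w ^+ 4 by exact: rhoX_le.
  have h1 : `|(l == k)%:R * cos (N.+1%:R^-1 * Z k w) * f (q N w)| <= 1 * 1 * B.
    by rewrite !normrM; apply: ler_pM => //; apply: ler_pM => //; rewrite ?normr_cos_le1// ger0_norm// lern1 leq_b1.
  have h2 : `|s N k w * (f' (q N w) * (2 * s N l w))| <= rho w * (B * (2 * rho w)).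
    rewrite [X in `|X|](_ : _ = s N k w * f' (q N w) * 2 * s N l w); last by ring.
    rewrite normrM [`|_ * 2|]normrM [`|_ * f' _|]normrM -!mulrA.
    apply: ler_pM; rewrite ?mulr_ge0//; first exact: normr_sinZ_le_rho.
    apply: ler_pM; rewrite ?mulr_ge0//.
    by rewrite ger0_norm// ler_pM// normr_sinZ_le_rho.
  apply: (le_trans (ler_normD _ _)); apply: (le_trans (lerD h1 h2)); nra.
- move=> w; apply: cvgM; first by under eq_fun do rewrite mul1r; exact: cvg_sinZ.
  have cf1 : f (q N w) @[N --> \oo] --> f (quad w).
    have cf : continuous f by exact: der_continuous df.
    by apply: continuous_cvg; [exact: cf|exact: cvg_cosQ].
  exact: cf1.
- move=> l w.
  rewrite [X in _ --> X](_ : _ = (0 * Z k w + (l == k)%:R * (1 * 1)) * f (quad w) +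
      (1 * Z k w) * (f' (quad w) * (2 * Z l w))); last by ring.
  have cf1 : f (q N w) @[N --> \oo] --> f (quad w).
    have cf : continuous f by exact: der_continuous df.
    by apply: continuous_cvg; [exact: cf|exact: cvg_cosQ].
  have cf2 : f' (q N w) @[N --> \oo] --> f' (quad w).
    by apply: continuous_cvg; [exact: cf'|exact: cvg_cosQ].
  apply: cvgD.
    apply: cvgM; last exact: cf1.
    apply: cvgD; first by apply: cvgM; [exact: cvg_cst|exact: cvg_sinZ].
    apply: cvgM; first exact: cvg_cst.
    by apply: cvgM; [exact: cvg_cst|exact: cvg_cosZ].
  apply: cvgM; first by apply: cvgM; [exact: cvg_cst|exact: cvg_sinZ].
  apply: cvgM; first exact: cf2.
  by apply: cvgM; [exact: cvg_cst|exact: cvg_sinZ].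
Qed.

Lemma measurable_quad : measurable_fun setT quad.
Proof. by apply: measurable_sum => i; exact: measurable_funX. Qed.

Lemma Rintegrable_quadf H : Rintegrable P (quadf H).
Proof.
apply: Rintegrable_sum => k _; apply: Rintegrable_sum => l _; apply: RintegrableZ.
exact: Rintegrable_Z2.
Qed.

Lemma quad_stein (f f' : R -> R) B : (forall x : R, is_derive x 1 f (f' x)) ->
  continuous f' -> (forall x, `|f x| <= B) -> (forall x, `|f' x| <= B) ->
  \int[P]_w (quad w * f (quad w)) = (\sum_k G k k) * \int[P]_w f (quad w) +
    2 * \int[P]_w (quadf G w * f' (quad w)).
Proof.
move=> df cf' fB f'B.
have bq (g : R -> R) : continuous g -> (forall x, `|g x| <= B) -> bm (fun w => g (quad w)).
  move=> cg gB; split; last by exists B.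
  by apply: measurableT_comp; [exact: continuous_measurable|exact: measurable_quad].
have cf : continuous f by exact: der_continuous df.
have bf := bq _ cf fB; have bf' := bq _ cf' f'B.
have i1 k : Rintegrable P (fun w => Z k w * (Z k w * f (quad w))).
  by have := bmZI bf (Rintegrable_Z2 k k); under eq_fun do rewrite -mulrA.
have i2 k l : Rintegrable P (fun w => Z k w * Z l w * f' (quad w)).
  by have := bmZI bf' (Rintegrable_Z2 k l).
transitivity (\int[P]_w (\sum_k Z k w * (Z k w * f (quad w)))).
  by apply: eq_Rintegral => w _; rewrite {1}/quad mulr_suml; apply: eq_bigr => k _; ring.
rewrite Rintegral_sum//; under eq_bigr do rewrite (quad_stein_coord _ df cf' fB f'B).
transitivity (\sum_k \sum_l (G k l * \int[P]_w f (quad w) * (l == k)%:R +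
    2 * (G k l * \int[P]_w (Z k w * Z l w * f' (quad w))))).
  apply: eq_bigr => k _; apply: eq_bigr => l _.
  transitivity (G k l * \int[P]_w ((l == k)%:R * f (quad w) + 2 * (Z k w * Z l w * f' (quad w)))).
    by congr (_ * _); apply: eq_Rintegral => w _; ring.
  rewrite RintegralD//; [|exact/RintegrableZ/(bmI P)|exact: RintegrableZ].
  by rewrite !RintegralZ//; [ring|exact: bmI].
under eq_bigr do rewrite big_split/= sum_delta -mulr_sumr.
rewrite big_split/= -mulr_suml -mulr_sumr; congr (_ + 2 * _).
under [in RHS]eq_Rintegral => w _ do rewrite /quadf mulr_suml.
rewrite Rintegral_sum; last first.
  move=> k _; under eq_fun do rewrite mulr_suml.
  apply: Rintegrable_sum => l _; under eq_fun do rewrite -mulrA; exact: RintegrableZ.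
apply: eq_bigr => k _; under [in RHS]eq_Rintegral => w _ do rewrite mulr_suml.
rewrite Rintegral_sum; last first.
  by move=> l _; under eq_fun do rewrite -mulrA; exact: RintegrableZ.
by apply: eq_bigr => l _; under [in RHS]eq_Rintegral => w _ do rewrite -mulrA; rewrite RintegralZ.
Qed.

Lemma quadf_mean H : \int[P]_w quadf H w = \sum_k \sum_l H k l * G k l.
Proof.
have i1 k l : Rintegrable P (fun w => H k l * (Z k w * Z l w)).
  by apply: RintegrableZ; exact: Rintegrable_Z2.
rewrite Rintegral_sum; last by move=> k _; exact: Rintegrable_sum.
apply: eq_bigr => k _; rewrite Rintegral_sum//; apply: eq_bigr => l _.
by rewrite RintegralZ ?moment2//; exact: Rintegrable_Z2.
Qed.

Lemma Rintegrable_Z4 k l a b : Rintegrable P (fun w => Z k w * (Z l w * Z a w * Z b w)).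
Proof.
apply: (@Rintegrable_rho_le _ 1).
  by do !apply: measurable_funM.
move=> w; rewrite mul1r !normrM !exprS expr0 mulr1 mulrA mulrA [leRHS]mulrA [leRHS]mulrA.
by do ![apply: ler_pM => //]; exact: norm_le_rho.
Qed.

Lemma quadf_sqr H w : quadf H w ^+ 2 = \sum_k \sum_l \sum_a \sum_b
  H k l * H a b * (Z k w * (Z l w * Z a w * Z b w)).
Proof.
rewrite expr2 /quadf mulr_suml; apply: eq_bigr => k _; rewrite mulr_suml; apply: eq_bigr => l _.
rewrite mulr_sumr; apply: eq_bigr => a _; rewrite mulr_sumr; apply: eq_bigr => b _; ring.
Qed.

Lemma Rintegrable_quadf_sqr H : Rintegrable P (fun w => quadf H w ^+ 2).
Proof.
under eq_fun do rewrite quadf_sqr.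
do 4 (apply: Rintegrable_sum => ? _); apply: RintegrableZ; exact: Rintegrable_Z4.
Qed.

(** Of the three pairings in [moment4], one gives the square of the mean and cancels; the other two
    coincide by symmetry of [H], whence the factor 2. *)
Lemma quadf_variance H : (forall i j, H i j = H j i) ->
  \int[P]_w (quadf H w - \sum_k \sum_l H k l * G k l) ^+ 2 =
  2 * \sum_k \sum_l \sum_a \sum_b H k l * H a b * (G k a * G l b).
Proof.
move=> Hsym; set c := \sum_k _.
have i2 := Rintegrable_quadf_sqr H; have i1 := Rintegrable_quadf H.
have -> : \int[P]_w (quadf H w - c) ^+ 2 = \int[P]_w quadf H w ^+ 2 - c ^+ 2.
  transitivity (\int[P]_w (quadf H w ^+ 2 + (- (2 * c) * quadf H w + c ^+ 2))).
    by apply: eq_Rintegral => w _; ring.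
  rewrite RintegralD//; last by apply: RintegrableD; [exact: RintegrableZ|exact: Rintegrable_cst].
  rewrite RintegralD//; [|exact: RintegrableZ|exact: Rintegrable_cst].
  by rewrite RintegralZ// quadf_mean Rintegral_cst_prob -/c; ring.
have -> : \int[P]_w quadf H w ^+ 2 = \sum_k \sum_l \sum_a \sum_b
    H k l * H a b * (G k l * G a b + G k a * G l b + G k b * G l a).
  have i4 k l a b : Rintegrable P (fun w => H k l * H a b * (Z k w * (Z l w * Z a w * Z b w))).
    by apply: RintegrableZ; exact: Rintegrable_Z4.
  under eq_Rintegral do rewrite quadf_sqr.
  rewrite Rintegral_sum; last by move=> *; do 3 (apply: Rintegrable_sum => ? _).
  apply: eq_bigr => k _; rewrite Rintegral_sum; last by move=> *; do 2 (apply: Rintegrable_sum => ? _).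
  apply: eq_bigr => l _; rewrite Rintegral_sum; last by move=> *; apply: Rintegrable_sum => ? _.
  apply: eq_bigr => a _; rewrite Rintegral_sum//.
  apply: eq_bigr => b _; rewrite RintegralZ; last exact: Rintegrable_Z4.
  by rewrite moment4.
have -> : c ^+ 2 = \sum_k \sum_l \sum_a \sum_b H k l * H a b * (G k l * G a b).
  rewrite expr2 /c mulr_suml; apply: eq_bigr => k _; rewrite mulr_suml; apply: eq_bigr => l _.
  rewrite mulr_sumr; apply: eq_bigr => a _; rewrite mulr_sumr; apply: eq_bigr => b _; ring.
have swap : \sum_k \sum_l \sum_a \sum_b H k l * H a b * (G k b * G l a) =
   \sum_k \sum_l \sum_a \sum_b H k l * H a b * (G k a * G l b).
  apply: eq_bigr => k _; apply: eq_bigr => l _; rewrite exchange_big/=.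
  by apply: eq_bigr => a _; apply: eq_bigr => b _; rewrite (Hsym b a).
rewrite mulr2n mulrDl !mul1r -{2}swap -!big_split/= -sumrB; apply: eq_bigr => k _.
rewrite -!big_split/= -sumrB; apply: eq_bigr => l _.
rewrite -!big_split/= -sumrB; apply: eq_bigr => a _.
rewrite -!big_split/= -sumrB; apply: eq_bigr => b _; ring.
Qed.
End gaussian_vector.

(** * Stein's equation *)

Section normal_stein_equation.
Context (R : realType).
Notation leb := (@lebesgue_measure R).

(** The primitive normalised at [-oo], like a distribution function. Its limit at [+oo] is the total
    integral, which is 0 for the centred right-hand side of Stein's equation. *)
Lemma antiderivative_Ny (q : R -> R) : continuous q -> Rintegrable leb q ->
  exists F : R -> R, [/\ forall x : R, is_derive x 1 F (q x),
    F (- n%:R) @[n --> \oo] --> 0 & F n%:R @[n --> \oo] --> \int[leb]_x q x].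
Proof.
move=> cq iq; have mq := Rintegrable_measurable iq.
pose F (x : R) := \int[leb]_(t in `]-oo, x]) q t.
have FE x : F x = \int[leb]_t (q t * \1_(`]-oo, x]%classic : set R) t).
  rewrite /F Rintegral_mkcond; apply: eq_Rintegral => t _.
  by rewrite patchE indicE; case: ifPn; rewrite ?mulr1 ?mulr0.
have lim (s : nat -> R) (a : R) :
    (forall t, \1_(`]-oo, s n]%classic : set R) t @[n --> \oo] --> a) ->
    F (s n) @[n --> \oo] --> \int[leb]_x (q x * a).
  move=> h; have [] := @Rintegral_dct _ _ _ leb
    (fun n x => q x * \1_(`]-oo, s n]%classic : set R) x) (fun x => q x * a) (fun x => `|q x|).
  - by move=> n; apply: measurable_funM => //; exact: measurable_indic.
  - exact: Rintegrable_norm.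
  - by move=> n x; rewrite normrM ler_piMr// indicE; case: (_ \in _); rewrite /= ?normr1 ?normr0.
  - by move=> x; apply: cvgM; [exact: cvg_cst|exact: h].
  by move=> _ h1; under eq_fun do rewrite FE; exact: h1.
exists F; split.
- move=> x; have iu : leb.-integrable `]-oo, x + 1]%classic (EFin \o q).
    by apply: (integrableS measurableT).
  have x1 : x < x + 1 by rewrite ltrDl.
  have [d e] := @continuous_FTC1 R q -oo%O x (x + 1) x1 iu (ltNyr _) (cq x).
  by rewrite derive1E in e; exact: DeriveDef d e.
- have /lim : forall t, \1_(`]-oo, - n%:R]%classic : set R) t @[n --> \oo] --> (0 : R).
    move=> t; apply: cvg_near_cst; near=> n; rewrite indicE memNset//= in_itv/=.
    apply/negP; rewrite -ltNge ltrNl; near: n.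
    exact: nbhs_infty_gtr.
  by under eq_Rintegral do rewrite mulr0; rewrite /Rintegral integral0.
- have /lim : forall t, \1_(`]-oo, n%:R]%classic : set R) t @[n --> \oo] --> (1 : R).
    move=> t; apply: cvg_near_cst; near=> n; rewrite indicE mem_set//= in_itv/=.
    near: n; exact: nbhs_infty_ger.
  by under eq_Rintegral do rewrite mulr1.
Unshelve. all: by end_near. Qed.

Lemma der_ge0_cvg0 (D dD : R -> R) (a : R) : (forall x : R, is_derive x 1 D (dD x)) ->
  (forall x, x <= a -> 0 <= dD x) -> D (- n%:R) @[n --> \oo] --> 0 ->
  forall x, x <= a -> 0 <= D x.
Proof.
move=> h d0 D0 x xa; apply: (cvgr_to_le D0); near=> n.
apply: (der_ge0_le h); first by rewrite lerNl; near: n; exact: nbhs_infty_ger.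
by move=> y /andP[_ yx]; apply: d0; exact: le_trans xa.
Unshelve. all: by end_near. Qed.

Variable s : R.
Hypothesis s0 : 0 < s.
Notation phi := (normal_pdf 0 s).
Let sn0 : s != 0. Proof. by rewrite gt_eqF. Qed.

(* With Phi the distribution function, K Phi - I, K Phi + I and s^2 phi + x Phi have signed
   derivatives on the negative half-line and vanish at -oo. *)
Lemma normal_tail_le (g I : R -> R) K : (forall x, `|g x| <= K) ->
  (forall x : R, is_derive x 1 I (g x * phi x)) -> I (- n%:R) @[n --> \oo] --> 0 ->
  (forall x, `|I x| <= K) /\ forall x, x <= 0 -> `|x * I x| <= K * s ^+ 2 * phi x.
Proof.
move=> gK dI I0; have K0 : 0 <= K := le_trans (normr_ge0 _) (gK 0).
have dphi := der_centered_normal_pdf s0; have phi0 := centered_normal_pdf_gt0 s0.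
have cphi : continuous phi by exact: der_continuous dphi.
have [Phi [dPhi Phi0 Phi1]] := antiderivative_Ny cphi (Rintegrable_normal s).
rewrite Rintegral_normal// in Phi1.
have Phi_ge0 x : 0 <= Phi x.
  by apply: (der_ge0_cvg0 dPhi _ Phi0 (lexx x)) => y _; exact: ltW.
have Phi_le1 x : Phi x <= 1.
  apply: (cvgr_to_ge Phi1); near=> n.
  apply: (der_ge0_le dPhi); first by near: n; exact: nbhs_infty_ger.
  by move=> y _; exact: ltW.
have IPhi x : `|I x| <= K * Phi x.
  rewrite ler_norml; apply/andP; split; rewrite -subr_ge0.
    rewrite opprK; have hD : forall y : R, is_derive y 1 (fun y => I y + K * Phi y) ((fun y => g y * phi y + K * phi y) y).
   by move=> y; have h1 := dI y; have h2 := dPhi y; derive_by; ring.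
 apply: (der_ge0_cvg0 (a := x) hD) => //.
    - move=> y _; have := phi0 y => /ltW p0; rewrite -mulrDl mulr_ge0//.
      by have := gK y; rewrite ler_norml; lra.
    - rewrite (_ : 0 = 0 + K * 0); last by ring.
      by apply: cvgD => //; apply: cvgM => //; exact: cvg_cst.
  have hD : forall y : R, is_derive y 1 (fun y => K * Phi y - I y) ((fun y => K * phi y - g y * phi y) y).
    by move=> y; have h1 := dI y; have h2 := dPhi y; derive_by; ring.
  apply: (der_ge0_cvg0 (a := x) hD) => //.
  - move=> y _; have := phi0 y => /ltW p0; rewrite -mulrBl mulr_ge0//.
    by have := gK y; rewrite ler_norml; lra.
  - rewrite (_ : 0 = K * 0 - 0); last by ring.
    by apply: cvgB => //; apply: cvgM => //; exact: cvg_cst.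
split; first by move=> x; rewrite (le_trans (IPhi x))// ler_piMr.
have sphi0 : s ^+ 2 * phi (- n%:R) @[n --> \oo] --> 0.
  have h1 (y : R) : `|(fun=> 1) y : R| <= 1 * (1 + `|y|) by rewrite normr1 mul1r lerDl.
  have [_ h] := cvg_normal_pdf_mul s0 h1; rewrite -[X in _ --> X](mulr0 (s ^+ 2)).
  by apply: cvgM; [exact: cvg_cst|move: h; under eq_fun do rewrite mul1r].
(* This tail bound is there to show that [x Phi x] vanishes at [-oo], the boundary value for the
   last of the three comparisons. *)
have PhiN1 x : x <= -1 -> Phi x <= s ^+ 2 * phi x.
  move=> x1; rewrite -subr_ge0.
  have hD : forall y : R, is_derive y 1 (fun y => s ^+ 2 * phi y - Phi y) ((fun y => - y * phi y - phi y) y).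
    by move=> y; have h1 := dphi y; have h2 := dPhi y; derive_by; field.
  apply: (der_ge0_cvg0 (a := (-1)) hD) => //.
  - move=> y y1; have := phi0 y; nra.
  - by rewrite -[X in _ --> X](subr0 0); apply: cvgB.
have nPhi : - n%:R * Phi (- n%:R) @[n --> \oo] --> 0.
  have [_ h] := @cvg_normal_pdf_mul _ _ s0 (fun x => - x) 1 (fun x => ltac:(rewrite normrN mul1r lerDr; exact: ler01)).
  apply: (@cvgn_squeeze _ _ (fun n => s ^+ 2 * (- - n%:R * phi (- n%:R)))) => [n|]; last first.
    by rewrite -[X in _ --> X](mulr0 (s ^+ 2)); apply: cvgM; [exact: cvg_cst|exact: h].
  rewrite subr0 opprK normrM normrN normr_nat (ger0_norm (Phi_ge0 _)).
  case: n => [|n]; first by rewrite !mul0r mulr0.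
  by rewrite mulrCA ler_wpM2l// PhiN1// lerN2 ler1n.
move=> x x0; rewrite normrM (ler0_norm x0).
apply: (@le_trans _ _ (- x * (K * Phi x))); first by rewrite ler_wpM2l// oppr_ge0.
have : 0 <= s ^+ 2 * phi x + x * Phi x.
  have hD : forall y : R, is_derive y 1 (fun y => s ^+ 2 * phi y + y * Phi y) (Phi y).
    by move=> y; have h1 := dphi y; have h2 := dPhi y; derive_by; field.
  apply: (der_ge0_cvg0 (a := 0) hD) => //.
  - by rewrite -[X in _ --> X](addr0 0); apply: cvgD.
by move=> /(mulr_ge0 K0); nra.
Unshelve. all: by end_near. Qed.

(** The solution is [I / (s^2 phi)], with [I] the primitive of [(g - c) phi]. Centring by [c] makes
    [I] vanish at both ends, so the tail bound holds on each half-line and bounds [x f x], hence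
    [f'] through the equation itself. For [|x| < 1], [f] is bounded because [phi x >= phi 1]. *)
Lemma normal_stein_solution (g : R -> R) K : continuous g -> (forall x, `|g x| <= K) ->
  exists (f f' : R -> R) (B : R), [/\ forall x : R, is_derive x 1 f (f' x), continuous f',
    forall x, `|f x| <= B, forall x, `|f' x| <= B &
    forall x, s ^+ 2 * f' x - x * f x = g x - \int[leb]_y (g y * phi y)].
Proof.
move=> cg gK; have K0 : 0 <= K := le_trans (normr_ge0 _) (gK 0).
have dphi := der_centered_normal_pdf s0; have phi0 := centered_normal_pdf_gt0 s0.
have cphi : continuous phi by exact: der_continuous dphi.
have iphi := Rintegrable_normal s.
set c := \int[leb]_y _.
have ig : Rintegrable leb (fun y => g y * phi y).
  apply: (@Rintegrable_normal_mul _ _ s0 _ K 0); first exact: continuous_measurable.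
  by move=> x; rewrite mul0r addr0.
have cK : `|c| <= K.
  apply: (le_trans (le_normr_Rintegral _ ig)) => //.
  rewrite -[leRHS]mulr1 -(Rintegral_normal s) -RintegralZ//.
  have i1 := Rintegrable_norm ig; have i2 := RintegrableZ K iphi.
  apply: (le_Rintegral _ i1 i2) => // x _.
  by rewrite normrM (gtr0_norm (phi0 x)) ler_wpM2r// ltW.
pose g0 x := g x - c.
have g0K x : `|g0 x| <= 2 * K.
  by rewrite /g0 (le_trans (ler_normB _ _))//; have := gK x; lra.
have cg0 : continuous (fun x => g0 x * phi x).
  move=> x; apply: cvgM; last exact: cphi.
  by apply: cvgB; [exact: cg|exact: cvg_cst].
have ig0 : Rintegrable leb (fun x => g0 x * phi x).
  have := RintegrableB ig (RintegrableZ c iphi).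
  by under eq_fun do rewrite -mulrBl.
have [I [dI I0 I1]] := antiderivative_Ny cg0 ig0.
have I1' : I n%:R @[n --> \oo] --> 0.
  move: I1; rewrite (_ : \int[leb]_x _ = 0)//.
  transitivity (\int[leb]_x (g x * phi x - c * phi x)).
    by apply: eq_Rintegral => x _; rewrite /g0; ring.
  rewrite RintegralB//; last exact: RintegrableZ.
  by rewrite RintegralZ// Rintegral_normal// mulr1 -/c subrr.
have [IK Ineg] := normal_tail_le g0K dI I0.
have Ipos x : 0 <= x -> `|x * I x| <= 2 * K * s ^+ 2 * phi x.
  move=> x0.
  (* The right half-line is the left one for [y |-> g0 (- y)], whose primitive is [- I (- y)]. *)
  have dJ : forall y : R, is_derive y 1 (fun y => - I (- y)) (g0 (- y) * phi y).
    move=> y; have h := der_comp (dI (- y)) (derN (derI y)).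
    apply: (der_eq (derN h)); rewrite (centered_normal_pdfN s0); ring.
  have [|_] := normal_tail_le (fun y => g0K (- y)) dJ.
  - by rewrite -oppr0; apply: cvgN; under eq_fun do rewrite opprK.
  - move=> /(_ (- x)); rewrite oppr_le0 => /(_ x0).
    by rewrite opprK mulrNN (centered_normal_pdfN s0).
have xI x : `|x * I x| <= 2 * K * s ^+ 2 * phi x.
  by have [/Ipos|/ltW /Ineg] := leP 0 x.
pose f x := I x / (s ^+ 2 * phi x).
pose f' x := (g0 x + x * f x) / s ^+ 2.
have s2 : 0 < s ^+ 2 by rewrite exprn_gt0.
have phin0 x : phi x != 0 by rewrite gt_eqF.
have df (x : R) : is_derive x 1 f (f' x).
  have h1 := dI x; have h2 := dphi x.
  have h3 := derM (derC (s ^+ 2) x) h2.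
  have nz : s ^+ 2 * phi x != 0 by rewrite mulf_neq0 ?gt_eqF.
  have h4 : is_derive x 1 (fun y => (s ^+ 2 * phi y)^-1)
      (- (s ^+ 2 * phi x) ^- 2 *: (s ^+ 2 * (- (x / s ^+ 2) * phi x) + phi x * 0)).
    exact: is_deriveV.
  rewrite /f; apply: (der_eq (derM h1 h4)).
  by rewrite /f' /f /GRing.scale/=; field; by rewrite ?phin0 ?sn0.
have xf x : `|x * f x| <= 2 * K.
  rewrite /f mulrA normrM normfV (gtr0_norm (_ : 0 < s ^+ 2 * phi x)) ?mulr_gt0//.
  by rewrite ler_pdivrMr ?mulr_gt0// mulrA.
have f'B x : `|f' x| <= 4 * K / s ^+ 2.
  rewrite /f' normrM normfV (gtr0_norm s2) ler_wpM2r ?invr_ge0 ?(ltW s2)//.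
  by apply: (le_trans (ler_normD _ _)); have := g0K x; have := xf x; lra.
have fB x : `|f x| <= 2 * K + 2 * K / (s ^+ 2 * phi 1).
  have h0 : 0 <= 2 * K / (s ^+ 2 * phi 1) by have p1 := ltW (phi0 1); have s20 := ltW s2; apply: divr_ge0; exact: mulr_ge0.
  have [x1|x1] := leP 1 `|x|.
    apply: (@le_trans _ _ (2 * K)); last by lra.
    by apply: le_trans (xf x); rewrite [leRHS]normrM; apply: ler_peMl.
  apply: (@le_trans _ _ (2 * K / (s ^+ 2 * phi 1))); last by lra.
  have sp y : 0 < s ^+ 2 * phi y by exact: mulr_gt0.
  rewrite /f normrM normfV (gtr0_norm (sp x)).
  apply: ler_pM => //; first by rewrite invr_ge0 (ltW (sp x)).
  rewrite lef_pV2 ?posrE// ler_wpM2l ?(ltW s2)//.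
  rewrite !centered_normal_pdfE// ler_wpM2l ?normal_peak_ge0// ler_expR lerN2 ler_wpM2r//.
    by rewrite invr_ge0; apply: mulr_ge0 => //; exact: ltW.
  by rewrite expr1n -(real_normK (num_real x)) expr_le1// ltW.
exists f, f', (2 * K + 2 * K / (s ^+ 2 * phi 1) + 4 * K / s ^+ 2); split.
- exact: df.
- move=> x; apply: cvgM; last exact: cvg_cst.
  have cf : continuous f by exact: der_continuous df.
  apply: cvgD; first by apply: cvgB; [exact: cg|exact: cvg_cst].
  by apply: cvgM; [exact: cvg_id|exact: cf].
- by move=> x; apply: (le_trans (fB x)); rewrite lerDl divr_ge0 ?(ltW s2)// mulr_ge0.
- by move=> x; apply: (le_trans (f'B x)); rewrite lerDr (le_trans _ (fB x)).
- by move=> x; rewrite /f' /g0; field.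
Qed.
End normal_stein_equation.

(** * Central limit theorem for sums of squares *)

Section quadratic_clt.
Context (R : realType) d (T : measurableType d) (P : probability T R).
Notation leb := (@lebesgue_measure R).

(** Joint normality is expressed by the characteristic function of every linear form, which allows a
    singular [G]. *)
Definition gaussian_vec n (Z : 'I_n -> T -> R) (G : 'I_n -> 'I_n -> R) :=
  [/\ forall i, measurable_fun setT (Z i), forall i j, G i j = G j i,
   forall u, 0 <= qform G u,
   forall u, \int[P]_w cos (lin Z u w) = expR (- (qform G u / 2)) &
   forall u, \int[P]_w sin (lin Z u w) = 0].

(** [tr G^2] for a symmetric [G]. *)
Definition frob2 n (G : 'I_n -> 'I_n -> R) := \sum_k \sum_l G k l ^+ 2.

(** [tr G^4] for a symmetric [G], with the indices arranged as in [quadf_variance] at [H = G]. *)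
Definition quartic n (G : 'I_n -> 'I_n -> R) :=
  \sum_k \sum_l \sum_a \sum_b G k l * G a b * (G k a * G l b).

Lemma eq_Rintegrable (f g : T -> R) : f =1 g -> Rintegrable P f -> Rintegrable P g.
Proof. by move=> /funext ->. Qed.

(** The variance of [|X|] is non-negative. *)
Lemma mean_abs_le (X : T -> R) : Rintegrable P X -> Rintegrable P (fun w => X w ^+ 2) ->
  \int[P]_w `|X w| <= Num.sqrt (\int[P]_w X w ^+ 2).
Proof.
move=> i1 i2; have ia := Rintegrable_norm i1.
set e := \int[P]_w `|X w|.
have e0 : 0 <= e by apply: Rintegral_ge0 => // w _; exact: normr_ge0.
suff h : e ^+ 2 <= \int[P]_w X w ^+ 2 by rewrite -(ger0_norm e0) -sqrtr_sqr ler_wsqrtr.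
rewrite -subr_ge0.
have -> : \int[P]_w X w ^+ 2 - e ^+ 2 = \int[P]_w (`|X w| - e) ^+ 2.
  transitivity (\int[P]_w (X w ^+ 2 + (- (2 * e) * `|X w| + e ^+ 2))).
    rewrite RintegralD//; last by apply: RintegrableD; [exact: RintegrableZ|exact: Rintegrable_cst].
    rewrite RintegralD//; [|exact: RintegrableZ|exact: Rintegrable_cst].
    by rewrite RintegralZ// -/e Rintegral_cst_prob; ring.
  apply: eq_Rintegral => w _; rewrite -(real_normK (num_real (X w))); ring.
by apply: Rintegral_ge0 => // w _; exact: sqr_ge0.
Qed.

Lemma le_Rintegral_bm (f g : T -> R) B : bm f -> Rintegrable P g -> (forall w, `|f w| <= B) ->
  `|\int[P]_w (g w * f w)| <= B * \int[P]_w `|g w|.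
Proof.
move=> bf ig fB; have i1 := bmZI bf ig.
apply: (le_trans (le_normr_Rintegral _ i1)) => //.
have ia := Rintegrable_norm ig.
rewrite -RintegralZ//; have i2 := Rintegrable_norm i1; have i3 := RintegrableZ B ia.
apply: (le_Rintegral _ i2 i3) => // w _.
by rewrite normrM mulrC ler_wpM2r.
Qed.

Section one_vector.
Variables (n : nat) (Z : 'I_n -> T -> R) (G : 'I_n -> 'I_n -> R).
Hypothesis n0 : (0 < n)%N.
Hypothesis gv : gaussian_vec Z G.
Variable t : R.
Let sn : R := Num.sqrt n%:R.
Definition quad_dev w := sn * (n%:R^-1 * quad Z w - t).
Let beta := sn * (n%:R^-1 * (\sum_k G k k) - t).

Let sn0 : 0 < sn. Proof. by rewrite sqrtr_gt0 ltr0n. Qed.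
Let sn2 : sn ^+ 2 = n%:R. Proof. by rewrite sqr_sqrtr. Qed.

Lemma quad_devE w : quad_dev w = sn^-1 * (quad Z w - \sum_k G k k) + beta.
Proof. by rewrite /quad_dev /beta -sn2; field; rewrite gt_eqF. Qed.

Lemma measurable_quad_dev : measurable_fun setT quad_dev.
Proof.
have [mZ _ _ _ _] := gv.
apply: measurable_funM => //; apply: measurable_funB => //; apply: measurable_funM => //.
exact: measurable_quad.
Qed.

Lemma quad_dev_stein (v : R) (f f' g : R -> R) (B c : R) : (forall x : R, is_derive x 1 f (f' x)) ->
  continuous f' -> (forall x, `|f x| <= B) -> (forall x, `|f' x| <= B) ->
  (forall x, v * f' x - x * f x = g x - c) -> continuous g ->
  (exists M, forall x, `|g x| <= M) ->
  `|\int[P]_w g (quad_dev w) - c| <=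
   B * (2 * Num.sqrt (2 * quartic G / n%:R ^+ 2) + `|2 * frob2 G / n%:R - v| + `|beta|).
Proof.
move=> df cf' fB f'B eq cg [M gM]; have [mZ Gs Gp Zc Zs] := gv.
have mY := measurable_quad_dev.
have cf : continuous f by exact: der_continuous df.
have bY (k : R -> R) K : continuous k -> (forall x, `|k x| <= K) -> bm (fun w => k (quad_dev w)).
  by move=> ck kK; split; [apply: measurableT_comp => //; exact: continuous_measurable|exists K].
have bf := bY _ _ cf fB; have bf' := bY _ _ cf' f'B; have bg := bY _ _ cg gM.
have B0 : 0 <= B := le_trans (normr_ge0 _) (fB 0).
pose tr := \sum_k G k k.
pose q (x : R) := sn^-1 * (x - tr) + beta.
have dq (x : R) : is_derive x 1 q sn^-1.
  by rewrite /q; derive_by; ring.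
pose F x := f (q x); pose F' x := sn^-1 * f' (q x).
have dF (x : R) : is_derive x 1 F (F' x) by exact: der_comp (df (q x)) (dq x).
have cF' : continuous F'.
  move=> x; apply: cvgM; first exact: cvg_cst.
  have cq : continuous q by exact: der_continuous dq.
  by apply: (continuous_comp (cq x)); exact: cf'.
pose B' := B + sn^-1 * B.
have FB x : `|F x| <= B' by rewrite (le_trans (fB _))// lerDl mulr_ge0// invr_ge0 ltW.
have F'B x : `|F' x| <= B'.
  rewrite /F' normrM gtr0_norm ?invr_gt0// /B'.
  by apply: ler_wpDl => //; rewrite ler_wpM2l// invr_ge0 ltW.
have st := quad_stein mZ Gs Gp Zc Zs dF cF' FB F'B.
have qE w : q (quad Z w) = quad_dev w by rewrite quad_devE.
have iQ : Rintegrable P (quad Z).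
  by apply: Rintegrable_sum => i _; under eq_fun do rewrite expr2; exact: (Rintegrable_Z2 mZ Gp Zc).
have iR := Rintegrable_quadf mZ Gp Zc G.
have iQf := bmZI bf iQ; have iRf' := bmZI bf' iR.
have i1 := bmI P bf; have i2 := bmI P bf'.
have st' : \int[P]_w (quad Z w * f (quad_dev w)) =
    tr * \int[P]_w f (quad_dev w) + 2 * (sn^-1 * \int[P]_w (quadf Z G w * f' (quad_dev w))).
  rewrite -(RintegralZ _ iRf').
  rewrite (_ : \int[P]_w (sn^-1 * _) = \int[P]_w (quadf Z G w * F' (quad Z w))); last first.
    by apply: eq_Rintegral => w _; rewrite /F' qE; ring.
  rewrite (_ : \int[P]_w f (quad_dev w) = \int[P]_w F (quad Z w)); last first.
    by apply: eq_Rintegral => w _; rewrite /F qE.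
  rewrite -st; apply: eq_Rintegral => w _; by rewrite /F qE.
pose mu := frob2 G.
have muE : \int[P]_w quadf Z G w = mu.
  rewrite (quadf_mean mZ Gs Gp Zc Zs); apply: eq_bigr => k _; apply: eq_bigr => l _; by rewrite expr2.
(* Stein's equation rewrites the left side as the mean of [v f'(Y) - Y f(Y)], and [quad_stein]
   rewrites the mean of [Y f(Y)]. Replacing [quadf Z G] by its mean [mu] gives the first term, and
   its fluctuation the last. *)
have key : \int[P]_w g (quad_dev w) - c =
   (v - 2 * mu / n%:R) * \int[P]_w f' (quad_dev w) - beta * \int[P]_w f (quad_dev w)
   - 2 / n%:R * \int[P]_w ((quadf Z G w - mu) * f' (quad_dev w)).
  have -> : \int[P]_w ((quadf Z G w - mu) * f' (quad_dev w)) =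
      \int[P]_w (quadf Z G w * f' (quad_dev w)) - mu * \int[P]_w f' (quad_dev w).
    rewrite -RintegralZ// -RintegralB//; last exact: RintegrableZ.
    by apply: eq_Rintegral => w _; ring.
  transitivity (\int[P]_w (v * f' (quad_dev w) +
     (- sn^-1 * (quad Z w * f (quad_dev w)) + (sn^-1 * tr - beta) * f (quad_dev w)))).
    rewrite -[in LHS](Rintegral_cst_prob P c) -RintegralB//; [|exact: bmI|exact: Rintegrable_cst].
    by apply: eq_Rintegral => w _; rewrite -eq [X in X * f _]quad_devE -/tr; ring.
  rewrite RintegralD//; [|exact: RintegrableZ|by apply: RintegrableD; exact: RintegrableZ].
  rewrite RintegralD//; [|exact: RintegrableZ|exact: RintegrableZ].
  rewrite !RintegralZ// st' -sn2; field; by rewrite gt_eqF.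
have one (k : R -> R) : bm (fun w => k (quad_dev w)) -> (forall x, `|k x| <= B) ->
    `|\int[P]_w k (quad_dev w)| <= B.
  move=> bk kB; have := le_Rintegral_bm bk (Rintegrable_cst P 1) (fun w => kB (quad_dev w)).
  rewrite normr1 Rintegral_cst_prob mulr1; under eq_Rintegral do rewrite mul1r; by [].
have n0' : 0 < n%:R :> R by rewrite ltr0n.
have hR : `|\int[P]_w ((quadf Z G w - mu) * f' (quad_dev w))| <= B * Num.sqrt (2 * quartic G).
  have iRm : Rintegrable P (fun w => quadf Z G w - mu) by apply: RintegrableB => //; exact: Rintegrable_cst.
  have iRm2 : Rintegrable P (fun w => (quadf Z G w - mu) ^+ 2).
    have := RintegrableD (Rintegrable_quadf_sqr mZ Gp Zc G) (RintegrableD (RintegrableZ (- (2 * mu)) iR)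
      (Rintegrable_cst P (mu ^+ 2))).
    by apply: eq_Rintegrable => w; ring.
  apply: (le_trans (le_Rintegral_bm bf' iRm (fun w => f'B _))); rewrite ler_wpM2l//.
  apply: (le_trans (mean_abs_le iRm iRm2)); rewrite ler_wsqrtr//.
  have e := quadf_variance mZ Gs Gp Zc Zs Gs.
  rewrite (_ : \sum_k \sum_l G k l * G k l = mu) in e; first by rewrite e.
  by apply: eq_bigr => k _; apply: eq_bigr => l _; rewrite expr2.
rewrite key; apply: (le_trans (ler_normB _ _)).
have -> : 2 * quartic G / n%:R ^+ 2 = 2 * quartic G * n%:R^-1 ^+ 2 by rewrite exprVn.
rewrite sqrtrM; last first.
  have e := quadf_variance mZ Gs Gp Zc Zs Gs; rewrite -[2 * _]e.
  by apply: Rintegral_ge0 => // w _; exact: sqr_ge0.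
have ni : 0 < n%:R^-1 :> R by rewrite invr_gt0.
rewrite sqrtr_sqr (gtr0_norm ni).
have h3 : `|2 / n%:R * \int[P]_w ((quadf Z G w - mu) * f' (quad_dev w))| <=
   2 / n%:R * (B * Num.sqrt (2 * quartic G)).
  by rewrite normrM gtr0_norm ?divr_gt0// ler_wpM2l// ltW// divr_gt0.
have h1 : `|(v - 2 * mu / n%:R) * \int[P]_w f' (quad_dev w)| <= `|2 * mu / n%:R - v| * B.
  by rewrite normrM distrC ler_wpM2l// one.
have h2 : `|beta * \int[P]_w f (quad_dev w)| <= `|beta| * B by rewrite normrM ler_wpM2l// one.
apply: (le_trans (lerD (ler_normB _ _) (lexx _))); rewrite -/mu.
apply: (le_trans (lerD (lerD h1 h2) h3)).
by rewrite le_eqVlt; apply/orP; left; apply/eqP; ring.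
Qed.

(** The sum of squares is the quadratic form of the identity matrix, so [quadf_variance] applies.
    This second moment settles the degenerate limit [v = 0]. *)
Lemma quad_dev_sqr : Rintegrable P (fun w => quad_dev w ^+ 2) /\
  \int[P]_w quad_dev w ^+ 2 = 2 * frob2 G / n%:R + beta ^+ 2.
Proof.
have [mZ Gs Gp Zc Zs] := gv.
pose H (i j : 'I_n) : R := (j == i)%:R.
pose tr := \sum_k G k k.
have Hs i j : H i j = H j i by rewrite /H eq_sym.
have qE w : quad Z w = quadf Z H w.
  apply: eq_bigr => k _; rewrite /H; under eq_bigr do rewrite mulrC.
  by rewrite sum_delta expr2.
have trE : \sum_k \sum_l H k l * G k l = tr.
  by apply: eq_bigr => k _; under eq_bigr do rewrite mulrC; rewrite sum_delta.
have e1 := quadf_mean mZ Gs Gp Zc Zs H; have e2 := quadf_variance mZ Gs Gp Zc Zs Hs.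
rewrite trE in e1 e2.
have i1 := Rintegrable_quadf mZ Gp Zc H; have i2 := Rintegrable_quadf_sqr mZ Gp Zc H.
have i3 : Rintegrable P (fun w => quadf Z H w - tr) by apply: RintegrableB => //; exact: Rintegrable_cst.
have i4 : Rintegrable P (fun w => (quadf Z H w - tr) ^+ 2).
  have := RintegrableD i2 (RintegrableD (RintegrableZ (- (2 * tr)) i1) (Rintegrable_cst P (tr ^+ 2))).
  by apply: eq_Rintegrable => w; ring.
have YE w : quad_dev w ^+ 2 = n%:R^-1 * (quadf Z H w - tr) ^+ 2 +
    (2 * sn^-1 * beta * (quadf Z H w - tr) + beta ^+ 2).
  by rewrite quad_devE qE -/tr -sn2; field; rewrite gt_eqF.
have -> : (fun w => quad_dev w ^+ 2) = (fun w => n%:R^-1 * (quadf Z H w - tr) ^+ 2 +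
    (2 * sn^-1 * beta * (quadf Z H w - tr) + beta ^+ 2)) by apply/funext.
have j2 : Rintegrable P (fun w => 2 * sn^-1 * beta * (quadf Z H w - tr) + beta ^+ 2).
  by apply: RintegrableD; [exact: RintegrableZ|exact: Rintegrable_cst].
split; first by apply: RintegrableD => //; exact: RintegrableZ.
rewrite RintegralD//; last exact: RintegrableZ.
rewrite RintegralD//; [|exact: RintegrableZ|exact: Rintegrable_cst].
rewrite Rintegral_cst_prob (RintegralZ _ i4) (RintegralZ _ i3) RintegralB//; last exact: Rintegrable_cst.
rewrite e1 !Rintegral_cst_prob subrr mulr0 add0r e2; congr (_ + _).
rewrite mulrC; congr (2 * _ / _); apply: eq_bigr => k _.
under eq_bigr => l _.
  under eq_bigr => a _.
    rewrite (_ : \sum_b _ = G k a * G l a * H k l); last first.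
      transitivity (\sum_b H k l * G k a * G l b * (b == a)%:R).
        by apply: eq_bigr => b _; rewrite [H a b]/H; ring.
      by rewrite sum_delta; ring.
  over.
  rewrite -mulr_suml.
over.
by rewrite sum_delta; apply: eq_bigr => a _; rewrite expr2.
Qed.
End one_vector.

Lemma quad_clt (m : nat -> nat) (Z : forall j, 'I_(m j) -> T -> R)
   (G : forall j, 'I_(m j) -> 'I_(m j) -> R) (t v : R) :
  (forall j, (0 < m j)%N) -> (forall j, gaussian_vec (Z j) (G j)) -> 0 <= v ->
  2 * frob2 (G j) / (m j)%:R @[j --> \oo] --> v ->
  quartic (G j) / (m j)%:R ^+ 2 @[j --> \oo] --> 0 ->
  Num.sqrt (m j)%:R * ((m j)%:R^-1 * (\sum_k G j k k) - t) @[j --> \oo] --> 0 ->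
  cvg_law_gauss P (fun j => quad_dev (Z j) t) v.
Proof.
move=> m0 gv v0 cv c4 cb g cg [M gM].
have mY j := measurable_quad_dev (gv j) t.
have bg j : bm (fun w => g (quad_dev (Z j) t w)).
  by split; [apply: measurableT_comp => //; exact: continuous_measurable|exists M].
have E1 j : 'E_P[g \o quad_dev (Z j) t]%E = (\int[P]_w g (quad_dev (Z j) t w))%:E.
  by rewrite unlock EFin_Rintegral//; exact: bmI.
rewrite (_ : (fun j => _) = EFin \o (fun j => \int[P]_w g (quad_dev (Z j) t w))); last first.
  by apply/funext => j; exact: E1.
have c4' : 2 * quartic (G j) / (m j)%:R ^+ 2 @[j --> \oo] --> 0.
  rewrite (_ : (fun j => _) = (fun j => 2 * (quartic (G j) / (m j)%:R ^+ 2))); last first.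
    by apply/funext => j; rewrite mulrA.
  by rewrite -[X in _ --> X](mulr0 2); apply: cvgM; [exact: cvg_cst|exact: c4].
rewrite /gauss_expect; case: ltP => [v1|v1].
  have s0 : 0 < Num.sqrt v by rewrite sqrtr_gt0.
  have [f [f' [B [df cf' fB f'B eq]]]] := normal_stein_solution s0 cg gM.
  rewrite -EFin_Rintegral; last first.
    apply: (@Rintegrable_normal_mul _ _ s0 _ M 0); first exact: continuous_measurable.
    by move=> x; rewrite mul0r addr0.
  apply: cvg_EFin => //; first by near=> j.
  set c := \int[leb]_x _ in eq *; rewrite sqr_sqrtr// in eq.
  apply: (cvgn_squeeze (fun j => quad_dev_stein (m0 j) (gv j) t df cf' fB f'B eq cg (ex_intro _ M gM))).
  rewrite -[X in _ --> X](mulr0 B); apply: cvgM; first exact: cvg_cst.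
  rewrite -[X in _ --> X]addr0; apply: cvgD; last by have := cvg_norm cb; rewrite normr0; exact.
  rewrite -[X in _ --> X]addr0; apply: cvgD; last first.
    have := cvg_norm (cvgB cv (cvg_cst v)); rewrite subrr normr0; exact.
  rewrite -[X in _ --> X](mulr0 2); apply: cvgM; first exact: cvg_cst.
  rewrite -[X in _ --> X](sqrtr0 R); by apply: continuous_cvg; [exact: sqrt_continuous|exact: c4'].
(* In the degenerate case the second moment of the statistic tends to 0, and
   [|g x - g 0| <= e / 2 + C x^2] by continuity at 0 and boundedness, as in Chebyshev's
   inequality. *)
have {v0 v1} v0 : v = 0 by apply/eqP; rewrite eq_le v1 v0.
apply: cvg_EFin => //; first by near=> j.
apply/cvgrPdist_le => e e0.
have e2 : 0 < e / 2 by lra.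
have M0 : 0 <= M := le_trans (normr_ge0 _) (gM 0).
have [D D0 hD] : exists2 D : R, 0 < D & forall x, `|x| < D -> `|g x - g 0| <= e / 2.
  have /cvgrPdist_le/(_ _ e2)[D /= D0 hD] := cg 0.
  by exists D => // x xD; rewrite distrC; apply: hD => /=; rewrite sub0r normrN.
pose C := 2 * M / D ^+ 2.
have C0 : 0 <= C by rewrite divr_ge0 ?sqr_ge0// mulr_ge0.
have key x : `|g x - g 0| <= e / 2 + C * x ^+ 2.
  have [/hD h|Dx] := ltP `|x| D; first by rewrite (le_trans h)// lerDl mulr_ge0// sqr_ge0.
  apply: (@le_trans _ _ (2 * M)).
    by apply: (le_trans (ler_normB _ _)); have := gM x; have := gM 0; lra.
  apply: ler_wpDl; first exact: ltW.
  rewrite [leRHS](_ : _ = 2 * M * x ^+ 2 / D ^+ 2); last by rewrite /C; ring.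
  rewrite ler_pdivlMr ?exprn_gt0// ler_wpM2l ?mulr_ge0//.
  by rewrite -(real_normK (num_real x)) ler_sqr ?nnegrE// ltW.
have cY : C * (2 * frob2 (G j) / (m j)%:R +
    (Num.sqrt (m j)%:R * ((m j)%:R^-1 * (\sum_k G j k k) - t)) ^+ 2) @[j --> \oo] --> 0.
  rewrite -[X in _ --> X](mulr0 C); apply: cvgM; first exact: cvg_cst.
  rewrite -[X in _ --> X]addr0; apply: cvgD; first by rewrite -v0.
  by rewrite -[X in _ --> X](mulr0 0); under eq_fun do rewrite expr2; apply: cvgM.
near=> j.
have [i2 e2'] := quad_dev_sqr (m0 j) (gv j) t.
have ig := bmI P (bg j).
rewrite distrC -(Rintegral_cst_prob P (g 0)) -RintegralB//; last exact: Rintegrable_cst.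
have ib : Rintegrable P (fun w => g (quad_dev (Z j) t w) - g 0).
  by apply: RintegrableB => //; exact: Rintegrable_cst.
apply: (le_trans (le_normr_Rintegral _ ib)) => //.
have ir : Rintegrable P (fun w => e / 2 + C * quad_dev (Z j) t w ^+ 2).
  by apply: RintegrableD; [exact: Rintegrable_cst|exact: RintegrableZ].
have in_ := Rintegrable_norm ib.
apply: (@le_trans _ _ (\int[P]_w (e / 2 + C * quad_dev (Z j) t w ^+ 2))).
  by apply: (le_Rintegral _ in_ ir) => // w _; exact: key.
rewrite RintegralD//; [|exact: Rintegrable_cst|exact: RintegrableZ].
rewrite Rintegral_cst_prob RintegralZ// e2'.
suff : `|0 - C * (2 * frob2 (G j) / (m j)%:R +
    (Num.sqrt (m j)%:R * ((m j)%:R^-1 * (\sum_k G j k k) - t)) ^+ 2)| <= e / 2.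
  by rewrite sub0r normrN ler_norml; lra.
near: j; by move/cvgrPdist_le : cY; exact.
Unshelve. all: by end_near. Qed.
End quadratic_clt.

(** * Folding and Fejer's theorem *)

Lemma continuous_sumr (R : realType) (I : Type) (r : seq I) (f : I -> R -> R) :
  (forall i, continuous (f i)) -> continuous (fun t => \sum_(i <- r) f i t).
Proof.
move=> cf; elim: r => [|i r IH] t.
  by under eq_fun do rewrite big_nil; exact: cvg_cst.
rewrite (_ : (fun t => _) = (fun t => f i t + \sum_(j <- r) f j t)); last first.
  by apply/funext => y; rewrite big_cons.
by apply: cvgD; [exact: cf|exact: IH].
Qed.

Section dirichlet_square.
Context (R : realType).

(* |sum_(k < m) e^(ikt)|^2, that is m times Fejer's kernel. *)
Definition dsq (m : nat) (t : R) := \sum_(k < m) \sum_(l < m) cos ((k%:R - l%:R) * t).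

Lemma dsqE m t : dsq m t =
  (\sum_(k < m) cos (k%:R * t)) ^+ 2 + (\sum_(k < m) sin (k%:R * t)) ^+ 2.
Proof.
rewrite !expr2 !mulr_suml -big_split/=; apply: eq_bigr => k _.
rewrite !mulr_sumr -big_split/=; apply: eq_bigr => l _.
by rewrite mulrBl cosB.
Qed.

Lemma dsq_ge0 m t : 0 <= dsq m t.
Proof. by rewrite dsqE addr_ge0 ?sqr_ge0. Qed.

(* |1 - e^(it)|^2 |sum_(k < m) e^(ikt)|^2 = |1 - e^(imt)|^2. *)
Lemma dsq_cos m t : (1 - cos t) * dsq m t = 1 - cos (m%:R * t).
Proof.
rewrite dsqE; set p := \sum_(k < m) cos _; set q := \sum_(k < m) sin _.
have [h1 h2] : p * (1 - cos t) + q * sin t = 1 - cos (m%:R * t) /\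
   q * (1 - cos t) - p * sin t = - sin (m%:R * t).
  rewrite /p /q; elim: m {p q} => [|m [IH1 IH2]].
    by rewrite !big_ord0 !mul0r cos0 sin0 !subrr oppr0 addr0.
  rewrite !big_ord_recr/=; have e : m.+1%:R * t = m%:R * t + t by rewrite -natr1; ring.
  by rewrite e cosD sinD; split; [move: IH1|move: IH2]; lra.
have cs := cos2Dsin2 t; have cm := cos2Dsin2 (m%:R * t).
suff : 2 * ((1 - cos t) * (p ^+ 2 + q ^+ 2)) = 2 * (1 - cos (m%:R * t)) by lra.
transitivity ((1 - cos (m%:R * t)) ^+ 2 + (- sin (m%:R * t)) ^+ 2); last first.
  by move: cm; set x := cos (_ * t); set y := sin (_ * t); lra.
rewrite -h1 -h2; move: cs; set x := cos t; set y := sin t => cs.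
have -> : y ^+ 2 = 1 - x ^+ 2 -> (p * (1 - x) + q * y) ^+ 2 + (q * (1 - x) - p * y) ^+ 2 =
   2 * ((1 - x) * (p ^+ 2 + q ^+ 2)).
- move=> y2; transitivity ((p ^+ 2 + q ^+ 2) * ((1 - x) ^+ 2 + y ^+ 2)); first by ring.
  by rewrite y2; ring.
- by [].
- lra.
Qed.

Lemma continuous_dsq m (a : R) : continuous (fun t => dsq m (a * t)).
Proof.
apply: continuous_sumr => k; apply: continuous_sumr => l.
by under eq_fun do rewrite mulrA; exact: continuous_cos_mul.
Qed.

Lemma sin_natpi n : sin (n%:R * pi) = 0 :> R.
Proof.
elim: n => [|n IH]; first by rewrite mul0r sin0.
by rewrite -natr1 mulrDl mul1r sinDpi IH oppr0.
Qed.

Lemma cos_periodic_nat (x : R) n : cos (x + 2 * n%:R * pi) = cos x.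
Proof.
elim: n => [|n IH]; first by rewrite mulr0 mul0r addr0.
rewrite (_ : x + _ = (x + 2 * n%:R * pi) + pi *+ 2) ?cosD2pi//.
by rewrite -natr1 mulr2n; ring.
Qed.
End dirichlet_square.

Lemma split_indicator (R : realType) (a b c e x : R) : a <= b -> b <= c -> c <= e ->
  ((b <= x < c)%R : bool)%:R + (((c <= x < e)%R : bool)%:R + ((a <= x < b)%R : bool)%:R) =
  ((a <= x < e)%R : bool)%:R :> R.
Proof.
move=> ab bc ce; have [xb|bx] := ltP x b.
  rewrite (_ : (c <= x) = false); last by apply/negP; lra.
  rewrite (_ : (x < e) = true); last by lra.
  by rewrite /= add0r add0r.
rewrite andbF addr0 (_ : (a <= x) = true); last by lra.
have [xc|cx] /= := ltP x c; last by rewrite add0r.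
by rewrite addr0 (_ : (x < e) = true)//; lra.
Qed.

(** The windows centred at [2 n L] and [- 2 (n + 1) L] extend the block on both sides. The block
    reaches one period further to the left because the [k]-th step adds the indices [k] and
    [- (k + 1)]. *)
Lemma partition_step (R : realType) (L n x : R) : 0 < L -> 0 <= n ->
  ((- ((2 * n + 1) * L) <= x < (2 * n - 1) * L)%R : bool)%:R +
  (((- L <= x - 2 * n * L < L)%R : bool)%:R + ((- L <= x + 2 * (n + 1) * L < L)%R : bool)%:R) =
  ((- ((2 * (n + 1) + 1) * L) <= x < (2 * (n + 1) - 1) * L)%R : bool)%:R :> R.
Proof.
move=> L0 n0; have nL := mulr_ge0 n0 (ltW L0).
rewrite (_ : (- L <= x - 2 * n * L) = ((2 * n - 1) * L <= x)); last by apply/idP/idP; lra.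
rewrite (_ : (x - 2 * n * L < L) = (x < (2 * (n + 1) - 1) * L)); last by apply/idP/idP; lra.
rewrite (_ : (- L <= x + 2 * (n + 1) * L) = (- ((2 * (n + 1) + 1) * L) <= x)); last by apply/idP/idP; lra.
rewrite (_ : (x + 2 * (n + 1) * L < L) = (x < - ((2 * n + 1) * L))); last by apply/idP/idP; lra.
apply: split_indicator; try lra.
Qed.

Section folding.
Context (R : realType).
Notation leb := (@lebesgue_measure R).
Variables (c : R).
Hypothesis c0 : 0 < c.
Let L := c * pi.
Let L0 : 0 < L. Proof. by rewrite mulr_gt0// pi_gt0. Qed.

(* Half-open, so that its translates by multiples of 2 L tile the line. *)
Definition window (t : R) : R := ((- L <= t < L)%R : bool)%:R.
Notation W := window.

Lemma window_ge0 t : 0 <= W t.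
Proof. exact: ler0n. Qed.

Lemma window_le1 t : W t <= 1.
Proof. by rewrite lern1 leq_b1. Qed.

Lemma window_neq0 t : W t != 0 -> - L <= t < L.
Proof. by rewrite /window; case: (_ <= _ < _) => //; rewrite eqxx. Qed.

Lemma windowE : W = \1_(`[- L, L[%classic : set R).
Proof. by apply/funext => t; rewrite indicE mem_setE in_itv. Qed.

Lemma measurable_window : measurable_fun [set: R] W.
Proof. rewrite windowE; apply: measurable_indic; exact: measurable_itv. Qed.

Lemma Rintegrable_mkcond (D : set R) (f : R -> R) : @measurable _ (measurableTypeR R) D ->
  leb.-integrable D (EFin \o f) -> Rintegrable leb (fun t => \1_D t * f t).
Proof.
move=> mD h; have := (@integrable_mkcond _ _ _ leb D (EFin \o f) mD).1 h.
rewrite (_ : (EFin \o f) \_ _ = EFin \o (fun t => \1_D t * f t))//.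
apply/funext => t; rewrite patchE/= indicE; case: ifPn => _; by rewrite ?mul1r ?mul0r.
Qed.

Lemma integrable_window (f : R -> R) : continuous f ->
  leb.-integrable `[- L, L[%classic (EFin \o f).
Proof.
move=> cf; apply: (@integrableS _ _ _ leb `[- L, L]%classic); [exact: measurable_itv|exact: measurable_itv| |].
  by move=> x /=; rewrite !in_itv/= => /andP[-> /ltW ->].
apply: continuous_compact_integrable; first exact: segment_compact.
exact: continuous_subspaceT.
Qed.

Lemma Rintegrable_window (f : R -> R) : continuous f -> Rintegrable leb (fun t => W t * f t).
Proof.
move=> cf; rewrite windowE; apply: Rintegrable_mkcond; first exact: measurable_itv.
exact: integrable_window.
Qed.

Lemma Rintegral_window (f : R -> R) : continuous f ->
  \int[leb]_t (W t * f t) = \int[leb]_(t in `[- L, L]) f t.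
Proof.
move=> cf; rewrite -Rintegral_itv_bndo_bndc; last exact: integrable_window.
rewrite [RHS]Rintegral_mkcond windowE; apply: eq_Rintegral => t _.
by rewrite patchE indicE; case: ifPn; rewrite ?mul1r ?mul0r.
Qed.

Lemma Rintegrable_compact (A : R) (g : R -> R) : continuous g ->
  (forall x, A < `|x| -> g x = 0) -> Rintegrable leb g.
Proof.
move=> cg gA; have h : leb.-integrable `[- A, A]%classic (EFin \o g).
  apply: continuous_compact_integrable; first exact: segment_compact.
  exact: continuous_subspaceT.
have := Rintegrable_mkcond (measurable_itv _) h.
rewrite (_ : (fun t => _) = g)//.
apply/funext => t; rewrite indicE mem_setE in_itv/= -ler_norml.
by case: leP => [|/gA ->]; rewrite ?mul1r ?mul0r.
Qed.

Lemma Rintegral_translate (a : R) (f : R -> R) : Rintegrable leb f ->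
  \int[leb]_x f x = \int[leb]_x f (x + a).
Proof.
move=> fi; have := @Rintegral_affine R 1 a f (oner_neq0 _) fi.
rewrite normr1 invr1 mul1r => <-; apply: eq_Rintegral => x _; by rewrite mul1r.
Qed.

(* The translates are enumerated as in sumZ: by 2 k L and by - 2 (k + 1) L for k < N. *)
Definition shiftsum (N : nat) (g : R -> R) (t : R) :=
  \sum_(0 <= k < N) (g (t + 2 * k%:R * L) + g (t - 2 * k.+1%:R * L)).

Lemma continuous_shift (g : R -> R) (a : R) : continuous g -> continuous (fun t => g (t + a)).
Proof.
move=> cg t; apply: (@continuous_comp _ _ _ (fun t => t + a) g); last exact: cg.
by apply: cvgD; [exact: cvg_id|exact: cvg_cst].
Qed.

Lemma continuous_shiftsum N g : continuous g -> continuous (shiftsum N g).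
Proof.
move=> cg; apply: continuous_sumr => k t.
by apply: cvgD; exact: continuous_shift.
Qed.

Lemma window_partition N (x : R) :
  \sum_(0 <= k < N) (W (x - 2 * k%:R * L) + W (x + 2 * k.+1%:R * L)) =
  ((- ((2 * N%:R + 1) * L) <= x < (2 * N%:R - 1) * L)%R : bool)%:R.
Proof.
elim: N => [|N IH].
  rewrite big_nil mulr0 add0r sub0r mul1r mulN1r.
  by case: leP => // h; rewrite ltNge h.
rewrite big_nat_recr//= IH /window -![N.+1%:R]natr1.
by apply: partition_step => //; exact: L0.
Qed.

(** The line is cut into windows, each translated back onto the central one, which leaves the
    periodic factor [p] unchanged. After [N] steps the asymmetric block reaches only [(2 N - 1) L]
    on the right, whence the condition on [A]. *)
Lemma fold_Rintegral (A : R) (g p : R -> R) (N : nat) : continuous g -> continuous p ->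
  (forall x, A < `|x| -> g x = 0) -> (forall t, p (t + 2 * L) = p t) ->
  A < (2 * N%:R - 1) * L ->
  \int[leb]_x (g x * p x) = \int[leb]_t (W t * (shiftsum N g t * p t)).
Proof.
move=> cg cp gA pL AN.
have pk (k : nat) t : p (t + 2 * k%:R * L) = p t.
  elim: k => [|k IH]; first by rewrite mulr0 mul0r addr0.
  by rewrite -[RHS]IH -[RHS]pL; congr (p _); rewrite -natr1; ring.
have pk' (k : nat) t : p (t - 2 * k%:R * L) = p t.
  by rewrite -[LHS](pk k); congr (p _); ring.
have cgp : continuous (fun x => g x * p x) by move=> x; apply: cvgM; [exact: cg|exact: cp].
have igp : Rintegrable leb (fun x => g x * p x).
  by apply: (@Rintegrable_compact A) => // x /gA ->; rewrite mul0r.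
have iWg (a : R) : Rintegrable leb (fun x => W (x + a) * (g x * p x)).
  apply: (@le_Rintegrable _ _ _ leb _ (fun x => `|g x * p x|)).
  - apply: measurable_funM; last exact: continuous_measurable.
    by apply: (measurableT_comp measurable_window); exact: measurable_funD.
  - by move=> x; rewrite normrM ler_piMl// ger0_norm ?window_ge0// window_le1.
  - exact: Rintegrable_norm.
transitivity (\int[leb]_x \sum_(0 <= k < N)
   (W (x + - (2 * k%:R * L)) * (g x * p x) + W (x + 2 * k.+1%:R * L) * (g x * p x))).
  apply: eq_Rintegral => x _.
  under eq_bigr do rewrite -mulrDl.
  rewrite -mulr_suml window_partition.
  have [xA|/gA ->] := leP `|x| A; last by rewrite mul0r mulr0.
  move: xA; rewrite ler_norml => /andP[h1 h2].
  rewrite (_ : (_ <= _ < _) = true) ?mul1r//.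
  by have := L0; move: AN; rewrite -/L; set y := N%:R; move: L => L' h3 h4; apply/andP; split; lra.
rewrite Rintegral_sum; last by move=> k _; exact: RintegrableD.
have cs (a : R) : Rintegrable leb (fun t => W t * (g (t + a) * p t)).
  by apply: Rintegrable_window => t; apply: cvgM; [exact: continuous_shift|exact: cp].
transitivity (\sum_(0 <= k < N) (\int[leb]_t (W t * (g (t + 2 * k%:R * L) * p t)) +
    \int[leb]_t (W t * (g (t + - (2 * k.+1%:R * L)) * p t)))).
  apply: eq_bigr => k _; rewrite RintegralD//; congr (_ + _).
    rewrite (Rintegral_translate (2 * k%:R * L))//; apply: eq_Rintegral => t _.
    by rewrite addrK pk.
  rewrite (Rintegral_translate (- (2 * k.+1%:R * L)))//; apply: eq_Rintegral => t _.
  by rewrite subrK pk'.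
under eq_bigr do rewrite -RintegralD//.
rewrite -Rintegral_sum; last by move=> k _; exact: RintegrableD.
apply: eq_Rintegral => t _; rewrite /shiftsum mulr_suml mulr_sumr.
by apply: eq_bigr => k _; ring.
Qed.

Lemma window_cos (n : nat) : \int[leb]_t (W t * cos (n.+1%:R * (c^-1 * t))) = 0.
Proof.
have cn := @continuous_cos_mul R (n.+1%:R / c).
have e : (fun t => cos (n.+1%:R * (c^-1 * t))) = (fun t => cos (n.+1%:R / c * t)).
  by apply/funext => t; rewrite mulrA.
rewrite (_ : (fun t => _) = (fun t => W t * cos (n.+1%:R / c * t))); last first.
  by apply/funext => t; rewrite mulrA.
have nc : n.+1%:R / c != 0 by rewrite mulf_neq0 ?invr_eq0 ?gt_eqF ?pnatr_eq0.
have h : forall t : R, is_derive t 1 (fun t => sin (n.+1%:R / c * t) / (n.+1%:R / c)) (cos (n.+1%:R / c * t)).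
  by move=> t; derive_by; field; rewrite ?nc ?gt_eqF ?pnatr_eq0.
rewrite Rintegral_window// (Rintegral_itv_derive _ h)//; last by rewrite ge0_cp ?ltW.
rewrite mulrN sinN (_ : _ * L = n.+1%:R * pi) ?sin_natpi; last by rewrite /L; field; rewrite gt_eqF.
by rewrite oppr0 mul0r subrr.
Qed.

Lemma window_cst (a : R) : \int[leb]_t (W t * a) = 2 * L * a.
Proof.
have h : forall t : R, is_derive t 1 (fun t => a * t) a by move=> t; derive_by; ring.
have cc : continuous (fun _ : R => a) by move=> t; exact: cvg_cst.
rewrite Rintegral_window// (Rintegral_itv_derive _ h)//; last by rewrite ge0_cp ?ltW.
by ring.
Qed.

(** Orthogonality over a period: only the [m] diagonal terms survive. *)
Lemma window_dsq m : \int[leb]_t (W t * dsq m (c^-1 * t)) = 2 * L * m%:R.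
Proof.
have ci (k l : 'I_m) : Rintegrable leb (fun t => W t * cos ((k%:R - l%:R) * (c^-1 * t))).
  apply: Rintegrable_window.
  by under eq_fun do rewrite mulrA; exact: continuous_cos_mul.
transitivity (\int[leb]_t \sum_(k < m) \sum_(l < m) W t * cos ((k%:R - l%:R) * (c^-1 * t))).
  by apply: eq_Rintegral => t _; rewrite mulr_sumr; apply: eq_bigr => k _; rewrite mulr_sumr.
rewrite Rintegral_sum; last by move=> k _; exact: Rintegrable_sum.
transitivity (\sum_(k < m) \sum_(l < m) (2 * L) * (l == k)%:R).
  apply: eq_bigr => k _; rewrite Rintegral_sum//; apply: eq_bigr => l _.
  have [->|lk] := eqVneq l k.
    rewrite mulr1 -[RHS]mulr1 -window_cst; apply: eq_Rintegral => t _.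
    by rewrite subrr mul0r cos0.
  rewrite mulr0; have [kl|kl|kl] := ltngtP k l.
  - have kl' := ltnW kl; rewrite -(window_cos (l - k).-1); apply: eq_Rintegral => t _.
    rewrite prednK ?subn_gt0// natrB//; congr (_ * _).
    by rewrite -[LHS]cosN; congr cos; ring.
  - rewrite -(window_cos (k - l).-1); apply: eq_Rintegral => t _.
    by rewrite prednK ?subn_gt0// natrB// ltnW.
  - by move: lk; rewrite -val_eqE/= kl eqxx.
under eq_bigr do rewrite sum_delta.
by rewrite sumr_const card_ord mulr_natr.
Qed.
End folding.

Section fejer.
Context (R : realType).
Notation leb := (@lebesgue_measure R).
Variables (c : R) (H : R -> R) (A kappa : R) (N : nat).
Hypothesis c0 : 0 < c.
Let L := c * pi.
Let L0 : 0 < L. Proof. by rewrite mulr_gt0// pi_gt0. Qed.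
Hypothesis cH : continuous H.
Hypothesis HN : forall x, H (- x) = H x.
Hypothesis HA : forall x, A < `|x| -> H x = 0.
Hypothesis AN : A + L < (2 * N%:R - 1) * L.
Notation W := (window c).
Let S := shiftsum c N H.
Let cS : continuous S. Proof. exact: continuous_shiftsum. Qed.

(** The entry at lag [x] of the idealised Toeplitz matrix: spectral density constant equal to
    [kappa], frequency step exactly [1 / c]. *)
Definition four (x : R) := kappa * \int[leb]_e (H e * cos (x * (c^-1 * e))).

Lemma continuous_cos_scale (a b : R) : continuous (fun t : R => cos (a * (b * t))).
Proof. by under eq_fun do rewrite mulrA; exact: continuous_cos_mul. Qed.

Lemma continuous_sin_scale (a b : R) : continuous (fun t : R => sin (a * (b * t))).
Proof. by under eq_fun do rewrite mulrA; exact: continuous_sin_mul. Qed.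

Lemma continuousM (f g : R -> R) : continuous f -> continuous g -> continuous (fun t => f t * g t).
Proof. by move=> cf cg t; apply: cvgM; [exact: cf|exact: cg]. Qed.

Lemma Rintegrable_supp (f : R -> R) : continuous f -> Rintegrable leb (fun e => H e * f e).
Proof.
move=> cf; apply: (@Rintegrable_compact _ A); first exact: continuousM.
by move=> x /HA ->; rewrite mul0r.
Qed.

(** The lag [x] occurs [m - |x|] times among the differences [k - l], so [m^-1 * sig m] is the Fejer
    mean of order [m] of the series with coefficients [four]. *)
Let sig (m : nat) (e : R) := \sum_(k < m) \sum_(l < m)
  four (k%:R - l%:R) * cos ((k%:R - l%:R) * (c^-1 * e)).

(** Evenness of [H] kills the sine integral, so it may be added to complete the cosine of a
    difference. *)
Lemma four_cos (x e : R) : four x * cos (x * (c^-1 * e)) =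
  kappa * \int[leb]_y (H y * cos (x * (c^-1 * (y - e)))).
Proof.
have i1 := Rintegrable_supp (@continuous_cos_scale x c^-1).
have i2 := Rintegrable_supp (@continuous_sin_scale x c^-1).
have o : \int[leb]_y (H y * sin (x * (c^-1 * y))) = 0.
  by apply: Rintegral_odd => // y; rewrite HN !mulrN sinN mulrN.
transitivity (kappa * \int[leb]_y (cos (x * (c^-1 * e)) * (H y * cos (x * (c^-1 * y))) +
    sin (x * (c^-1 * e)) * (H y * sin (x * (c^-1 * y))))).
  rewrite RintegralD//; [|exact: RintegrableZ|exact: RintegrableZ].
  by rewrite !RintegralZ// o mulr0 addr0 /four; ring.
by congr (_ * _); apply: eq_Rintegral => y _; rewrite !mulrBr cosB; ring.
Qed.

Lemma sigE m e : sig m e = kappa * \int[leb]_t (H (t + e) * dsq m (c^-1 * t)).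
Proof.
rewrite /sig; under eq_bigr => k _ do under eq_bigr => l _ do rewrite four_cos.
under eq_bigr do rewrite -mulr_sumr; rewrite -mulr_sumr; congr (_ * _).
have ci (k l : 'I_m) : Rintegrable leb (fun y => H y * cos ((k%:R - l%:R) * (c^-1 * (y - e)))).
  apply: Rintegrable_supp; apply: (@continuous_shift R (fun y => cos ((k%:R - l%:R) * (c^-1 * y))) (- e)).
  exact: continuous_cos_scale.
under eq_bigr do rewrite -Rintegral_sum//.
rewrite -Rintegral_sum; last by move=> k _; exact: Rintegrable_sum.
rewrite (Rintegral_translate e); last by apply: Rintegrable_sum => k _; exact: Rintegrable_sum.
apply: eq_Rintegral => t _; rewrite /dsq mulr_sumr; apply: eq_bigr => k _.
by rewrite mulr_sumr; apply: eq_bigr => l _; rewrite addrK.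
Qed.

Lemma sig_fold m e : - L <= e <= L ->
  sig m e = kappa * \int[leb]_t (W t * (S (t + e) * dsq m (c^-1 * t))).
Proof.
move=> /andP[e1 e2]; rewrite sigE; congr (_ * _).
rewrite (@fold_Rintegral _ c c0 (A + L) (fun t => H (t + e)) _ N)//.
- apply: eq_Rintegral => t _; congr (_ * (_ * _)).
  by rewrite /S /shiftsum; apply: eq_bigr => k _; congr (H _ + H _); ring.
- exact: continuous_shift.
- exact: continuous_dsq.
- move=> x xA; apply: HA; have := ler_normB (x + e) e; rewrite addrK.
  have : `|e| <= L by rewrite ler_norml e1.
  lra.
- move=> t; rewrite /dsq; apply: eq_bigr => k _; apply: eq_bigr => l _.
  have -> : c^-1 * (t + 2 * (c * pi)) = c^-1 * t + 2 * pi by field; rewrite gt_eqF.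
  have [kl|lk] := leqP k l.
    rewrite -(opprB l%:R) -natrB// mulNr cosN mulNr cosN mulrDr.
    by rewrite (_ : (l - k)%:R * (2 * pi) = 2 * (l - k)%:R * pi) ?cos_periodic_nat//; ring.
  have {}lk := ltnW lk; rewrite -natrB// mulrDr.
  by rewrite (_ : (k - l)%:R * (2 * pi) = 2 * (k - l)%:R * pi) ?cos_periodic_nat//; ring.
Qed.

(** Large increments are charged to [1 - cos], bounded below away from 0. This weight is chosen
    because, by [dsq_cos], its product with [dsq m] is at most 2, negligible against the mass of
    order [m] of the kernel. *)
Lemma fejer_modulus e : 0 < e -> exists2 C, 0 <= C & forall x t, - L <= x <= L -> - L <= t <= L ->
  `|S (t + x) - S x| <= e + C * (1 - cos (c^-1 * t)).
Proof.
move=> e0; have [D D0 hD] := segment_unif_continuous (- L) L cS e0.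
have [B hB] : exists B, forall x, - (2 * L) <= x <= 2 * L -> `|S x| <= B.
  have ckn : {within `[- (2 * L), 2 * L]%classic, continuous (fun x => `|S x|)}.
    apply: continuous_subspaceT => x; apply: cvg_norm; exact: cS.
  have [|z _ hz] := EVT_max _ ckn; first by rewrite ge0_cp// mulr_ge0// ltW.
  by exists `|S z| => x x01; apply: hz; rewrite in_itv.
have B0 : 0 <= B.
  by apply: (le_trans (normr_ge0 _) (hB 0 _)); rewrite oppr_le0 mulr_ge0 ?ltW.
(* The minimum with [pi] keeps [u] where the cosine decreases. *)
pose u := Num.min (c^-1 * D) pi.
have u0 : 0 < u by rewrite /u lt_min pi_gt0 mulr_gt0 ?invr_gt0.
have upi : u <= pi by rewrite /u ge_min lexx orbT.
have q0 : 0 < 1 - cos u.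
  rewrite subr_gt0 -[ltRHS]cos0 ltr_cos ?in_itv/= ?lexx ?pi_ge0 ?upi ?ltW//.
exists (2 * B / (1 - cos u)); first by rewrite divr_ge0 ?mulr_ge0// ltW.
move=> x t hx ht; have c1 := cos_le1 (c^-1 * t).
have C0 : 0 <= 2 * B / (1 - cos u) * (1 - cos (c^-1 * t)).
  by rewrite mulr_ge0 ?subr_ge0// divr_ge0 ?mulr_ge0// ltW.
have [tD|Dt] := ltP `|t| D.
  have := hD x (t + x) hx; rewrite opprD addrCA subrr addr0 normrN => /(_ tD).
  by rewrite distrC; lra.
have h1 : `|S (t + x) - S x| <= 2 * B.
  apply: (le_trans (ler_normB _ _)).
  have := hB (t + x); have := hB x; move: hx ht => /andP[? ?] /andP[? ?].
  move=> b1 b2; have := b1 ltac:(apply/andP; split; lra); have := b2 ltac:(apply/andP; split; lra); lra.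
apply: (le_trans h1); apply: ler_wpDl; first exact: ltW.
rewrite mulrAC ler_pdivlMr// ler_wpM2l ?mulr_ge0// lerD2l lerN2.
have -> : cos (c^-1 * t) = cos (c^-1 * `|t|).
  by case: (ger0P t) => // _; rewrite mulrN cosN.
have tL : `|t| <= L by rewrite ler_norml.
rewrite leNgt ltr_cos ?in_itv/= ?(ltW u0) ?upi//.
  by rewrite -leNgt /u ge_min ler_pM2l ?invr_gt0// Dt.
rewrite mulr_ge0 ?invr_ge0 ?(ltW c0)//= mulrC ler_pdivrMr// [leRHS]mulrC; exact: tL.
Qed.

Lemma Rintegral_window_le (f g : R -> R) : continuous f -> continuous g ->
  (forall t, - L <= t <= L -> `|f t| <= g t) ->
  `|\int[leb]_t (W t * f t)| <= \int[leb]_t (W t * g t).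
Proof.
move=> cf cg fg; have i1 := Rintegrable_window c cf; have i2 := Rintegrable_window c cg.
apply: (le_trans (le_normr_Rintegral _ i1)) => //.
have i3 := Rintegrable_norm i1.
apply: (le_Rintegral _ i3 i2) => // t _.
rewrite normrM ger0_norm ?window_ge0//.
have [->|/window_neq0 /andP[t1 t2]] := eqVneq (W t) 0; first by rewrite !mul0r.
by apply: ler_wpM2l; [exact: window_ge0|apply: fg; rewrite t1 ltW].
Qed.

Lemma sig_approx e : 0 < e -> exists2 C, 0 <= C & forall m x, (0 < m)%N -> - L <= x <= L ->
  `|m%:R^-1 * sig m x - 2 * L * kappa * S x| <= `|kappa| * (2 * L * e + C / m%:R).
Proof.
move=> e0; have [C C0 hC] := fejer_modulus e0.
(* The window has length [2 L] and [1 - cos] is at most 2. *)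
have L00 := ltW L0; exists (4 * L * C); first by rewrite !mulr_ge0 ?pi_ge0 ?(ltW c0).
move=> m x m0 hx; have mR : 0 < m%:R :> R by rewrite ltr0n.
have cd := @continuous_dsq R m c^-1.
have cSx : continuous (fun t => S (t + x)) by exact: continuous_shift.
have c1 : continuous (fun t => S (t + x) * dsq m (c^-1 * t)) by exact: continuousM.
have i1 := Rintegrable_window c c1; have i2 := Rintegrable_window c cd.
have cc (a : R) : continuous (fun _ : R => a) by move=> t; exact: cvg_cst.
have -> : m%:R^-1 * sig m x - 2 * L * kappa * S x =
    kappa * m%:R^-1 * \int[leb]_t (W t * ((S (t + x) - S x) * dsq m (c^-1 * t))).
  rewrite sig_fold//.
  transitivity (kappa * m%:R^-1 * \int[leb]_t (W t * (S (t + x) * dsq m (c^-1 * t)) - S x * (W t * dsq m (c^-1 * t)))).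
    rewrite RintegralB//; last exact: RintegrableZ.
    by rewrite (RintegralZ _ i2) window_dsq// -/L; field; rewrite gt_eqF.
  by congr (_ * _); apply: eq_Rintegral => t _; ring.
rewrite normrM normrM -mulrA ler_wpM2l// gtr0_norm ?invr_gt0// ler_pdivrMl//.
have cq (a : R) : continuous (fun t => cos (a * (c^-1 * t))) by exact: continuous_cos_scale.
have cg : continuous (fun t => (e + C * (1 - cos (c^-1 * t))) * dsq m (c^-1 * t)).
  apply: continuousM => // t; apply: cvgD; first exact: cvg_cst.
  apply: cvgM; first exact: cvg_cst; apply: cvgB; first exact: cvg_cst.
  exact: continuous_cos_mul.
apply: (@le_trans _ _ (\int[leb]_t (W t * ((e + C * (1 - cos (c^-1 * t))) * dsq m (c^-1 * t))))).
  apply: Rintegral_window_le => //.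
    apply: continuousM => // t; apply: cvgB; [exact: cSx|exact: cvg_cst].
  move=> t ht; rewrite normrM (ger0_norm (dsq_ge0 _ _)) ler_wpM2r ?dsq_ge0//.
  exact: hC.
have i3 := Rintegrable_window c (cq m%:R).
have i4 := Rintegrable_window c (cc 1).
have -> : \int[leb]_t (W t * ((e + C * (1 - cos (c^-1 * t))) * dsq m (c^-1 * t))) =
   \int[leb]_t (e * (W t * dsq m (c^-1 * t)) + (C * (W t * 1) - C * (W t * cos (m%:R * (c^-1 * t))))).
  apply: eq_Rintegral => t _; have := dsq_cos m (c^-1 * t) => h.
  transitivity (e * (W t * dsq m (c^-1 * t)) + C * W t * ((1 - cos (c^-1 * t)) * dsq m (c^-1 * t))); first by ring.
  by rewrite h; ring.
rewrite RintegralD//; [|exact: RintegrableZ|by apply: RintegrableB; exact: RintegrableZ].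
rewrite RintegralB//; [|exact: RintegrableZ|exact: RintegrableZ].
rewrite !RintegralZ// window_dsq// window_cst//.
have : `|\int[leb]_t (W t * cos (m%:R * (c^-1 * t)))| <= \int[leb]_t (W t * 1).
  by apply: Rintegral_window_le => // t _; exact: normr_cos_le1.
rewrite window_cst// mulr1 ler_norml => /andP[h _].
rewrite [leRHS](_ : _ = 2 * L * e * m%:R + 4 * L * C); last by field; rewrite gt_eqF.
have : C * (2 * L) - C * \int[leb]_t (W t * cos (m%:R * (c^-1 * t))) <= 4 * L * C.
  rewrite -mulrBr [leRHS]mulrC ler_wpM2l//; move: h; rewrite -/L => h; lra.
by rewrite -/L; lra.
Qed.

(** Expanding one of the two factors [four] as an integral turns the sum of squares into [kappa]
    times the integral of [H * sig m]. Since [sig m] is periodic this folds to [S * sig m] on the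
    window, where [sig m / m] is uniformly close to [2 L kappa S]. *)
Lemma fejer_limit e : 0 < e -> exists C, forall m, (0 < m)%N ->
  `|m%:R^-1 * (\sum_(k < m) \sum_(l < m) four (k%:R - l%:R) ^+ 2) -
    2 * L * kappa ^+ 2 * \int[leb]_(t in `[- L, L]) S t ^+ 2| <= e + C / m%:R.
Proof.
move=> e0.
have [B hB] : exists B, forall x, - L <= x <= L -> `|S x| <= B.
  have ckn : {within `[- L, L]%classic, continuous (fun x => `|S x|)}.
    apply: continuous_subspaceT => x; apply: cvg_norm; exact: cS.
  have [|z _ hz] := EVT_max _ ckn; first by rewrite ge0_cp// ltW.
  by exists `|S z| => x x01; apply: hz; rewrite in_itv.
have B0 : 0 <= B.
  by apply: (le_trans (normr_ge0 _) (hB 0 _)); rewrite oppr_le0 ltW.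
pose K := kappa ^+ 2 * (2 * L * B).
have L00 := ltW L0; have K0 : 0 <= K by apply: mulr_ge0; [exact: sqr_ge0|do 2 apply: mulr_ge0 => //].
(* Chosen so that [K * (2 L e1) <= e], with [K + 1] because [K] may be 0. *)
pose e1 := e / ((K + 1) * (2 * L)).
have K1 : 0 < K + 1 by lra.
have e10 : 0 < e1 by rewrite /e1; apply: divr_gt0 => //; do 2 apply: mulr_gt0 => //.
have [C C0 hC] := sig_approx e10.
exists (K * C) => m m0; have mR : 0 < m%:R :> R by rewrite ltr0n.
have csig : continuous (sig m).
  apply: continuous_sumr => k; apply: continuous_sumr => l t.
  apply: cvgM; [exact: cvg_cst|exact: continuous_cos_scale].
have cSs : continuous (fun t => S t * sig m t) by exact: continuousM.
have cSS : continuous (fun t => S t * S t) by exact: continuousM.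
have E1 : \sum_(k < m) \sum_(l < m) four (k%:R - l%:R) ^+ 2 =
    kappa * \int[leb]_t (W t * (S t * sig m t)).
  have HA' x : A + L < `|x| -> H x = 0 by move=> h; apply: HA; have := L0; lra.
  have per t : sig m (t + 2 * L) = sig m t.
    apply: eq_bigr => k _; apply: eq_bigr => l _; congr (_ * _).
    have -> : c^-1 * (t + 2 * L) = c^-1 * t + 2 * pi by rewrite /L; field; rewrite gt_eqF.
    have [kl|lk] := leqP k l.
      rewrite -(opprB l%:R) -natrB// mulNr cosN mulNr cosN mulrDr.
      by rewrite (_ : (l - k)%:R * (2 * pi) = 2 * (l - k)%:R * pi) ?cos_periodic_nat//; ring.
    have {}lk := ltnW lk; rewrite -natrB// mulrDr.
    by rewrite (_ : (k - l)%:R * (2 * pi) = 2 * (k - l)%:R * pi) ?cos_periodic_nat//; ring.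
  rewrite -(@fold_Rintegral _ c c0 (A + L) H (sig m) N)//.
  transitivity (kappa * \int[leb]_x \sum_(k < m) \sum_(l < m)
      four (k%:R - l%:R) * (H x * cos ((k%:R - l%:R) * (c^-1 * x)))).
    have ic (x : R) := Rintegrable_supp (@continuous_cos_scale x c^-1).
    rewrite Rintegral_sum; last by move=> k _; apply: Rintegrable_sum => l _; exact: RintegrableZ.
    rewrite mulr_sumr; apply: eq_bigr => k _.
    rewrite Rintegral_sum; last by move=> l _; exact: RintegrableZ.
    rewrite mulr_sumr; apply: eq_bigr => l _.
    by rewrite RintegralZ// expr2 {2}/four; ring.
  congr (_ * _); apply: eq_Rintegral => x _; rewrite /sig mulr_sumr; apply: eq_bigr => k _.
  by rewrite mulr_sumr; apply: eq_bigr => l _; ring.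
have -> : \int[leb]_(t in `[- L, L]) S t ^+ 2 = \int[leb]_t (W t * (S t * S t)).
  by rewrite Rintegral_window.
have i1 := Rintegrable_window c cSs; have i2 := Rintegrable_window c cSS.
rewrite E1.
have -> : m%:R^-1 * (kappa * \int[leb]_t (W t * (S t * sig m t))) -
    2 * L * kappa ^+ 2 * \int[leb]_t (W t * (S t * S t)) =
   kappa * \int[leb]_t (W t * (S t * (m%:R^-1 * sig m t - 2 * L * kappa * S t))).
  transitivity (kappa * \int[leb]_t (m%:R^-1 * (W t * (S t * sig m t)) - 2 * L * kappa * (W t * (S t * S t)))).
    rewrite RintegralB//; [|exact: RintegrableZ|exact: RintegrableZ].
    by rewrite !RintegralZ//; ring.
  by congr (_ * _); apply: eq_Rintegral => t _; ring.
pose q := B * (`|kappa| * (2 * L * e1 + C / m%:R)).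
have cc (a : R) : continuous (fun _ : R => a) by move=> t; exact: cvg_cst.
have h : `|\int[leb]_t (W t * (S t * (m%:R^-1 * sig m t - 2 * L * kappa * S t)))| <= 2 * L * q.
  rewrite -[leRHS](window_cst c0); apply: Rintegral_window_le => //.
    apply: continuousM => // t; apply: cvgB; apply: cvgM; try exact: cvg_cst.
      exact: csig.
    exact: cS.
  by move=> t ht; rewrite normrM /q ler_pM//; [exact: hB|exact: hC].
rewrite normrM; apply: (le_trans (ler_wpM2l (normr_ge0 kappa) h)).
have -> : `|kappa| * (2 * L * q) = K * (2 * L * e1 + C / m%:R).
  by rewrite /q /K -(real_normK (num_real kappa)); ring.
have -> : K * (2 * L * e1 + C / m%:R) = K * (2 * L * e1) + K * C / m%:R by ring.
rewrite lerD2r.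
have -> : K * (2 * L * e1) = K * (e / (K + 1)).
  by rewrite /e1; field; rewrite (gt_eqF K1) (gt_eqF L0).
by rewrite mulrCA ler_piMr ?(ltW e0)// ler_pdivrMr//; lra.
Qed.
End fejer.

(** * Toeplitz covariance matrices *)

Section spectral_norm.
Context (R : realType) (n : nat) (G : 'I_n -> 'I_n -> R) (M : R).
Hypothesis M0 : 0 < M.
Hypothesis Gsym : forall i j, G i j = G j i.
Hypothesis Gpos : forall u, 0 <= qform G u.
Hypothesis GM : forall u, qform G u <= M * \sum_k u k ^+ 2.

Let ap (u : 'I_n -> R) (l : 'I_n) := \sum_k G l k * u k.

Lemma qform_sub u w (t : R) : qform G (fun i => u i - t * w i) =
  qform G u - 2 * t * (\sum_k w k * ap u k) + t ^+ 2 * qform G w.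
Proof.
have e : \sum_k w k * ap u k = \sum_k \sum_l u k * w l * G k l.
  rewrite exchange_big/=; apply: eq_bigr => k _; rewrite mulr_sumr; apply: eq_bigr => l _.
  by rewrite (Gsym k l); ring.
have e' : \sum_k w k * ap u k = \sum_k \sum_l w k * u l * G k l.
  by apply: eq_bigr => k _; rewrite mulr_sumr; apply: eq_bigr => l _; ring.
have -> : 2 * t * (\sum_k w k * ap u k) = t * (\sum_k w k * ap u k) + t * (\sum_k w k * ap u k) by ring.
rewrite {1}e e' /qform !mulr_sumr -!big_split/= -sumrB -big_split/=; apply: eq_bigr => k _.
by rewrite !mulr_sumr -!big_split/= -sumrB -big_split/=; apply: eq_bigr => l _; ring.
Qed.

(* Positivity of the form at u - M^-1 G u. *)
Lemma sqr_norm_ap_le u : \sum_k ap u k ^+ 2 <= M ^+ 2 * \sum_k u k ^+ 2.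
Proof.
have h := Gpos (fun i => u i - M^-1 * ap u i).
rewrite qform_sub in h; set s := \sum_k ap u k ^+ 2.
have e : \sum_k ap u k * ap u k = s by apply: eq_bigr => k _; rewrite expr2.
rewrite e in h; have h1 := GM (ap u); rewrite -/s in h1; have h2 := GM u.
have h3 : M^-1 ^+ 2 * qform G (ap u) <= M^-1 * s.
  have -> : M^-1 * s = M^-1 ^+ 2 * (M * s) by field; rewrite gt_eqF.
  by rewrite ler_wpM2l ?sqr_ge0.
have h4 : M^-1 * s <= qform G u by lra.
rewrite expr2 -mulrA -ler_pdivrMl//; exact: le_trans h4 h2.
Qed.

(** [tr G^4] is the sum of the squared norms of the images under [G] of its own columns, and the
    squared norms of the columns add up to [frob2 G]. *)
Lemma quartic_le : quartic G <= M ^+ 2 * frob2 G.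
Proof.
have -> : quartic G = \sum_a \sum_l ap (fun k => G k a) l ^+ 2.
  rewrite /quartic (eq_bigr (fun k => \sum_a \sum_l \sum_b G k l * G a b * (G k a * G l b))); last first.
    by move=> k _; rewrite exchange_big.
  rewrite exchange_big; apply: eq_bigr => a _; rewrite exchange_big; apply: eq_bigr => l _.
  rewrite expr2 mulr_suml; apply: eq_bigr => k _; rewrite mulr_sumr; apply: eq_bigr => b _.
  by rewrite (Gsym l k) (Gsym b a); ring.
rewrite /frob2 [X in _ <= _ * X]exchange_big mulr_sumr; apply: ler_sum => a _.
exact: sqr_norm_ap_le.
Qed.
End spectral_norm.

(** With [x = y + e], the cross term satisfies [2 |y e| <= t y^2 + e^2 / t]. The weight [t] is left
    free, to be sent to 0 no faster than the error. *)
Lemma frob_perturb (R : realType) n (x y : 'I_n -> 'I_n -> R) (D t : R) : 0 < t ->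
  (forall k l, `|x k l - y k l| <= D) ->
  `|frob2 x - frob2 y| <= t * frob2 y + (1 + t^-1) * (n%:R ^+ 2 * D ^+ 2).
Proof.
move=> t0 xyD.
have h k l : `|x k l ^+ 2 - y k l ^+ 2| <= t * y k l ^+ 2 + (1 + t^-1) * D ^+ 2.
  have := xyD k l; set a := x k l; set b := y k l; set e := a - b => eD.
  have ae : a = b + e by rewrite /e; ring.
  have e2 : e ^+ 2 <= D ^+ 2.
    by rewrite -(real_normK (num_real e)) ler_sqr ?nnegrE// (le_trans _ eD).
  have := sqr_ge0 (t * b - e); have := sqr_ge0 (t * b + e) => p1 p2.
  have p1' : - (2 * b * e) <= t * b ^+ 2 + t^-1 * e ^+ 2.
    rewrite -subr_ge0 (_ : _ - _ = t^-1 * (t * b + e) ^+ 2); first by rewrite mulr_ge0// invr_ge0 ltW.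
    by field; rewrite gt_eqF.
  have p2' : 2 * b * e <= t * b ^+ 2 + t^-1 * e ^+ 2.
    rewrite -subr_ge0 (_ : _ - _ = t^-1 * (t * b - e) ^+ 2); first by rewrite mulr_ge0// invr_ge0 ltW.
    by field; rewrite gt_eqF.
  have q0 : t^-1 * e ^+ 2 <= t^-1 * D ^+ 2 by rewrite ler_wpM2l// invr_ge0 ltW.
  rewrite (_ : a ^+ 2 - b ^+ 2 = 2 * b * e + e ^+ 2); last by rewrite ae; ring.
  have := sqr_ge0 e; rewrite ler_norml mulrDl mul1r => e0; apply/andP; split; lra.
have -> : frob2 x - frob2 y = \sum_k \sum_l (x k l ^+ 2 - y k l ^+ 2).
  by rewrite /frob2 -sumrB; apply: eq_bigr => k _; rewrite sumrB.
apply: (le_trans (ler_norm_sum _ _ _)).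
apply: (@le_trans _ _ (\sum_(k < n) \sum_(l < n) (t * y k l ^+ 2 + (1 + t^-1) * D ^+ 2))).
  by apply: ler_sum => k _; apply: (le_trans (ler_norm_sum _ _ _)); exact: ler_sum.
under eq_bigr do rewrite big_split/= sumr_const card_ord -mulr_sumr.
rewrite big_split/= sumr_const card_ord -mulr_sumr lerD2l -mulrnA -[leLHS]mulr_natr natrM.
by rewrite le_eqVlt; apply/orP; left; apply/eqP; ring.
Qed.

Section toeplitz.
Context (R : realType).
Notation leb := (@lebesgue_measure R).

Definition toep (phi : R -> R) (theta : R) (m : nat) (k l : 'I_m) : R :=
  \int[leb]_e (phi e * cos ((k%:R - l%:R) * (theta * e))).

(** [|sum_k u_k e^(i k t)|^2], of which [dsq] is the case [u = 1]. *)
Definition trigsq (m : nat) (u : 'I_m -> R) (t : R) :=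
  \sum_k \sum_l u k * u l * cos ((k%:R - l%:R) * t).

Lemma trigsqE m (u : 'I_m -> R) t : trigsq u t =
  (\sum_k u k * cos (k%:R * t)) ^+ 2 + (\sum_k u k * sin (k%:R * t)) ^+ 2.
Proof.
rewrite !expr2 !mulr_suml -big_split/=; apply: eq_bigr => k _.
rewrite !mulr_sumr -big_split/=; apply: eq_bigr => l _.
by rewrite mulrBl cosB; ring.
Qed.

Lemma trigsq_ge0 m (u : 'I_m -> R) t : 0 <= trigsq u t.
Proof. by rewrite trigsqE addr_ge0 ?sqr_ge0. Qed.

Lemma toep_sym phi theta m (k l : 'I_m) : toep phi theta k l = toep phi theta l k.
Proof.
apply: eq_Rintegral => e _; congr (_ * _); rewrite -[LHS]cosN; congr cos; ring.
Qed.

Lemma Rintegrable_toep phi (theta x : R) : Rintegrable leb phi ->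
  Rintegrable leb (fun e => phi e * cos (x * (theta * e))).
Proof.
move=> ip; under eq_fun do rewrite mulrC.
apply: Rintegrable_bounded_mul => //; last by move=> e; exact: normr_cos_le1.
by apply: continuous_measurable; exact: continuous_cos_scale.
Qed.

Lemma toep_qform phi theta m (u : 'I_m -> R) : Rintegrable leb phi ->
  Rintegrable leb (fun e => phi e * trigsq u (theta * e)) /\
  qform (toep phi theta (m := m)) u = \int[leb]_e (phi e * trigsq u (theta * e)).
Proof.
move=> ip.
have ii (k l : 'I_m) : Rintegrable leb (fun e => u k * u l * (phi e * cos ((k%:R - l%:R) * (theta * e)))).
  by apply: RintegrableZ; exact: Rintegrable_toep.
have E : (fun e => phi e * trigsq u (theta * e)) = (fun e =>
    \sum_k \sum_l u k * u l * (phi e * cos ((k%:R - l%:R) * (theta * e)))).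
  apply/funext => e; rewrite /trigsq mulr_sumr; apply: eq_bigr => k _.
  by rewrite mulr_sumr; apply: eq_bigr => l _; ring.
rewrite E; split.
  by apply: Rintegrable_sum => k _; exact: Rintegrable_sum.
rewrite Rintegral_sum; last by move=> k _; exact: Rintegrable_sum.
apply: eq_bigr => k _; rewrite Rintegral_sum//; apply: eq_bigr => l _.
by rewrite RintegralZ//; exact: Rintegrable_toep.
Qed.

Lemma toep_qform_ge0 phi theta m (u : 'I_m -> R) : Rintegrable leb phi ->
  (forall e, 0 <= phi e) -> 0 <= qform (toep phi theta (m := m)) u.
Proof.
move=> ip p0; rewrite (toep_qform _ _ ip).2; apply: Rintegral_ge0 => // e _.
by rewrite mulr_ge0// trigsq_ge0.
Qed.

(* Enlarge [-A, A] to a window of N full periods of e |-> e^(i theta e). *)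
Lemma toep_qform_le phi theta m (u : 'I_m -> R) (A K : R) : Rintegrable leb phi ->
  0 < theta -> 0 < A -> (forall e, 0 <= phi e <= K) -> (forall e, A < `|e| -> phi e = 0) ->
  qform (toep phi theta (m := m)) u <= 2 * K * (A + pi / theta) * \sum_k u k ^+ 2.
Proof.
move=> ip th0 A0 phiK phiA.
have K0 : 0 <= K by have := phiK 0; case/andP; exact: le_trans.
pose N := (Num.trunc (theta * A / pi)).+1.
have p0 := pi_gt0 R.
have x0 : 0 <= theta * A / pi by rewrite divr_ge0 ?mulr_ge0// ltW.
have N1 : theta * A / pi < N%:R by exact: truncnS_gt.
have N2 : N%:R <= theta * A / pi + 1.
  by rewrite /N -natr1 lerD2r; have /andP[] := truncn_itv x0.
have NR : 0 < N%:R :> R by rewrite ltr0n.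
(* The window then has half-width [N pi / theta], more than [A] and at most [A + pi / theta]. *)
pose c := N%:R / theta.
have c0 : 0 < c by rewrite divr_gt0.
have cA : A < c * pi.
  move: N1; rewrite ltr_pdivrMr// => N1.
  by rewrite /c mulrAC ltr_pdivlMr// mulrC.
have cle : c * pi <= A + pi / theta.
  rewrite /c mulrAC ler_pdivrMr// mulrDl divfK ?gt_eqF//.
  have : N%:R * pi <= (theta * A / pi + 1) * pi by rewrite ler_pM2r.
  by rewrite mulrDl divfK ?gt_eqF// mul1r mulrC; lra.
have [i1 ->] := toep_qform theta u ip.
have ctr : continuous (fun e => trigsq u (theta * e)).
  apply: continuous_sumr => k; apply: continuous_sumr => l t.
  by apply: cvgM; [exact: cvg_cst|exact: continuous_cos_scale].
have i2 := Rintegrable_window c ctr.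
apply: (@le_trans _ _ (K * \int[leb]_e (window c e * trigsq u (theta * e)))).
  rewrite -RintegralZ//; have i3 := RintegrableZ K i2.
  apply: (le_Rintegral _ i1 i3) => // e _; rewrite mulrA ler_wpM2r ?trigsq_ge0//.
  have [eA|/phiA ->] := leP `|e| A; last by rewrite mulr_ge0// window_ge0.
  rewrite /window (_ : (_ <= _ < _) = true); last first.
    by move: eA; rewrite ler_norml => /andP[h1 h2]; apply/andP; split; lra.
  by rewrite mulr1; case/andP: (phiK e).
have -> : \int[leb]_e (window c e * trigsq u (theta * e)) = 2 * (c * pi) * \sum_k u k ^+ 2.
  have ci (k l : 'I_m) : Rintegrable leb (fun t => u k * u l * (window c t * cos ((k%:R - l%:R) * (theta * t)))).
    by apply: RintegrableZ; apply: Rintegrable_window; exact: continuous_cos_scale.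
  transitivity (\int[leb]_t \sum_k \sum_l u k * u l * (window c t * cos ((k%:R - l%:R) * (theta * t)))).
    apply: eq_Rintegral => t _; rewrite mulr_sumr; apply: eq_bigr => k _; rewrite mulr_sumr.
    by apply: eq_bigr => l _; ring.
  rewrite Rintegral_sum; last by move=> k _; exact: Rintegrable_sum.
  transitivity (\sum_(k < m) \sum_(l < m) (2 * (c * pi) * (u k * u l)) * (l == k)%:R).
    apply: eq_bigr => k _; rewrite Rintegral_sum//; apply: eq_bigr => l _.
    rewrite RintegralZ; last by apply: Rintegrable_window; exact: continuous_cos_scale.
    have [->|lk] := eqVneq l k.
      rewrite (_ : \int[leb]_t _ = 2 * (c * pi)); first by rewrite mulr1 mulrC.
      rewrite -[RHS]mulr1 -window_cst//; apply: eq_Rintegral => t _; by rewrite subrr mul0r cos0.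
    rewrite mulr0 (_ : \int[leb]_t _ = 0) ?mulr0//.
    have thE : theta = N%:R * c^-1 by rewrite /c; field; rewrite !gt_eqF.
    have main (p : nat) : (0 < p)%N -> \int[leb]_t (window c t * cos (p%:R * (theta * t))) = 0.
      move=> p1; rewrite -(@window_cos _ c c0 (p * N).-1); apply: eq_Rintegral => t _.
      rewrite prednK ?muln_gt0 ?p1// natrM thE; congr (_ * cos _); ring.
    have [kl|kl|kl] := ltngtP k l.
    - have kl' := ltnW kl; rewrite -(main (l - k)%N) ?subn_gt0//; apply: eq_Rintegral => t _.
      rewrite natrB//; congr (_ * _); rewrite -[LHS]cosN; congr cos; ring.
    - have kl' := ltnW kl; rewrite -(main (k - l)%N) ?subn_gt0//; apply: eq_Rintegral => t _.
      by rewrite natrB.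
    - by move: lk; rewrite -val_eqE/= kl eqxx.
  under eq_bigr do rewrite sum_delta.
  by rewrite mulr_sumr; apply: eq_bigr => k _; rewrite expr2.
set q := \sum_k _; have q0 : 0 <= q by apply: sumr_ge0 => k _; exact: sqr_ge0.
rewrite [leLHS](_ : _ = K * q * (2 * (c * pi))); last by ring.
rewrite [leRHS](_ : _ = K * q * (2 * (A + pi / theta))); last by ring.
by rewrite ler_wpM2l ?mulr_ge0// ler_wpM2l.
Qed.

(** Two errors add up: the density moves by [D H], and the phase by [|k - l| |theta - 1/c| |e|],
    where [|k - l| <= m] and [|e| <= A] on the support. *)
Lemma toep_four_dist (phi H : R -> R) (theta c kappa A D : R) m (k l : 'I_m) :
  Rintegrable leb phi -> continuous H -> (forall e, 0 <= H e) -> (forall e, A < `|e| -> H e = 0) ->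
  0 <= kappa -> 0 <= A -> (forall e, `|phi e - kappa * H e| <= D * H e) ->
  `|toep phi theta k l - four c H kappa (k%:R - l%:R)| <=
    (D + kappa * (m%:R * `|theta - c^-1| * A)) * \int[leb]_e H e.
Proof.
move=> ip cH H0 HA k0 A0 hD.
have iH := Rintegrable_compact cH HA.
have iHc (x y : R) : Rintegrable leb (fun e => H e * cos (x * (y * e))) by exact: Rintegrable_toep.
set x := k%:R - l%:R.
have xm : `|x| <= m%:R.
  rewrite ler_norml /x; have := ltnW (ltn_ord k); have := ltnW (ltn_ord l).
  rewrite -!(ler_nat R) => h1 h2; have := ler0n R k; have := ler0n R l; lra.
have -> : toep phi theta k l - four c H kappa x = \int[leb]_e
   (phi e * cos (x * (theta * e)) - kappa * (H e * cos (x * (c^-1 * e)))).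
  rewrite RintegralB//; [|exact: Rintegrable_toep|exact: RintegrableZ].
  by rewrite RintegralZ.
have i1 : Rintegrable leb (fun e => phi e * cos (x * (theta * e)) - kappa * (H e * cos (x * (c^-1 * e)))).
  by apply: RintegrableB; [exact: Rintegrable_toep|exact: RintegrableZ].
apply: (le_trans (le_normr_Rintegral _ i1)) => //.
rewrite -RintegralZ//; have i2 := Rintegrable_norm i1.
have i3 := RintegrableZ (D + kappa * (m%:R * `|theta - c^-1| * A)) iH.
apply: (le_Rintegral _ i2 i3) => // e _.
have -> : phi e * cos (x * (theta * e)) - kappa * (H e * cos (x * (c^-1 * e))) =
   (phi e - kappa * H e) * cos (x * (theta * e)) +
   kappa * H e * (cos (x * (theta * e)) - cos (x * (c^-1 * e))) by ring.
apply: (le_trans (ler_normD _ _)); rewrite [leRHS]mulrDl; apply: lerD.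
  rewrite normrM; apply: le_trans (hD e); rewrite ler_piMr// normr_cos_le1//.
have [eA|eA] := leP `|e| A; last by rewrite HA// !(mulr0, mul0r) normr0.
rewrite normrM (ger0_norm (mulr_ge0 k0 (H0 e))).
rewrite [leRHS](_ : _ = kappa * H e * (m%:R * `|theta - c^-1| * A)); last by ring.
apply: ler_wpM2l; first exact: mulr_ge0.
apply: (le_trans (normr_cosB _ _)).
by rewrite -mulrBr -mulrBl !normrM mulrA ler_pM ?mulr_ge0// ler_wpM2r.
Qed.
End toeplitz.

(** * The spectral density near frequency 0 *)

(** With [s = s0^2] and [w = s - x^2], the factor is [q = (s / w)^(2 alpha)], which lies between 1
    and [s / w] because [0 < 2 alpha < 1]. The assumption [s0 > 1] keeps [w >= s - 1 > 0] on
    [|x| <= 1], away from the singularity, and [s / w - 1 = x^2 / w]. *)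
Lemma inv_powR_quad (R : realType) (s0 alpha : R) : 1 < s0 -> 0 < alpha < 2^-1 ->
  exists2 M, 0 <= M & forall x, `|x| <= 1 -> exists q,
    [/\ `| x ^+ 2 - s0 ^+ 2 | `^ (- (2 * alpha)) = s0 `^ (- (4 * alpha)) * q,
      1 <= q, q <= M & q - 1 <= M * x ^+ 2].
Proof.
move=> s1 al; have s00 : 0 < s0 by lra.
set k := s0 `^ (- (4 * alpha)).
have k0 : 0 < k by exact: powR_gt0.
pose s := s0 ^+ 2.
have s2 : 1 < s by rewrite /s expr2; nra.
have kE : s `^ (- (2 * alpha)) = k.
  rewrite /s -powR_mulrn ?ltW// -powRrM; congr (_ `^ _).
  by rewrite -[2%:R]/(2 : R); ring.
have sk : 0 < s - 1 by lra.
exists (s / (s - 1)); first by apply: divr_ge0; lra.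
move=> x x1; have x2 : x ^+ 2 <= 1.
  by rewrite -(real_normK (num_real x)) expr_le1.
have xx := sqr_ge0 x; set z := x ^+ 2 in xx x2 *.
rewrite -/s ler0_norm ?opprB; last by lra.
set w := s - z; have w0 : 0 < w by rewrite /w; lra.
have ws : w <= s by rewrite /w; lra.
have w1 : s - 1 <= w by rewrite /w; lra.
have sw1 : 1 <= s / w by rewrite ler_pdivlMr// mul1r.
exists ((s / w) `^ (2 * alpha)); split.
- have e : s = s / w * w by rewrite divfK// gt_eqF.
  rewrite -kE {1}e powRM ?(ltW w0)//; last by rewrite (le_trans _ sw1).
  rewrite [(s / w) `^ (- _)]powRN; field; rewrite gt_eqF// powR_gt0//.
  by rewrite (lt_le_trans _ sw1).
- have a2 : 0 <= 2 * alpha by case/andP: al; lra.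
  by have := ler_powR sw1 a2; rewrite powRr0.
- apply: (@le_trans _ _ (s / w)); first by apply: ler1_powR => //; case/andP: al; lra.
  by apply: ler_wpM2l; [lra|rewrite lef_pV2 ?posrE//; lra].
- apply: (@le_trans _ _ (s / w - 1)).
    by rewrite lerD2r; apply: ler1_powR => //; case/andP: al; lra.
  have -> : s / w - 1 = z / w by rewrite /w; field; rewrite gt_eqF.
  rewrite mulrC; apply: ler_wpM2r => //.
  apply: (@le_trans _ _ (s - 1)^-1); first by rewrite lef_pV2 ?posrE//; lra.
  by rewrite ler_peMl ?invr_ge0 ?(ltW sk)//; lra.
Qed.

Section spectral_density.
Context (R : realType).
Variables (h : R -> R) (s0 alpha : R).
Hypothesis s1 : 1 < s0.
Hypothesis al : 0 < alpha < 2^-1.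
Hypothesis hN : forall x, h (- x) = h x.
Hypothesis h_ge0 : forall x, 0 <= h x.
Hypothesis hd : forall k, (k < 4)%N -> forall x, derivable (derive1n k h) x 1.
Hypothesis h1 : derive1n 1 h 0 = 0.
Hypothesis h0 : h 0 = 1.

Let der_h k x : (k < 4)%N -> is_derive (x : R) 1 (derive1n k h) (derive1n k.+1 h x).
Proof. by move=> /hd /(_ x) d; apply: (DeriveDef d); rewrite derive1nS derive1E. Qed.

(** Two uses of the mean value theorem, starting from [h 0 = 1] and [h' 0 = 0], against the maximum
    of [|h''|] on [[0, 1]]; evenness covers negative [x]. *)
Lemma derive_quad_le : exists2 C, 0 <= C & forall x, `|x| <= 1 -> `|h x - 1| <= C * x ^+ 2.
Proof.
have d0 (x : R) : is_derive x 1 h (derive1n 1 h x) := @der_h 0%N x isT.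
have d1 (x : R) : is_derive x 1 (derive1n 1 h) (derive1n 2 h x) := @der_h 1%N x isT.
have c2 : continuous (derive1n 2 h).
  by apply: (@der_continuous _ _ (derive1n 3 h)) => x; exact: der_h.
have ckn : {within `[0, 1]%classic, continuous (fun x => `|derive1n 2 h x|)}.
  apply: continuous_subspaceT => x; apply: cvg_norm; exact: c2.
have [z _ hz] := EVT_max ler01 ckn.
exists `|derive1n 2 h z| => // x; wlog x0 : x / 0 <= x => [H|].
  have [/H//|x0] := leP 0 x; rewrite -normrN -hN -sqrrN; apply: H; first by lra.
rewrite ger0_norm// => x1.
have [y /andP[y0 yx] e1] := der_mvt d0 x0; rewrite h0 subr0 in e1; rewrite e1.
have [t /andP[t0 ty] e2] := der_mvt d1 y0; rewrite h1 !subr0 in e2; rewrite e2.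
have tz : `|derive1n 2 h t| <= `|derive1n 2 h z|.
  by apply: hz; rewrite in_itv/=; apply/andP; split; lra.
move: (derive1n 2 h t) (derive1n 2 h z) tz => D E DE.
rewrite normrM normrM (ger0_norm x0) (ger0_norm y0) expr2 mulrA; apply: ler_wpM2r => //.
exact: ler_pM.
Qed.

Local Notation f := (spec_dens h s0 alpha).

Lemma spec_densE l : f l = h l * `| l ^+ 2 - s0 ^+ 2 | `^ (- (2 * alpha)).
Proof. by rewrite /spec_dens powRN. Qed.

Lemma spec_dens_ge0 l : 0 <= f l.
Proof. by rewrite spec_densE mulr_ge0// powR_ge0. Qed.

Lemma measurable_spec_dens : measurable_fun [set: R] f.
Proof.
have -> : f = (fun l => h l * `| l ^+ 2 - s0 ^+ 2 | `^ (- (2 * alpha))).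
  by apply/funext => l; exact: spec_densE.
apply: measurable_funM.
  apply: continuous_measurable; apply: (@der_continuous _ _ (derive1n 1 h)) => x.
  exact: (@der_h 0%N).
apply: (@measurableT_comp _ _ _ _ _ _ (@powR R ^~ (- (2 * alpha)))); first exact: measurable_powR.
apply: measurableT_comp => //; apply: continuous_measurable => x.
apply: cvgB; last exact: cvg_cst.
by under eq_fun do rewrite expr2; rewrite expr2; apply: cvgM; exact: cvg_id.
Qed.

Lemma spec_dens_quad : exists2 C, 0 <= C & forall x, `|x| <= 1 ->
  `|f x - s0 `^ (- (4 * alpha))| <= C * x ^+ 2.
Proof.
have [C C0 hC] := derive_quad_le.
have [M M0 hM] := inv_powR_quad s1 al.
set k := s0 `^ (- (4 * alpha)); have k0 : 0 <= k by exact: powR_ge0.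
exists (C * (k * M) + k * M); first by rewrite addr_ge0 ?mulr_ge0.
move=> x x1; rewrite spec_densE; have [q [-> q1 qM qx]] := hM x x1.
have q0 : 0 <= q := le_trans ler01 q1.
rewrite -/k (_ : h x * (k * q) - k = (h x - 1) * (k * q) + k * (q - 1)); last by ring.
apply: (le_trans (ler_normD _ _)); rewrite normrM [`|k * (q - 1)|]normrM (ger0_norm k0).
rewrite (ger0_norm (mulr_ge0 k0 q0)) (ger0_norm (_ : 0 <= q - 1)) ?subr_ge0//.
rewrite mulrDl; apply: lerD.
  rewrite [leRHS](_ : _ = C * x ^+ 2 * (k * M)); last by ring.
  by apply: ler_pM => //; [exact: mulr_ge0|exact: hC|exact: ler_wpM2l].
by rewrite -mulrA ler_wpM2l.
Qed.
End spectral_density.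

(** * Covariance of the wavelet coefficients *)

Section wavelet_vector.
Context (R : realType) d (T : measurableType d) (P : probability T R).
Notation leb := (@lebesgue_measure R).
Variables (X : R -> T -> R) (F : R -> R).
Hypothesis mX : measurable_fun [set: R * T] (fun p : R * T => X p.1 p.2).
Hypothesis gX : gaussian_process P X.
Hypothesis EX : forall t, ('E_P[X t] = 0)%E.
Hypotheses (mF : measurable_fun [set: R] F) (F0 : forall l, 0 <= F l).
Hypothesis covX : forall t s, ('E_P[fun w => (X t w * X s w)%R] =
     \int[leb]_(l in [set: R]) (cos (l * (t - s)) * F l)%R%:E)%E.
Hypothesis msX : forall t, ('E_P[fun w => ((X s w - X t w) ^+ 2)%R] @[s --> t] --> 0%E)%E.
Variable psi : R -> R.
Hypothesis ipsi : Rintegrable leb psi.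
Variables (a : nat -> R) (b : nat -> int -> R) (j : nat) (g : R).
Hypothesis a0 : 0 < a j.
Hypothesis bg : forall k l : int, b j k - b j l = g * (k - l)%:~R.

Let dil (k : int) (t : R) : R := psi ((t - b j k) / a j).

Lemma Rintegrable_dil k : Rintegrable leb (dil k).
Proof.
have n0 : (a j)^-1 != 0 by rewrite invr_eq0 gt_eqF.
have := Rintegrable_affine (- b j k / a j) n0 ipsi.
by congr (Rintegrable _ _); apply/funext => t; rewrite /dil; congr psi; rewrite mulrDl mulrC.
Qed.

(** In complex form the transform of the dilated and translated wavelet is
    [a e^(- i l b) psihat (a l)]; the two equations are its real and, up to sign, imaginary
    parts. *)
Lemma FT_dil k l :
  FTre (dil k) l = a j * (cos (l * b j k) * FTre psi (a j * l) - sin (l * b j k) * FTim psi (a j * l)) /\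
  FTim (dil k) l = a j * (sin (l * b j k) * FTre psi (a j * l) + cos (l * b j k) * FTim psi (a j * l)).
Proof.
have n0 : a j != 0 by rewrite gt_eqF.
have ic (x : R) : Rintegrable leb (fun t => cos (x * t) * psi t).
  apply: Rintegrable_bounded_mul => //; last by move=> t; exact: normr_cos_le1.
  by apply: continuous_measurable; exact: continuous_cos_mul.
have is_ (x : R) : Rintegrable leb (fun t => sin (x * t) * psi t).
  apply: Rintegrable_bounded_mul => //; last by move=> t; exact: normr_sin_le1.
  by apply: continuous_measurable; exact: continuous_sin_mul.
have i1 : Rintegrable leb (fun t => cos (l * t) * dil k t).
  apply: Rintegrable_bounded_mul; [exact: Rintegrable_dil| |by move=> t; exact: normr_cos_le1].
  by apply: continuous_measurable; exact: continuous_cos_mul.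
have i2 : Rintegrable leb (fun t => sin (l * t) * dil k t).
  apply: Rintegrable_bounded_mul; [exact: Rintegrable_dil| |by move=> t; exact: normr_sin_le1].
  by apply: continuous_measurable; exact: continuous_sin_mul.
have dE s : dil k (a j * s + b j k) = psi s by rewrite /dil addrK mulrC mulKf.
have aE (q : R -> R) : Rintegrable leb q -> \int[leb]_t q t = a j * \int[leb]_s q (a j * s + b j k).
  by move=> iq; rewrite (Rintegral_affine _ n0 iq) gtr0_norm// mulVKf.
rewrite /FTre /FTim /RintR; split; rewrite aE//; congr (_ * _).
  rewrite -!RintegralZ// -RintegralB//; [|exact: RintegrableZ|exact: RintegrableZ].
  apply: eq_Rintegral => s _; rewrite dE.
  by rewrite (_ : l * (a j * s + b j k) = l * b j k + a j * l * s) ?cosD; ring.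
rewrite -!RintegralZ// -RintegralD//; [|exact: RintegrableZ|exact: RintegrableZ].
apply: eq_Rintegral => s _; rewrite dE.
by rewrite (_ : l * (a j * s + b j k) = l * b j k + a j * l * s) ?sinD; ring.
Qed.

Variable m : nat.
Let r := (Num.sqrt (a j))^-1.
Let r2 : r ^+ 2 = (a j)^-1.
Proof. by rewrite /r exprVn sqr_sqrtr// ltW. Qed.
Let ker (u : 'I_m -> R) (t : R) := \sum_k u k * (r * dil (Posz k.+1) t).

Lemma Rintegrable_ker u : Rintegrable leb (ker u).
Proof. by apply: Rintegrable_sum => k _; do 2 apply: RintegrableZ; exact: Rintegrable_dil. Qed.

(** The squared modulus sees the [b j k] only through their differences, which [bg] makes multiples
    of [k - l]: this is why the covariance is Toeplitz. *)
Lemma FTabs2_ker u l : FTabs2 (ker u) l = a j * trigsq u (g * l) * FTabs2 psi (a j * l).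
Proof.
have lin (q : R -> R) : measurable_fun [set: R] q -> (forall x, `|q x| <= 1) ->
    \int[leb]_t (q t * ker u t) = \sum_k u k * (r * \int[leb]_t (q t * dil (Posz k.+1) t)).
  move=> mq q1; have iq k : Rintegrable leb (fun t => q t * dil (Posz k.+1) t).
    by apply: Rintegrable_bounded_mul => //; exact: Rintegrable_dil.
  transitivity (\int[leb]_t \sum_k u k * (r * (q t * dil (Posz k.+1) t))).
    by apply: eq_Rintegral => t _; rewrite mulr_sumr; apply: eq_bigr => k _; ring.
  rewrite Rintegral_sum; last by move=> k _; do 2 apply: RintegrableZ.
  by apply: eq_bigr => k _; rewrite RintegralZ ?RintegralZ//; exact: RintegrableZ.
rewrite /FTabs2 {1}/FTre {1}/FTim /RintR !lin; try by move=> t; rewrite ?normr_cos_le1 ?normr_sin_le1.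
- rewrite (eq_bigr (fun k => u k * (r * FTre (dil (Posz k.+1)) l)))//.
  rewrite [in X in _ + X](eq_bigr (fun k => u k * (r * FTim (dil (Posz k.+1)) l)))//.
  set C := FTre psi (a j * l); set S := FTim psi (a j * l).
  pose p := \sum_(k < m) u k * cos (l * b j (Posz k.+1)).
  pose q := \sum_(k < m) u k * sin (l * b j (Posz k.+1)).
  have -> : \sum_(k < m) u k * (r * FTre (dil (Posz k.+1)) l) = r * a j * (p * C - q * S).
    rewrite /p /q !mulr_suml -sumrB mulr_sumr; apply: eq_bigr => k _.
    by rewrite (FT_dil _ _).1 -/C -/S; ring.
  have -> : \sum_(k < m) u k * (r * FTim (dil (Posz k.+1)) l) = r * a j * (q * C + p * S).
    rewrite /p /q !mulr_suml -big_split mulr_sumr; apply: eq_bigr => k _.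
    by rewrite (FT_dil _ _).2 -/C -/S /=; ring.
  have -> : trigsq u (g * l) = p ^+ 2 + q ^+ 2.
    rewrite !expr2 {1}/p {1}/q !mulr_suml -big_split/=; apply: eq_bigr => k _.
    rewrite /p /q !mulr_sumr -big_split/=; apply: eq_bigr => i _.
    have e := bg (Posz k.+1) (Posz i.+1).
    have -> : (k%:R - i%:R) * (g * l) = l * b j (Posz k.+1) - l * b j (Posz i.+1).
      rewrite -mulrBr e (_ : (Posz k.+1 - Posz i.+1)%:~R = (k%:R - i%:R : R)); first by ring.
      by rewrite rmorphB/= -!pmulrn -!natr1; ring.
    by rewrite cosB; ring.
  transitivity ((r ^+ 2 * a j) * a j * ((p ^+ 2 + q ^+ 2) * (C ^+ 2 + S ^+ 2))); first by ring.
  by rewrite r2 mulVf ?gt_eqF//; ring.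
- by apply: continuous_measurable; exact: continuous_sin_mul.
- by apply: continuous_measurable; exact: continuous_cos_mul.
Qed.

Let phi (e : R) := F ((a j)^-1 * e) * FTabs2 psi e.
Let theta := g / a j.

Lemma Rintegrable_phi : Rintegrable leb phi.
Proof.
have iF := Rintegrable_spectral mX gX EX mF F0 covX.
have n0 : (a j)^-1 != 0 by rewrite invr_eq0 gt_eqF.
have i1 := Rintegrable_affine 0 n0 iF.
have := i1; under eq_fun do rewrite addr0; move=> i2.
apply: (le_Rintegrable _ _ (RintegrableZ (2 * (\int[leb]_x `|psi x|) ^+ 2) i2)).
  apply: measurable_funM; first exact: Rintegrable_measurable i2.
  by apply: continuous_measurable; exact: continuous_FTabs2.
move=> e; rewrite /phi normrM (ger0_norm (F0 _)) (ger0_norm (FTabs2_ge0 _ _)) mulrC.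
by apply: ler_wpM2r => //; exact: le_FTabs2.
Qed.

(** The factor [a j] of [FTabs2_ker] is the Jacobian of the rescaled frequency [e = a l]. *)
Lemma ker_variance u :
  \int[leb]_l (F l * FTabs2 (ker u) l) = qform (toep phi theta (m := m)) u.
Proof.
have [i1 ->] := toep_qform theta u Rintegrable_phi.
have n0 : a j != 0 by rewrite gt_eqF.
have := Rintegral_affine 0 n0 i1; rewrite (gtr0_norm a0) => e.
have -> : \int[leb]_e (phi e * trigsq u (theta * e)) =
   a j * \int[leb]_x (phi (a j * x + 0) * trigsq u (theta * (a j * x + 0))).
  by rewrite e mulVKf.
have i2 := Rintegrable_affine 0 n0 i1.
rewrite -RintegralZ//; apply: eq_Rintegral => l _.
rewrite FTabs2_ker /phi addr0 mulKf// (_ : theta * (a j * l) = g * l); last by rewrite /theta; field.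
ring.
Qed.

(** A linear form in the coefficients is the integral of the process against the single kernel
    [ker u], to which [process_integral_gaussian] applies. The equality holds almost surely, on the
    finite intersection of the events where the separate integrals converge. *)
Lemma wavelet_gaussian_vec :
  gaussian_vec P (fun i : 'I_m => wcoef psi X a b j (Posz i.+1)) (toep phi theta (m := m)).
Proof.
have iX t : Rintegrable P (X t) by case: (process_marginal mX gX EX t).
have nX := process_norm_le mX gX EX covX.
have K (k : 'I_m) := kernel_integral (Rintegrable_dil (Posz k.+1)) mX iX nX.
have mW (k : 'I_m) : measurable_fun setT (wcoef psi X a b j (Posz k.+1)).
  have [_ mI _ _ _] := K k.
  apply: measurable_funM => //.
have lE u : {ae P, forall w, lin (fun i : 'I_m => wcoef psi X a b j (Posz i.+1)) u w =
    RintR (fun t => ker u t * X t w)}.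
  have all : {ae P, forall w, forall k : 'I_m, Rintegrable leb (fun t => dil (Posz k.+1) t * X t w)}.
    by apply: filter_forall => k; have [] := K k.
  apply: filterS all => w iw.
  rewrite /RintR (_ : \int[leb]_t _ = \int[leb]_t \sum_k u k * (r * (dil (Posz k.+1) t * X t w))).
    rewrite Rintegral_sum; last by move=> k _; do 2 apply: RintegrableZ.
    by apply: eq_bigr => k _; rewrite RintegralZ ?RintegralZ//; exact: RintegrableZ.
  by apply: eq_Rintegral => t _; rewrite /ker mulr_suml; apply: eq_bigr => k _; ring.
have mZ u : measurable_fun setT (fun w => RintR (fun t => ker u t * X t w)).
  by have [] := kernel_integral (Rintegrable_ker u) mX iX nX.
have ml u : measurable_fun setT (lin (fun i : 'I_m => wcoef psi X a b j (Posz i.+1)) u).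
  by apply: measurable_sum => k; exact: measurable_funM.
have gz u := process_integral_gaussian mX gX EX mF F0 covX msX (Rintegrable_ker u).
split => //.
- by move=> k l; exact: toep_sym.
- move=> u; apply: toep_qform_ge0; first exact: Rintegrable_phi.
  by move=> e; rewrite mulr_ge0// FTabs2_ge0.
- move=> u; rewrite -ker_variance -(gz u).1; apply: ae_eq_Rintegral.
  + by apply: bmI; exact: bm_cos.
  + by apply: bmI; exact: bm_cos.
  + by apply: filterS (lE u) => w ->.
- move=> u; rewrite -(gz u).2; apply: ae_eq_Rintegral.
  + by apply: bmI; exact: bm_sin.
  + by apply: bmI; exact: bm_sin.
  + by apply: filterS (lE u) => w ->.
Qed.
End wavelet_vector.

Section sequences.
Context (R : realType).
Implicit Types (u v : nat -> R).

Lemma cvgn_squeeze_from u v (l : R) (N : nat) : (forall n, (N <= n)%N -> `|u n - l| <= v n) ->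
  v n @[n --> \oo] --> 0 -> u n @[n --> \oo] --> l.
Proof.
move=> h /cvgrPdist_le v0; apply/cvgrPdist_le => e e0.
have [N1 _ hv] := v0 e e0; exists (maxn N N1) => // n /=; rewrite geq_max => /andP[nN nN1].
have := hv n nN1; rewrite /= sub0r normrN => hn.
by rewrite distrC (le_trans (h n nN))// (le_trans (ler_norm _)).
Qed.

Lemma unbounded_homo_from (m : nat -> nat) : {homo m : i j / (i <= j)%N >-> (i <= j)%N} ->
  (forall n, exists j, (n <= m j)%N) -> forall n, exists N, forall j, (N <= j)%N -> (n <= m j)%N.
Proof. by move=> hm um n; have [N h] := um n; exists N => j /hm; exact: leq_trans. Qed.

Lemma unbounded_incr_from u : (forall i j, (i < j)%N -> u i < u j) ->
  (forall M, exists j, M < u j) -> forall M, exists N, forall j, (N <= j)%N -> M < u j.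
Proof.
move=> hu uu M; have [N h] := uu M; exists N => j; rewrite leq_eqVlt => /orP[/eqP <-//|/hu].
exact: lt_trans.
Qed.
End sequences.

(** * The normalised variance and the theorem *)

Section covariance_limits.
Context (R : realType).
Notation leb := (@lebesgue_measure R).
Variables (c : R) (H : R -> R) (A kappa : R) (F : R -> R) (a g : nat -> R) (m : nat -> nat) (C : R) (N : nat).
Hypothesis c0 : 0 < c.
Hypothesis A0 : 0 < A.
Hypothesis k0 : 0 <= kappa.
Hypothesis C0 : 0 <= C.
Hypothesis cH : continuous H.
Hypothesis HN : forall x, H (- x) = H x.
Hypothesis H0 : forall x, 0 <= H x.
Hypothesis HA : forall x, A < `|x| -> H x = 0.
Hypothesis AN : A + c * pi < (2 * N%:R - 1) * (c * pi).
Hypothesis F0 : forall x, 0 <= F x.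
Hypothesis FC : forall x, `|x| <= 1 -> `|F x - kappa| <= C * x ^+ 2.
Hypothesis a0 : forall j, 0 < a j.
Hypothesis a_oo : forall M, exists N, forall j, (N <= j)%N -> M < a j.
Hypothesis g0 : forall j, 0 < g j.
Hypothesis m0 : forall j, (0 < m j)%N.
Hypothesis m_oo : forall n, exists N, forall j, (N <= j)%N -> (n <= m j)%N.
Hypothesis ag : a j / g j @[j --> \oo] --> c.
Hypothesis mg : (m j)%:R ^+ 2 * (g j / a j - c^-1) @[j --> \oo] --> 0.
Hypothesis ma : (m j)%:R / a j ^+ 4 @[j --> \oo] --> 0.
Let phi j (e : R) := F ((a j)^-1 * e) * H e.
Hypothesis iphi : forall j, Rintegrable leb (phi j).
Let th j := g j / a j.
Let G j := toep (phi j) (th j) (m := m j).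
Let IH := \int[leb]_e H e.
Let V := 2 * (c * pi) * kappa ^+ 2 * \int[leb]_(t in `[- (c * pi), c * pi]) shiftsum c N H t ^+ 2.
(** A bound on [sqrt m] times the entrywise error; the first term is small by [ma], the second by
    [mg]. *)
Let w j := (C * A ^+ 2 * Num.sqrt ((m j)%:R / a j ^+ 4) +
   kappa * A * `|(m j)%:R ^+ 2 * (g j / a j - c^-1)|) * IH.
Let y j (k l : 'I_(m j)) := four c H kappa (k%:R - l%:R).
Let mR j : 0 < (m j)%:R :> R. Proof. by rewrite ltr0n. Qed.
Let IH0 : 0 <= IH. Proof. by apply: Rintegral_ge0 => // x _. Qed.

(** Once [a j > A], the support of [H] is rescaled into [[-1, 1]], where [FC] applies; hence the
    restriction to large [j]. *)
Lemma phi_dist : exists N1, forall j, (N1 <= j)%N -> forall e,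
  `|phi j e - kappa * H e| <= C * A ^+ 2 / a j ^+ 2 * H e.
Proof.
have [N1 h1] := a_oo A; exists N1 => j /h1 aA e.
have [eA|eA] := leP `|e| A; last by rewrite /phi HA// !mulr0 subrr normr0.
rewrite /phi -mulrBl normrM (ger0_norm (H0 e)); apply: ler_wpM2r => //.
have aj := a0 j; have e2 : e ^+ 2 <= A ^+ 2.
  by rewrite -(real_normK (num_real e)) ler_sqr ?nnegrE// ltW.
apply: (le_trans (FC _)).
  rewrite normrM normfV (gtr0_norm aj) mulrC ler_pdivrMr// mul1r.
  by rewrite (le_trans eA)// ltW.
rewrite [leLHS](_ : _ = C * (a j)^-1 ^+ 2 * e ^+ 2); last by ring.
rewrite [leRHS](_ : _ = C * (a j)^-1 ^+ 2 * A ^+ 2); last by rewrite exprVn; ring.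
by rewrite ler_wpM2l// mulr_ge0// sqr_ge0.
Qed.

Lemma toep_dist : exists N1, forall j, (N1 <= j)%N -> forall k l,
  Num.sqrt (m j)%:R * `|G k l - y (j := j) k l| <= w j.
Proof.
have [N1 h1] := phi_dist; exists N1 => j /h1 hphi k l.
have := toep_four_dist (th j) c k l (iphi j) cH H0 HA k0 (ltW A0) hphi.
rewrite -/IH -/(G k l) -/(y k l) => h.
have s0 := sqrtr_ge0 ((m j)%:R : R).
apply: (le_trans (ler_wpM2l s0 h)); rewrite mulrA ler_wpM2r// mulrDr; apply: lerD.
  have -> : Num.sqrt ((m j)%:R / a j ^+ 4) = Num.sqrt (m j)%:R / a j ^+ 2.
    rewrite sqrtrM ?ler0n// -exprVn (_ : (a j)^-1 ^+ 4 = ((a j)^-1 ^+ 2) ^+ 2); last by ring.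
    by rewrite sqrtr_sqr ger0_norm ?sqr_ge0// exprVn.
  by rewrite le_eqVlt; apply/orP; left; apply/eqP; ring.
rewrite normrM (ger0_norm (sqr_ge0 _)) -/(th j).
(* This turns [sqrt m * m], with one factor from the normalisation and one from the largest lag,
   into the [m^2] of [mg]. *)
have sm : Num.sqrt (m j)%:R <= (m j)%:R :> R.
  rewrite -[leRHS]sqr_sqrtr ?ler0n// expr2 ler_peMl//.
  have : Num.sqrt 1 <= Num.sqrt (m j)%:R :> R by rewrite ler_wsqrtr// ler1n.
  by rewrite sqrtr1.
rewrite [leLHS](_ : _ = (Num.sqrt (m j)%:R * (m j)%:R) * (kappa * A * `|th j - c^-1|)); last by ring.
rewrite [leRHS](_ : _ = ((m j)%:R * (m j)%:R) * (kappa * A * `|th j - c^-1|)); last by ring.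
apply: ler_wpM2r; last by rewrite ler_wpM2r.
by rewrite !mulr_ge0// ltW.
Qed.

Lemma w_ge0 j : 0 <= w j.
Proof.
have C1 : 0 <= C * A ^+ 2 by apply: mulr_ge0 => //; exact: sqr_ge0.
have k1 : 0 <= kappa * A by apply: mulr_ge0 => //; exact: ltW.
by rewrite mulr_ge0// addr_ge0// mulr_ge0// sqrtr_ge0.
Qed.

Lemma cvg_w : w j @[j --> \oo] --> 0.
Proof.
have c1 : Num.sqrt ((m j)%:R / a j ^+ 4) @[j --> \oo] --> 0.
  rewrite -[X in _ --> X](sqrtr0 R).
  by apply: continuous_cvg; [exact: sqrt_continuous|exact: ma].
have c2 : `|(m j)%:R ^+ 2 * (g j / a j - c^-1)| @[j --> \oo] --> 0.
  by have := cvg_norm mg; rewrite normr0; exact.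
rewrite -[X in _ --> X](mul0r IH); apply: cvgM; last exact: cvg_cst.
rewrite -[X in _ --> X](addr0 0); apply: cvgD.
  by rewrite -[X in _ --> X](mulr0 (C * A ^+ 2)); apply: cvgM; [exact: cvg_cst|exact: c1].
by rewrite -[X in _ --> X](mulr0 (kappa * A)); apply: cvgM; [exact: cvg_cst|exact: c2].
Qed.

(** The diagonal entries of [y] equal [kappa * IH], so the bias is an average of normalised
    entrywise errors, each at most [w j]. *)
Lemma cvg_trace :
  Num.sqrt (m j)%:R * ((m j)%:R^-1 * (\sum_k G (j := j) k k) - kappa * IH) @[j --> \oo] --> 0.
Proof.
have [N1 h1] := toep_dist.
apply: (@cvgn_squeeze_from _ _ w _ N1) cvg_w => j /h1 h; rewrite subr0.
have yE (k : 'I_(m j)) : y k k = kappa * IH.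
  by rewrite /y /four /IH; congr (_ * _); apply: eq_Rintegral => e _; rewrite subrr mul0r cos0 mulr1.
have -> : Num.sqrt (m j)%:R * ((m j)%:R^-1 * (\sum_k G (j := j) k k) - kappa * IH) =
    (m j)%:R^-1 * \sum_(k < m j) Num.sqrt (m j)%:R * (G k k - y (j := j) k k).
  rewrite -mulr_sumr sumrB (eq_bigr (fun=> kappa * IH) (fun k _ => yE k)).
  by rewrite sumr_const card_ord -mulr_natr; field; rewrite gt_eqF.
rewrite normrM gtr0_norm ?invr_gt0// ler_pdivrMl//.
apply: (le_trans (ler_norm_sum _ _ _)).
apply: (@le_trans _ _ (\sum_(k < m j) w j)); last by rewrite sumr_const card_ord mulr_natl.
apply: ler_sum => k _; rewrite normrM ger0_norm ?sqrtr_ge0//.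
Qed.

Lemma cvg_inv_m : (m j)%:R^-1 @[j --> \oo] --> (0 : R).
Proof.
apply/cvgrPdist_le => e e0.
have [N1 h1] := m_oo (Num.trunc e^-1).+1; exists N1 => // j /= /h1 h.
rewrite sub0r normrN gtr0_norm ?invr_gt0// -[leRHS]invrK lef_pV2 ?posrE ?invr_gt0//.
by apply: ltW; apply: (lt_le_trans (truncnS_gt _)); rewrite ler_nat.
Qed.

Lemma cvg_frob_four : frob2 (y (j := j)) / (m j)%:R @[j --> \oo] --> V.
Proof.
apply/cvgrPdist_le => e e0; have e2 : 0 < e / 2 by lra.
have [D hD] := fejer_limit kappa c0 cH HN HA AN e2.
have cD : `|D| * (m j)%:R^-1 @[j --> \oo] --> 0.
  by rewrite -[X in _ --> X](mulr0 `|D|); apply: cvgM; [exact: cvg_cst|exact: cvg_inv_m].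
move/cvgrPdist_le : cD => /(_ _ e2)[N1 _ h1]; exists N1 => // j /= /h1.
rewrite sub0r normrN ger0_norm ?mulr_ge0 ?invr_ge0// => h2.
rewrite distrC [_ / _]mulrC; apply: (le_trans (hD _ (m0 j))).
have : D / (m j)%:R <= `|D| / (m j)%:R by rewrite ler_wpM2r ?invr_ge0// ler_norm.
lra.
Qed.

Lemma cvg_frob : frob2 (G (j := j)) / (m j)%:R @[j --> \oo] --> V.
Proof.
(* This weight tends to 0, is positive even where [w j = 0], and dominates [w j], so that
   [w^2 / t <= w]. *)
pose t j := w j + j.+1%:R^-1.
have t0 j : 0 < t j by rewrite ltr_wpDl ?w_ge0// invr_gt0.
have [N1 h1] := toep_dist.
have key : frob2 (G (j := j)) / (m j)%:R - frob2 (y (j := j)) / (m j)%:R @[j --> \oo] --> 0.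
  apply: (@cvgn_squeeze_from _ _ (fun j => t j * (frob2 (y (j := j)) / (m j)%:R) + (w j * w j + w j)) _ N1).
    move=> j /h1 h; rewrite subr0 -mulrBl normrM normfV (gtr0_norm (mR j)) ler_pdivrMr//.
    have sm : 0 < Num.sqrt (m j)%:R :> R by rewrite sqrtr_gt0.
    have hd k l : `|G (j := j) k l - y (j := j) k l| <= w j / Num.sqrt (m j)%:R.
      by rewrite ler_pdivlMr// mulrC.
    apply: (le_trans (frob_perturb (t0 j) hd)); rewrite exprMn exprVn sqr_sqrtr ?ler0n//.
    rewrite [leRHS](_ : _ = t j * frob2 (y (j := j)) + (w j * w j + w j) * (m j)%:R); last first.
      by field; rewrite gt_eqF.
    rewrite lerD2l.
    rewrite [leLHS](_ : _ = (w j * w j + w j * ((t j)^-1 * w j)) * (m j)%:R); last by field; rewrite !gt_eqF.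
    rewrite ler_pM2r// lerD2l ler_piMr ?w_ge0// mulrC ler_pdivrMr// mul1r /t lerDl invr_ge0//.
  have ct : t j @[j --> \oo] --> 0.
    by rewrite -[X in _ --> X](addr0 0); apply: cvgD; [exact: cvg_w|exact: cvg_harmonic].
  rewrite -[X in _ --> X](addr0 0); apply: cvgD.
    by rewrite -[X in _ --> X](mul0r V); apply: cvgM; [exact: ct|exact: cvg_frob_four].
  rewrite -[X in _ --> X](addr0 0); apply: cvgD; last exact: cvg_w.
  by rewrite -[X in _ --> X](mulr0 0); apply: cvgM; exact: cvg_w.
have : frob2 (G (j := j)) / (m j)%:R - frob2 (y (j := j)) / (m j)%:R +
    frob2 (y (j := j)) / (m j)%:R @[j --> \oo] --> V.
  by rewrite -[X in _ --> X](add0r V); apply: cvgD; [exact: key|exact: cvg_frob_four].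
by under eq_fun do rewrite subrK.
Qed.

(** One constant [M] bounds the operator norm for all large [j], so [quartic G / m^2] is at most
    [M^2 (frob2 G / m) / m], with [frob2 G / m] convergent. *)
Lemma cvg_quartic : quartic (G (j := j)) / (m j)%:R ^+ 2 @[j --> \oo] --> 0.
Proof.
have [N1 h1] := phi_dist; have [N2 h2] := a_oo A.
have cth : th j @[j --> \oo] --> c^-1.
  have : (a j / g j)^-1 @[j --> \oo] --> c^-1 by apply: cvgV => //; rewrite gt_eqF.
  by apply: cvg_trans; apply: near_eq_cvg; near=> j; rewrite /th invf_div.
(* Half the limit of [th j]: eventually [th j >= c^-1 / 2], whence [pi / th j <= 2 (c pi)]
   uniformly. *)
have c2 : 0 < c^-1 / 2 by rewrite divr_gt0// invr_gt0.
move/cvgrPdist_lt : (cth) => /(_ _ c2)[N3 _ h3].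
have [B hB] : exists B, forall x, `|x| <= A -> H x <= B.
  have AA : - A <= A by rewrite ge0_cp// ltW.
  have [z _ hz] := EVT_max AA (continuous_subspaceT cH).
  by exists (H z) => x xA; apply: hz; rewrite in_itv/= -ler_norml.
have HB x : H x <= B.
  have [/hB//|/HA ->] := leP `|x| A; apply: (le_trans (H0 0)); apply: hB.
  by rewrite normr0 ltW.
have B0 : 0 <= B := le_trans (H0 0) (HB 0).
(* On the support the rescaled density is at most [kappa + C] and [H] at most [B]; adding 1 makes
   [K], and then [M], positive. *)
pose K := (kappa + C) * B + 1.
have K0 : 0 < K by rewrite ltr_wpDl// mulr_ge0// addr_ge0.
pose M := 2 * K * (A + 2 * (c * pi)).
have p0 := pi_gt0 R.
have cp0 : 0 < c * pi by exact: mulr_gt0.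
have M0 : 0 < M by apply: mulr_gt0; [exact: mulr_gt0|apply: addr_gt0 => //; exact: mulr_gt0].
apply: (@cvgn_squeeze_from _ _ (fun j => M ^+ 2 * (frob2 (G (j := j)) / (m j)%:R * (m j)%:R^-1)) _
   (maxn (maxn N1 N2) N3)); last first.
  rewrite -[X in _ --> X](mulr0 (M ^+ 2)); apply: cvgM; first exact: cvg_cst.
  by rewrite -[X in _ --> X](mulr0 V); apply: cvgM; [exact: cvg_frob|exact: cvg_inv_m].
move=> j; rewrite !geq_max => /andP[/andP[/h1 hphi /h2 aA] /h3 /= hth].
rewrite subr0.
have th0 : 0 < th j by exact: divr_gt0.
have thc : pi / th j <= 2 * (c * pi).
  rewrite ler_pdivrMr// -ler_pdivrMl ?mulr_gt0//.
  have : c^-1 / 2 <= th j by move: hth; rewrite ltr_norml => /andP[? ?]; lra.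
  apply: le_trans; rewrite le_eqVlt; apply/orP; left; apply/eqP.
  by rewrite !invfM -!mulrA mulVf ?gt_eqF// mulr1 mulrC.
have phi0 e : 0 <= phi j e <= K.
  rewrite mulr_ge0//=.
  have [eA|/HA e0] := leP `|e| A; last by rewrite /phi e0 mulr0 ltW.
  have eaj : `|(a j)^-1 * e| <= 1.
    by rewrite normrM normfV (gtr0_norm (a0 j)) mulrC ler_pdivrMr// mul1r (le_trans eA)// ltW.
  have Fk : F ((a j)^-1 * e) <= kappa + C.
    have := FC eaj; rewrite ler_norml => /andP[_]; rewrite lerBlDl => h.
    apply: (le_trans h); rewrite lerD2l ler_piMr//.
    by rewrite -(real_normK (num_real _)) expr_le1.
  apply: (@le_trans _ _ ((kappa + C) * B)); last by rewrite /K lerDl.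
  by apply: ler_pM.
have phiA e : A < `|e| -> phi j e = 0 by move=> /HA h; rewrite /phi h mulr0.
have Gq u : qform (G (j := j)) u <= M * \sum_k u k ^+ 2.
  apply: (le_trans (toep_qform_le u (iphi j) th0 A0 phi0 phiA)).
  rewrite ler_wpM2r//; first by apply: sumr_ge0 => k _; exact: sqr_ge0.
  by apply: ler_wpM2l; [apply: mulr_ge0 => //; exact: ltW|rewrite lerD2l].
have Gs k l : G (j := j) k l = G l k by exact: toep_sym.
have Gp u : 0 <= qform (G (j := j)) u.
  by apply: toep_qform_ge0; [exact: iphi|move=> e; case/andP: (phi0 e)].
have q := quartic_le M0 Gs Gp Gq.
have frob0 : 0 <= quartic (G (j := j)).
  rewrite /quartic (eq_bigr (fun k => \sum_a \sum_l \sum_b G k l * G a b * (G k a * G l b))); last first.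
    by move=> k _; rewrite exchange_big.
  rewrite exchange_big; apply: sumr_ge0 => x _; rewrite exchange_big; apply: sumr_ge0 => l _.
  rewrite (_ : \sum_k _ = (\sum_k G k l * G k x) ^+ 2) ?sqr_ge0//.
  rewrite expr2 mulr_suml; apply: eq_bigr => k _; rewrite mulr_sumr; apply: eq_bigr => b _.
  by rewrite (Gs b l) (Gs b x); ring.
rewrite ger0_norm ?divr_ge0 ?sqr_ge0//.
rewrite [leRHS](_ : _ = M ^+ 2 * frob2 (G (j := j)) / (m j)%:R ^+ 2); last by field; rewrite gt_eqF.
by rewrite ler_wpM2r// invr_ge0 sqr_ge0.
Unshelve. all: by end_near. Qed.
End covariance_limits.

Lemma sumZ_eventually (R : realType) (u : int -> R) N :
  (forall k, (N <= k)%N -> u (Posz k) = 0 /\ u (- Posz k.+1)%R = 0) ->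
  sumZ u = \sum_(0 <= k < N) (u (Posz k) + u (- Posz k.+1)%R).
Proof.
move=> h; apply/cvg_lim => //; apply: cvg_near_cst; exists N => // n /= Nn.
rewrite (big_cat_nat (leq0n N) Nn)/= [X in _ + X = _](_ : _ = 0) ?addr0//.
apply: big1_seq => k; rewrite mem_index_iota => /andP[_ /andP[Nk _]].
by have [-> ->] := h k Nk; rewrite addr0.
Qed.

Theorem theorem2 (R : realType) (d : measure_display) (T : measurableType d)
  (P : probability T R) (X : R -> T -> R)
  (s0 alpha : R) (h : R -> R) (psi : R -> R) (A : R)
  (a : nat -> R) (m : nat -> nat) (b : nat -> int -> R)
  (gamma : nat -> R) (c : R) :
  (* parameters *)
  1 < s0 -> 0 < alpha < 2^-1 ->
  (* h *)
  (forall x, h (- x) = h x) -> (forall x, 0 <= h x) ->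
  (exists M : R, forall x, `|h x| <= M) ->
  (forall k, (k < 4)%N -> forall x, derivable (derive1n k h) x 1) ->
  continuous (derive1n 4 h) ->
  (forall i, (1 <= i <= 4)%N -> derive1n i h 0 = 0) ->
  h 0 = 1 ->
  (exists e : R, 0 < e /\ forall x, `|x - s0| < e -> 0 < h x /\ 0 < h (- x)) ->
  (forall eps : R, 0 < eps ->
     (@lebesgue_measure R).-integrable [set: R]
       (fun l => (h l * (1 + `|l|) `^ (- eps))%:E)) ->
  (* X : measurable, mean-square continuous, zero-mean Gaussian, stationary
     with spectral density f = spec_dens h s0 alpha *)
  measurable_fun [set: R * T] (fun p : R * T => X p.1 p.2) ->
  gaussian_process P X ->
  (forall t, ('E_P[X t] = 0)%E) ->
  (forall t s, ('E_P[fun w => (X t w * X s w)%R] =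
     \int[@lebesgue_measure R]_(l in [set: R])
        (cos (l * (t - s)) * spec_dens h s0 alpha l)%R%:E)%E) ->
  (forall t, ('E_P[fun w => ((X s w - X t w) ^+ 2)%R] @[s --> t] --> 0%E)%E) ->
  (* psi *)
  (@lebesgue_measure R).-integrable [set: R] (EFin \o psi) ->
  0 < A ->
  (forall l, A < `|l| -> FTre psi l = 0 /\ FTim psi l = 0) ->
  bounded_variation (- A) A (FTre psi) -> bounded_variation (- A) A (FTim psi) ->
  (* sequences *)
  (forall j, 0 < a j) -> (forall i j, (i < j)%N -> a i < a j) ->
  (forall M : R, exists j, M < a j) ->
  (forall j, (0 < m j)%N) -> {homo m : i j / (i <= j)%N >-> (i <= j)%N} ->
  (forall N : nat, exists j, (N <= m j)%N) ->
  (* hypotheses of the theorem *)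
  (forall j, 0 < gamma j) ->
  (forall j (k l : int), b j k - b j l = gamma j * (k - l)%:~R) ->
  0 < c ->
  a j / gamma j @[j --> \oo] --> c ->
  (m j)%:R ^+ 2 * (gamma j / a j - c^-1) @[j --> \oo] --> 0 ->
  (m j)%:R / a j ^+ 4 @[j --> \oo] --> 0 ->
  cvg_law_gauss P
    (fun j w => Num.sqrt (m j)%:R *
       ((m j)%:R^-1 * (\sum_(1 <= k < (m j).+1) wcoef psi X a b j (Posz k) w ^+ 2)
        - s0 `^ (- (4 * alpha)) * RintR (FTabs2 psi)))
    (4 * c * pi * s0 `^ (- (8 * alpha)) *
       Rintegral (@lebesgue_measure R) `[- (c * pi), c * pi]
         (fun e => sumZ (fun n : int => FTabs2 psi (e + 2 * n%:~R * c * pi)) ^+ 2)).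
Proof.
move=> s1 al hN h_ge0 _ hd _ hi h0 _ _ mX gX EX covX msX ipsi A0 psiA _ _.
move=> a0 a_incr a_unb m0 m_homo m_unb g0 bg c0 ag mg ma.
set H := FTabs2 psi; set F := spec_dens h s0 alpha; pose kappa := s0 `^ (- (4 * alpha)).
have mF : measurable_fun [set: R] F by exact: measurable_spec_dens hd.
have F0 x : 0 <= F x by exact: spec_dens_ge0.
have [C C0 FC] : exists2 C, 0 <= C & forall x, `|x| <= 1 -> `|F x - kappa| <= C * x ^+ 2.
  by apply: spec_dens_quad => //; exact: hi.
have cH : continuous H by exact: continuous_FTabs2.
have HN x : H (- x) = H x by exact: FTabs2N.
have H0 x : 0 <= H x by exact: FTabs2_ge0.
have HA x : A < `|x| -> H x = 0.
  by move=> /psiA[h1 h2]; rewrite /H /FTabs2 h1 h2 expr0n/= addr0.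
have k0 : 0 <= kappa by exact: powR_ge0.
have p0 := pi_gt0 R.
have L0 : 0 < c * pi by exact: mulr_gt0.
(* Enough windows to cover the support of [H] even after a shift by up to [c * pi], as the folding
   of Fejer's convolution requires. *)
pose N := (Num.trunc ((A + 2 * (c * pi)) / (2 * (c * pi)))).+1.
have AN : A + c * pi < (2 * N%:R - 1) * (c * pi).
  have : (A + 2 * (c * pi)) / (2 * (c * pi)) < N%:R by exact: truncnS_gt.
  by rewrite ltr_pdivrMr ?mulr_gt0//; lra.
have a_oo := unbounded_incr_from a_incr a_unb.
have m_oo := unbounded_homo_from m_homo m_unb.
pose Z j (i : 'I_(m j)) := wcoef psi X a b j (Posz i.+1).
pose phi j (e : R) := F ((a j)^-1 * e) * H e.
have iphi j : Rintegrable (@lebesgue_measure R) (phi j).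
  exact: (Rintegrable_phi mX gX EX mF F0 covX ipsi (a0 j)).
pose G j := toep (phi j) (gamma j / a j) (m := m j).
have gv j : gaussian_vec P (Z j) (G j).
  exact: (wavelet_gaussian_vec mX gX EX mF F0 covX msX ipsi (a0 j) (bg j)).
pose S := shiftsum c N H.
have SE e : e \in `[- (c * pi), c * pi] ->
    sumZ (fun n : int => H (e + 2 * n%:~R * c * pi)) = S e.
  rewrite in_itv/= => /andP[e1 e2].
  (* For [e] in the window, both translates of index [k >= N] leave the support of [H], so the
     series over the integers is the finite sum [S]. *)
  rewrite (@sumZ_eventually _ _ N) => [|k Nk].
    apply: eq_bigr => k _; congr (H _ + H _); first by rewrite -pmulrn; ring.
    by rewrite rmorphN/= -pmulrn; ring.
  have NkR : N%:R <= k%:R :> R by rewrite ler_nat.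
  have NkL : N%:R * (c * pi) <= k%:R * (c * pi) by rewrite ler_pM2r.
  split; apply: HA.
    apply: lt_le_trans (ler_norm _); rewrite -pmulrn; lra.
  rewrite rmorphN/= -pmulrn -normrN; apply: lt_le_trans (ler_norm _); rewrite -natr1; lra.
set V := (X in cvg_law_gauss _ _ X).
have kk : s0 `^ (- (8 * alpha)) = kappa ^+ 2.
  rewrite /kappa -powR_mulrn ?powR_ge0// -powRrM; congr (_ `^ _).
  by rewrite -[2%:R]/(2 : R); ring.
pose I2 := \int[@lebesgue_measure R]_(t in `[- (c * pi), c * pi]) S t ^+ 2.
(* The outer 2 is that of [2 tr G^2 / m]; the other factor is the limit given by [cvg_frob]. *)
have VE : V = 2 * (2 * (c * pi) * kappa ^+ 2 * I2).
  rewrite /V kk (_ : \int[_]_(_ in _) _ = I2); first by ring.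
  by apply: eq_Rintegral => e; rewrite inE => /SE ->.
have V0 : 0 <= V.
  have I20 : 0 <= I2 by apply: Rintegral_ge0 => // t _; exact: sqr_ge0.
  by rewrite VE !mulr_ge0 ?sqr_ge0// ltW.
have qE : (fun j w => Num.sqrt (m j)%:R *
       ((m j)%:R^-1 * (\sum_(1 <= k < (m j).+1) wcoef psi X a b j (Posz k) w ^+ 2)
        - s0 `^ (- (4 * alpha)) * RintR (FTabs2 psi))) =
    (fun j => quad_dev (Z j) (kappa * RintR H)).
  apply/funext => j; apply/funext => w; congr (_ * (_ * _ - _)).
  by rewrite big_add1/= big_mkord.
rewrite qE; apply: (quad_clt m0 gv V0).
- have cf := cvg_frob c0 A0 k0 C0 cH HN H0 HA AN FC a0 a_oo m0 m_oo mg ma iphi.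
  rewrite VE; under eq_fun do rewrite -mulrA.
  by apply: cvgM; [exact: cvg_cst|exact: cf].
- exact: (cvg_quartic c0 A0 k0 C0 cH HN H0 HA AN F0 FC a0 a_oo g0 m0 m_oo ag mg ma iphi).
- exact: (cvg_trace A0 k0 C0 cH H0 HA FC a0 a_oo m0 mg ma iphi).
Qed.
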